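(* For every admissible signed measure $\mu$ on $\mathbb{R}$, $\tilde{\mathcal{G}}[\mu]\ge\frac12$, with equality if and only if $\mu$ is of Type I, i.e. $\mu=\mu_{\mathrm I}(\cdot/\lambda)$ for some $\lambda>0$.
   Context: Let $\tilde W(x)=-\log|x|$ on $\mathbb{R}$. Signed measures: $\mu_{\mathrm I}=-1+\frac{\sqrt{x^2-\pi^{-2}}}{|x|}\chi_{\{|x|\ge\pi^{-1}\}}+\delta_0$; $\mu_{\mathrm{II},R}=-1+\frac{\sqrt{(x^2-R^2)x^2}}{|x^2-1|}\chi_{\{|x|\ge R\}}+\frac{\pi\sqrt{R^2-1}}2(\delta_1+\delta_{-1})$; $\mu_{\mathrm{III},L,R}=-1+\frac{\sqrt{(x^2-R^2)(x^2-L^2)}}{|x^2-1|}\chi_{\{|x|\in[0,L]\cup[R,\infty)\}}+\frac{\pi\sqrt{(R^2-1)(1-L^2)}}2(\delta_1+\delta_{-1})$ for $0<L<1<R$. Let $\Phi(L,R)=\mathrm{p.v.}\int_L^R\frac{\pi\sqrt{(R^2-x^2)(x^2-L^2)}}{x^2-1}dx$; $R_c>1$ is the unique root of $\sqrt{R^2-1}\ln(R+\sqrt{R^2-1})-R=0$, and for $1<R<R_c$, $L(R)\in(0,1)$ is the unique number with $\Phi(L(R),R)=0$. For $\lambda>0$, $\mu(\cdot/\lambda)$ denotes $\lambda$ times the push-forward of $\mu$ under $x\mapsto\lambda x$ (density $f(x/\lambda)$, and each mass $a\delta_p$ becomes $\lambda a\delta_{\lambda p}$). $\mu$ is admissible if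 it equals $\mu_{\mathrm I}(\cdot/\lambda)$, or $\mu_{\mathrm{II},R}(\cdot/\lambda)$ with $R\ge R_c$, or $\mu_{\mathrm{III},L(R),R}(\cdot/\lambda)$ with $1<R<R_c$, for some $\lambda>0$. Define $\tilde{\mathcal{H}}[\mu]=\int_{\mathbb{R}}(\tilde W*\mu)(x)\,dx$ with $(\tilde W*\mu)(x)=\int-\log|x-y|\,d\mu(y)$; $\tilde{\mathcal{D}}[\mu_{\mathrm I}(\cdot/\lambda)]=\lambda$; $\tilde{\mathcal{D}}[\mu]=\mu([-\lambda,\lambda])$ for $\mu$ of the second or third kind with scaling $\lambda$; and $\tilde{\mathcal{G}}[\mu]=\tilde{\mathcal{H}}[\mu]/\tilde{\mathcal{D}}[\mu]^2$. *)

(* Defs.v *)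
From HB Require Import structures.
From mathcomp Require Import all_boot all_order all_algebra.
From mathcomp Require Import all_classical all_reals all_analysis.
Set Implicit Arguments. Unset Strict Implicit. Unset Printing Implicit Defensive.
Import Order.TTheory GRing.Theory Num.Theory.
Import numFieldNormedType.Exports.
Local Open Scope classical_set_scope.
Local Open Scope ring_scope.

Section Defs.
Variable R : realType.

(* A signed measure of the form  dens(x) dx + sum_i a_i delta_{p_i}
   (atoms = list of pairs (p_i, a_i)). *)
Record smeas := SMeas { dens : R -> R ; atoms : seq (R * R) }.

Definition scale (lam : R) (m : smeas) : smeas :=
  SMeas (fun x => dens m (x / lam)) [seq (lam * p.1, lam * p.2) | p <- atoms m].

Definition muI : smeas :=
  SMeas (fun x => -1 + (if pi^-1 <= `|x| then Num.sqrt (x ^+ 2 - pi ^- 2) / `|x| else 0))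
        [:: (0, 1)].

Definition muII (Rr : R) : smeas :=
  SMeas (fun x => -1 + (if Rr <= `|x|
                        then Num.sqrt ((x ^+ 2 - Rr ^+ 2) * x ^+ 2) / `|x ^+ 2 - 1|
                        else 0))
        [:: (1, pi * Num.sqrt (Rr ^+ 2 - 1) / 2); (-1, pi * Num.sqrt (Rr ^+ 2 - 1) / 2)].

Definition muIII (L Rr : R) : smeas :=
  SMeas (fun x => -1 + (if (`|x| <= L) || (Rr <= `|x|)
                        then Num.sqrt ((x ^+ 2 - Rr ^+ 2) * (x ^+ 2 - L ^+ 2)) / `|x ^+ 2 - 1|
                        else 0))
        [:: (1, pi * Num.sqrt ((Rr ^+ 2 - 1) * (1 - L ^+ 2)) / 2);
            (-1, pi * Num.sqrt ((Rr ^+ 2 - 1) * (1 - L ^+ 2)) / 2)].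

Definition Phi_integrand (L Rr : R) (x : R) : R :=
  pi * Num.sqrt ((Rr ^+ 2 - x ^+ 2) * (x ^+ 2 - L ^+ 2)) / (x ^+ 2 - 1).

Definition Phi (L Rr : R) : R :=
  lim ((\int[lebesgue_measure]_(x in `[L, 1 - e]) Phi_integrand L Rr x
        + \int[lebesgue_measure]_(x in `[1 + e, Rr]) Phi_integrand L Rr x)
       @[e --> 0^'+]).

(* R_c > 1 : the unique root of sqrt(R^2-1) ln(R + sqrt(R^2-1)) - R = 0 *)
Definition Rc : R :=
  get [set r : R | 1 < r /\
       Num.sqrt (r ^+ 2 - 1) * ln (r + Num.sqrt (r ^+ 2 - 1)) - r = 0].

(* L(R) in (0,1) : the unique number with Phi(L(R), R) = 0 *)
Definition LofR (Rr : R) : R := get [set l : R | 0 < l < 1 /\ Phi l Rr = 0].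

(* Parameters of admissible measures: kind I (lambda), kind II (lambda, R),
   kind III (lambda, R) with L = L(R). *)
Inductive adm_data := AI of R | AII of R & R | AIII of R & R.

Definition admissible (a : adm_data) : Prop :=
  match a with
  | AI l => 0 < l
  | AII l r => 0 < l /\ Rc <= r
  | AIII l r => 0 < l /\ 1 < r /\ r < Rc
  end.

Definition measure_of (a : adm_data) : smeas :=
  match a with
  | AI l => scale l muI
  | AII l r => scale l (muII r)
  | AIII l r => scale l (muIII (LofR r) r)
  end.

Definition potential (m : smeas) (x : R) : R :=
  \int[lebesgue_measure]_(y in setT) (- ln `|x - y| * dens m y)
  + \sum_(p <- atoms m) p.2 * (- ln `|x - p.1|).

Definition Ht (m : smeas) : R := \int[lebesgue_measure]_(x in setT) potential m x.

Definition mass_interval (m : smeas) (l : R) : R :=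
  \int[lebesgue_measure]_(x in `[- l, l]) dens m x
  + \sum_(p <- atoms m | (- l <= p.1) && (p.1 <= l)) p.2.

Definition Dt (a : adm_data) : R :=
  match a with
  | AI l => l
  | AII l _ => mass_interval (measure_of a) l
  | AIII l _ => mass_interval (measure_of a) l
  end.

Definition Gt (a : adm_data) : R := Ht (measure_of a) / Dt a ^+ 2.

End Defs.

(* Main.v *)
(** All the densities are even, neutral (total mass zero) and behave like
    [- kappa / x^2] at infinity. For such a measure the integrated potential is
    [pi^2 * kappa]: write the density as [g - kappa / (1 + |y|)^2] with
    [g = O(|y|^-3)]. Fubini applies to [g], because the even part
    [ln |x| - (ln |x - y| + ln |x + y|) / 2] of the kernel is integrable in [x],
    with integral [0]; the potential of [(1 + |y|)^-2] is explicit, and its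
    integral is computed by Tonelli.

    Type I is neutral by a direct computation, with [kappa = (2 * pi^2)^-1].
    For types II and III, put [A = L^2], [B = R^2] ([A = 0] for type II) and
    [d = A + B - 2]; then [kappa = d / 2], and the claim is that the mass [D] of
    [[-1, 1]] satisfies [0 < D < pi * sqrt d]. The case [A = 0] is elementary, and
    [R_c] is only needed through [sqrt (R_c^2 - 1) >= 5 / 4]. The total mass is
    constant along [(B - 1) * (1 - A) = c], because its derivative is the
    difference of two elliptic integrals exchanged by [x -> R * L / x].

    For type III the condition [Phi (L, R) = 0] reads
    [pi * d / 4 = int_L^R sqrt ((R^2 - x^2) (x^2 - L^2)) / (1 + x) dx]. Replacing
    [1 / (1 + x)] by expressions in [x] and [1 / x] that touch it at [x = 1] gives two
    polynomial constraints on [p = R^2 - 1] and [q = 1 - L^2]; with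
    [D <= pi * sqrt (p * q) - (q + p * q - d)] they force [D < pi * sqrt d]. *)

Require Import Defs.
From HB Require Import structures.
From mathcomp Require Import all_boot all_order all_algebra.
From mathcomp Require Import all_classical all_reals all_analysis.
From mathcomp Require Import measurable_realfun ring lra.
Set Implicit Arguments. Unset Strict Implicit. Unset Printing Implicit Defensive.
Import Order.TTheory GRing.Theory Num.Theory.
Import numFieldNormedType.Exports.
Local Open Scope classical_set_scope.
Local Open Scope ring_scope.

(** For types II and III the integrated potential is [pi^2 * d * l^2 / 2] and the mass is [l * D],
    so the strict inequality is exactly [D^2 < pi^2 * d], whatever the scaling [l]. The reason for
    subtracting a reference density is that the L1 norm in [x] of the symmetrised kernel is
    proportional to [|y|]: against a tail in [y^-2] the double integral diverges absolutely, against
    [|y|^-3] it converges. The delicate regime of type III is [R] near 1. There [L] is near 1 as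
    well, and with [m = (p + q) / 2] one finds [d] close to [m^2 / 2] and both [q] and
    [P = sqrt (p * q)] close to [m]. The final comparison then degenerates to
    [1 - 1 / sqrt 2 < 3 / 10], where [3 / 10] is the inverse of the bound [10 / 3] on [pi]; the
    margin is below [1 / 100]. This is why the bounds on [1 / (1 + x)] have to be exact at [x = 1].
    The conventions [Num.sqrt x = 0] for [x < 0] and [0^-1 = 0] are used throughout: one formula
    describes a density both on its gap and off it. *)

Ltac neq := let H := fresh in apply/eqP => H; lra.

(** * Derivatives, limits and the fundamental theorem *)

Section Derivatives.
Context {R : realType}.
Implicit Types (f g : R -> R) (x a b : R).

Lemma isder_add f g x a b : is_derive x 1 f a -> is_derive x 1 g b ->
  is_derive x 1 (fun t => f t + g t) (a + b).
Proof. by move=> ? ?; exact: is_deriveD. Qed.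

Lemma isder_eq f x a b : is_derive x 1 f a -> a = b -> is_derive x 1 f b.
Proof. by move=> df <-. Qed.

Lemma isder_cst (c : R) x : is_derive x 1 (fun _ : R => c) 0.
Proof. exact: is_derive_cst. Qed.

Lemma isder_opp f x a : is_derive x 1 f a -> is_derive x 1 (fun t => - f t) (- a).
Proof. by move=> ?; exact: is_deriveN. Qed.

Lemma isder_mul f g x a b : is_derive x 1 f a -> is_derive x 1 g b ->
  is_derive x 1 (fun t => f t * g t) (a * g x + f x * b).
Proof.
move=> df dg; apply: (is_derive_eq (is_deriveM df dg)).
by rewrite addrC; congr (_ + _); exact: mulrC.
Qed.

Lemma isder_comp f g x a b : is_derive (g x) 1 f a -> is_derive x 1 g b ->
  is_derive x 1 (fun t => f (g t)) (a * b).
Proof. by move=> ? ?; apply: is_derive1_comp. Qed.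

Lemma isder_pow f x a n : is_derive x 1 f a ->
  is_derive x 1 (fun t => f t ^+ n) (n%:R * f x ^+ n.-1 * a).
Proof.
move=> df; rewrite (_ : (fun t => _) = f ^+ n); last first.
  by apply/funext => t; rewrite exprfctE.
exact: is_deriveX.
Qed.

Lemma isder_inv f x a : f x != 0 -> is_derive x 1 f a ->
  is_derive x 1 (fun t => (f t)^-1) (- a / f x ^+ 2).
Proof.
move=> fx0 df; apply: (is_derive_eq (is_deriveV fx0 df)).
by rewrite /GRing.scale/= !mulNr mulrC.
Qed.

Lemma isder_sqrt f x a : 0 < f x -> is_derive x 1 f a ->
  is_derive x 1 (fun t => Num.sqrt (f t)) ((2 * Num.sqrt (f x))^-1 * a).
Proof. by move=> ? ?; apply: isder_comp; exact: is_derive1_sqrt. Qed.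

Lemma isder_ln f x a : 0 < f x -> is_derive x 1 f a ->
  is_derive x 1 (fun t => ln (f t)) ((f x)^-1 * a).
Proof. by move=> ? ?; apply: isder_comp; exact: is_derive1_ln. Qed.

Lemma isder_atan f x a : is_derive x 1 f a ->
  is_derive x 1 (fun t => atan (f t)) ((1 + f x ^+ 2)^-1 * a).
Proof. by move=> ?; apply: isder_comp. Qed.

Lemma isder_near f g x a : (\near x, g x = f x) -> is_derive x 1 g a ->
  is_derive x 1 f a.
Proof. exact: near_eq_is_derive. Qed.

(** By continuity [f] keeps its sign near [x], so [ln |f|] is locally [ln f] or [ln (- f)]. *)
Lemma isder_lnabs f x a : f x != 0 -> is_derive x 1 f a ->
  is_derive x 1 (fun t => ln `|f t|) ((f x)^-1 * a).
Proof.
move=> fx0 df; have cf : {for x, continuous f}.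
  by apply/differentiable_continuous/derivable1_diffP; case: df.
move: fx0; rewrite neq_lt => /orP[f0|f0].
  apply: (@isder_near _ (fun t => ln (- f t))).
    near=> t; rewrite [in RHS]ltr0_norm//; near: t.
    by move/cvgrPdist_lt: cf => /(_ (- f x)); rewrite oppr_gt0 => /(_ f0);
      apply: filterS => t; rewrite ltr_norml => /andP[? ?]; lra.
  have fN : 0 < - f x by lra.
  apply: (is_derive_eq (@isder_ln (fun t => - f t) x _ fN (isder_opp df))).
  by rewrite invrN mulrNN.
apply: (@isder_near _ (fun t => ln (f t))).
  near=> t; rewrite [in RHS]gtr0_norm//; near: t.
  by move/cvgrPdist_lt: cf => /(_ _ f0);
    apply: filterS => t; rewrite ltr_norml => /andP[? ?]; lra.
exact: isder_ln.
Unshelve. all: by end_near. Qed.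

Lemma isder_continuous f x a : is_derive x 1 f a -> {for x, continuous f}.
Proof.
by move=> df; apply/differentiable_continuous/derivable1_diffP; case: df.
Qed.

End Derivatives.

Ltac der :=
  first [exact: is_derive_cst | lazymatch goal with
  | |- is_derive _ _ (fun x => x) _ => exact: is_derive_id
  | |- is_derive _ _ (fun x => @?f x + @?g x) _ => eapply (@isder_add _ f g); der
  | |- is_derive _ _ (fun x => - @?f x) _ => eapply (@isder_opp _ f); der
  | |- is_derive _ _ (fun x => @?f x * @?g x) _ => eapply (@isder_mul _ f g); der
  | |- is_derive _ _ (fun x => (@?f x) ^+ ?n) _ => eapply (@isder_pow _ f _ _ n); der
  | |- is_derive _ _ (fun x => (@?f x) ^-1) _ => eapply (@isder_inv _ f); [|der]
  | |- is_derive _ _ (fun x => Num.sqrt (@?f x)) _ => eapply (@isder_sqrt _ f); [|der]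
  | |- is_derive _ _ (fun x => ln `|@?f x|) _ => eapply (@isder_lnabs _ f); [|der]
  | |- is_derive _ _ (fun x => ln (@?f x)) _ => eapply (@isder_ln _ f); [|der]
  | |- is_derive _ _ (fun x => atan (@?f x)) _ => eapply (@isder_atan _ f); der
  | |- _ => try eassumption
  end].

(* Vanilla [eapply], so that typeclass resolution does not pick the derivative. *)
Ltac isder := eapply isder_eq; [der|].

Section Limits.
Context {R : realType} {T : Type} {F : set_system T} {FF : Filter F}.
Implicit Types (f g : T -> R) (a b : R).

Lemma fcvg_eq f a b : fmap f F --> a -> a = b -> fmap f F --> b.
Proof. by move=> + <-. Qed.

Lemma fcvg_add f g a b : fmap f F --> a -> fmap g F --> b ->
  fmap (fun t => f t + g t) F --> a + b.
Proof. by move=> fa gb; exact: cvgD. Qed.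

Lemma fcvg_opp f a : fmap f F --> a -> fmap (fun t => - f t) F --> - a.
Proof. by move=> fa; exact: cvgN. Qed.

Lemma fcvg_mul f g a b : fmap f F --> a -> fmap g F --> b ->
  fmap (fun t => f t * g t) F --> a * b.
Proof. by move=> fa gb; exact: cvgM. Qed.

Lemma fcvg_pow f a n : fmap f F --> a -> fmap (fun t => f t ^+ n) F --> a ^+ n.
Proof.
move=> fa; elim: n => [|n IH].
  by under eq_fun do rewrite expr0; exact: cvg_cst.
by under eq_fun do rewrite exprS; rewrite exprS; exact: cvgM.
Qed.

Lemma fcvg_comp (h : R -> R) f a : {for a, continuous h} -> fmap f F --> a ->
  fmap (fun t => h (f t)) F --> h a.
Proof. by move=> ch fa; exact: cvg_comp fa ch. Qed.

Lemma fcvg_ln f a : 0 < a -> fmap f F --> a -> fmap (fun t => ln (f t)) F --> ln a.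
Proof. by move=> a0; apply: fcvg_comp; exact: continuous_ln. Qed.

Lemma fcvg_inv f a : a != 0 -> fmap f F --> a -> fmap (fun t => (f t)^-1) F --> a^-1.
Proof. by move=> a0; apply: (@fcvg_comp (fun x => x^-1)); exact: inv_continuous. Qed.

Lemma fcvg_norm f a : fmap f F --> a -> fmap (fun t => `|f t|) F --> `|a|.
Proof. by move=> fa; exact: cvg_norm. Qed.

Lemma fcvg_sqrt f a : fmap f F --> a ->
  fmap (fun t => Num.sqrt (f t)) F --> Num.sqrt a.
Proof. by apply: fcvg_comp; exact: sqrt_continuous. Qed.

Lemma fcvg_atan f a : fmap f F --> a -> fmap (fun t => atan (f t)) F --> atan a.
Proof. by apply: fcvg_comp; exact: continuous_atan. Qed.

End Limits.

Ltac lims :=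
  first [eassumption | refine (cvg_cst _); solve_constraints | lazymatch goal with
  | |- cvg_to (nbhs (fmap (fun x => x) _)) _ => refine cvg_id
  | |- cvg_to (nbhs (fmap (fun x => @?f x + @?g x) ?F)) _ => eapply (fcvg_add (F := F) (f := f) (g := g)); lims
  | |- cvg_to (nbhs (fmap (fun x => - @?f x) ?F)) _ => eapply (fcvg_opp (F := F) (f := f)); lims
  | |- cvg_to (nbhs (fmap (fun x => @?f x * @?g x) ?F)) _ => eapply (fcvg_mul (F := F) (f := f) (g := g)); lims
  | |- cvg_to (nbhs (fmap (fun x => (@?f x) ^+ ?n) ?F)) _ => eapply (fcvg_pow (F := F) (f := f) (n := n)); lims
  | |- cvg_to (nbhs (fmap (fun x => (@?f x)^-1) ?F)) _ => eapply (fcvg_inv (F := F) (f := f)); [|lims]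
  | |- cvg_to (nbhs (fmap (fun x => Num.sqrt (@?f x)) ?F)) _ => eapply (fcvg_sqrt (F := F) (f := f)); lims
  | |- cvg_to (nbhs (fmap (fun x => `|@?f x|) ?F)) _ => eapply (fcvg_norm (F := F) (f := f)); lims
  | |- cvg_to (nbhs (fmap (fun x => ln (@?f x)) ?F)) _ => eapply (fcvg_ln (F := F) (f := f)); [|lims]
  | |- cvg_to (nbhs (fmap (fun x => atan (@?f x)) ?F)) _ => eapply (fcvg_atan (F := F) (f := f)); lims
  | |- _ => idtac
  end].

(* An alias of [is_derive] hidden from typeclass resolution. *)
Definition has_der {R : realType} (F : R -> R) (x d : R) : Prop := is_derive x 1 F d.

Section FTC.
Context {R : realType}.
Let mu := @lebesgue_measure R.
Implicit Types (f F : R -> R) (a b : R).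

(** Improper fundamental theorem: it is applied on the compact intervals [[u n, v n]], and monotone
    convergence passes to their union. The primitive only needs limits along [u] and [v], so it may
    be singular at the ends of [D]. *)
Lemma ge0_FTC_bigcup f F (D : set R) (u v : R^nat) (A B : R) :
  nonincreasing_seq u -> nondecreasing_seq v -> (forall n, u n < v n) ->
  (forall x, D x -> exists n, u n <= x <= v n) ->
  (forall n x, u n <= x <= v n -> D x) ->
  (forall x, D x -> 0 <= f x) ->
  (forall x, D x -> {for x, continuous f}) ->
  (forall x, D x -> has_der F x (f x)) ->
  F (u n) @[n --> \oo] --> A -> F (v n) @[n --> \oo] --> B ->
  (\int[mu]_(x in D) (f x)%:E = (B - A)%:E)%E.
Proof.
move=> ndu ndv uv Dsub subD f0 cf dF FA FB.
pose E n := `[u n, v n]%classic.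
have DE : D = \bigcup_n E n.
  apply/seteqP; split => x.
    by move=> /Dsub[n ?]; exists n => //=; rewrite in_itv.
  by move=> [n _]; rewrite /E/= in_itv/=; exact: subD.
have cE n : {within E n, continuous f}.
  apply: continuous_in_subspaceT => x; rewrite inE/E/= in_itv/= => /subD.
  exact: cf.
have intE n : (\int[mu]_(x in E n) (f x)%:E = (F (v n) - F (u n))%:E)%E.
  have inD x : u n <= x <= v n -> D x by exact: subD.
  rewrite EFinB; apply: (continuous_FTC2 (uv n)); first exact: cE.
  - split => [x| |].
    + rewrite in_itv/= => /andP[ux xv].
      by have [] : is_derive x 1 F (f x)
        by apply: dF; apply: inD; apply/andP; split; exact: ltW.
    + apply: cvg_at_right_filter; apply: (@isder_continuous _ _ _ (f (u n))).
      by apply: dF; apply: inD; rewrite lexx ltW.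
    + apply: cvg_at_left_filter; apply: (@isder_continuous _ _ _ (f (v n))).
      by apply: dF; apply: inD; rewrite lexx ltW.
  - move=> x; rewrite in_itv/= => /andP[ux xv]; rewrite derive1E.
    have := dF x (inD x _); rewrite (ltW ux) (ltW xv) => /(_ isT) dFx.
    by have [] : is_derive x 1 F (f x) by exact: dFx.
have c1 : (\int[mu]_(x in E n) (f x)%:E @[n --> \oo] -->
    \int[mu]_(x in D) (f x)%:E)%E.
  rewrite DE; apply: ge0_nondecreasing_set_cvg_integral.
  - move=> m n mn; apply/subsetPset => x; rewrite /E/= !in_itv/=.
    by move=> /andP[h1 h2]; rewrite (le_trans (ndu _ _ mn))//= (le_trans h2)//; exact: ndv.
  - by move=> n; exact: measurable_itv.
  - move=> n; apply/measurable_EFinP.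
    by apply: subspace_continuous_measurable_fun => //; exact: measurable_itv.
  - by move=> n x; rewrite /E/= in_itv/= lee_fin => /subD/f0.
have c2 : (\int[mu]_(x in E n) (f x)%:E @[n --> \oo] --> (B - A)%:E)%E.
  under eq_fun do rewrite intE.
  by apply: cvg_EFin; [exact: nearW|exact: cvgB].
exact: cvg_unique c1 c2.
Qed.

Lemma ge0_FTCoo f F a b A B : a < b ->
  (forall x, a < x < b -> 0 <= f x) ->
  (forall x, a < x < b -> {for x, continuous f}) ->
  (forall x, a < x < b -> has_der F x (f x)) ->
  F x @[x --> a^'+] --> A -> F x @[x --> b^'-] --> B ->
  (\int[mu]_(x in `]a, b[) (f x)%:E = (B - A)%:E)%E.
Proof.
move=> ab f0 cf dF FA FB.
(* The factor [1 / 3] ensures [a + h n < b - h n] already for [n = 0]. *)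
pose h (n : nat) : R := (b - a) / 3 / n.+1%:R.
have h0 n : 0 < h n by rewrite !divr_gt0//; lra.
have hle m n : (m <= n)%N -> h n <= h m.
  move=> mn; rewrite ler_pM2l ?lef_pV2 ?posrE ?ler_nat//.
  by rewrite divr_gt0//; lra.
have h3 n : h n <= (b - a) / 3.
  by apply: (le_trans (hle 0%N n _)) => //; rewrite /h divr1.
have hc : h n @[n --> \oo] --> 0.
  rewrite -(mulr0 ((b - a) / 3)); apply: cvgMr; exact: cvg_harmonic.
apply: (@ge0_FTC_bigcup f F _ (fun n => a + h n) (fun n => b - h n)).
- by move=> m n mn; rewrite lerD2l; exact: hle.
- by move=> m n mn; rewrite lerD2l lerN2; exact: hle.
- by move=> n; have := h3 n; lra.
- move=> x; rewrite /= ?in_itv/= => /andP[ax xb].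
  have m0 : 0 < Num.min (x - a) (b - x) by rewrite lt_min; apply/andP; lra.
  have [N _ /(_ N (leqnn _))] := (cvgrPdist_lt _ _).1 hc _ m0.
  rewrite /= sub0r normrN gtr0_norm// lt_min => /andP[? ?]; exists N.
  by apply/andP; lra.
- by move=> n x /andP[? ?]; rewrite /= ?in_itv/=; have := h0 n => ?; apply/andP; lra.
- by move=> x; rewrite /= ?in_itv; exact: f0.
- by move=> x; rewrite /= ?in_itv; exact: cf.
- by move=> x; rewrite /= ?in_itv; exact: dF.
- move/cvg_at_rightP: FA; apply; split=> [n|]; first by rewrite ltrDl.
  by rewrite -[X in _ --> X]addr0; apply: cvgD => //; exact: cvg_cst.
- move/cvg_at_leftP: FB; apply; split=> [n|]; first by rewrite ltrBlDr ltrDl.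
  by rewrite -[X in _ --> X]subr0; apply: cvgB => //; exact: cvg_cst.
Qed.

Lemma ge0_FTCoy f F a A B :
  (forall x, a < x -> 0 <= f x) ->
  (forall x, a < x -> {for x, continuous f}) ->
  (forall x, a < x -> has_der F x (f x)) ->
  F x @[x --> a^'+] --> A -> F x @[x --> +oo] --> B ->
  (\int[mu]_(x in `]a, +oo[) (f x)%:E = (B - A)%:E)%E.
Proof.
move=> f0 cf dF FA FB.
pose h (n : nat) : R := n.+1%:R^-1.
have h0 n : 0 < h n by rewrite invr_gt0.
have hle m n : (m <= n)%N -> h n <= h m.
  by move=> mn; rewrite lef_pV2 ?posrE ?ler_nat.
have h1 n : h n <= 1 by apply: (le_trans (hle 0%N n _)) => //; rewrite /h invr1.
have hc : h n @[n --> \oo] --> 0 by exact: cvg_harmonic.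
have vc : a + 2 + n%:R @[n --> \oo] --> +oo.
  apply: (@cvg_comp _ _ _ (fun n : nat => n%:R : R) (fun r => a + 2 + r) _ +oo).
    exact: cvgr_idn.
  exact: cvg_addrl.
apply: (@ge0_FTC_bigcup f F _ (fun n => a + h n) (fun n => a + 2 + n%:R)).
- by move=> m n mn; rewrite lerD2l; exact: hle.
- by move=> m n mn; rewrite lerD2l ler_nat.
- by move=> n; have := h1 n; have := ler0n R n; lra.
- move=> x; rewrite /= ?in_itv/= andbT => ax.
  have m0 : 0 < x - a by lra.
  have [N _ /(_ _) hN] := (cvgrPdist_lt _ _).1 hc _ m0.
  have [M _ /(_ _) hM] := (cvgryPge _).1 vc x.
  exists (maxn N M); have := hN (maxn N M) (leq_maxl _ _).
  have := hM (maxn N M) (leq_maxr _ _).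
  rewrite /= sub0r normrN gtr0_norm// => ? ?.
  by apply/andP; lra.
- move=> n x /andP[? ?]; rewrite /= ?in_itv/= andbT; have := h0 n => ?; lra.
- by move=> x; rewrite /= ?in_itv/= andbT; exact: f0.
- by move=> x; rewrite /= ?in_itv/= andbT; exact: cf.
- by move=> x; rewrite /= ?in_itv/= andbT; exact: dF.
- apply: ((cvg_at_rightP F a A).1 FA); split=> [n|]; first by rewrite ltrDl.
  by rewrite -[X in _ --> X]addr0; apply: cvgD => //; exact: cvg_cst.
- by move: FB; apply: cvg_comp.
Qed.

Lemma measurable_inv : measurable_fun [set: R] (fun x : R => x^-1).
Proof.
have -> : [set: R] = [set 0] `|` [set~ 0] by rewrite setUv.
apply/measurable_funU; [exact: measurable_set1|exact: measurableC|split].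
  exact: measurable_fun_set1.
apply: open_continuous_measurable_fun.
  by apply: closed_openC; exact: closed_eq.
by move=> x; rewrite inE => /eqP; exact: inv_continuous.
Qed.

Lemma measurable_sqrt : measurable_fun [set: R] (@Num.sqrt R).
Proof. apply: continuous_measurable_fun; exact: sqrt_continuous. Qed.

End FTC.

(** * Dilations, even functions and splitting of integrals *)

Section Dilation.
Context {R : realType}.
Let mu := @lebesgue_measure R.
Local Open Scope ereal_scope.

(** Lebesgue measure is [|k|] times its image under multiplication by [k], because both give the
    same value to the intervals []a, b]]. A negative [k] has preimages [[b / k, a / k[], hence the
    two cases. *)
Lemma ge0_integral_dilate (k : R) (h : R -> \bar R) : k != 0%R ->
  measurable_fun setT h -> (forall x, 0 <= h x) ->
  \int[mu]_x h (k * x)%R = (`|k|^-1)%:E * \int[mu]_x h x.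
Proof.
move=> k0 mh h0.
have mphi : measurable_fun [set: measurableTypeR R] (( *%R k) : R -> measurableTypeR R).
  exact: mulrl_measurable.
have nk0 : (0 <= `|k|)%R by [].
pose nu : {measure set (measurableTypeR R) -> \bar R} :=
  mscale (NngNum nk0)
    (measure_function_pushforward__canonical__measure_function_Measure mu mphi).
have nuE A : measurable A -> mu A = nu A.
  apply: lebesgue_measure_unique => X /ocitvP[->|[[a b] /= ab ->]].
    by rewrite !measure0.
  rewrite /nu /= /mscale/= /pushforward.
  move: k0; rewrite neq_lt => /orP[k0|k0].
    rewrite (_ : _ @^-1` _ = `[(b / k)%R, (a / k)%R[%classic); last first.
      apply/seteqP; split => x /=; rewrite !in_itv/= ?ler_ndivrMr// ?ltr_ndivlMr//;
        rewrite ?(mulrC k) //.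
        by rewrite andbC.
      by rewrite andbC.
    rewrite !lebesgue_measure_itv/= !lte_fin ab ltr_nM2r ?invr_lt0// ab -!EFinD -EFinM.
    by congr EFin; rewrite ltr0_norm//; field; exact: ltr0_neq0.
  rewrite (_ : _ @^-1` _ = `](a / k)%R, (b / k)%R]%classic); last first.
    by apply/seteqP; split => x /=; rewrite !in_itv/= ltr_pdivrMr// ler_pdivlMr//
      (mulrC k).
  rewrite !lebesgue_measure_itv/= !lte_fin ab ltr_pM2r ?invr_gt0// ab -!EFinD -EFinM.
  by congr EFin; rewrite gtr0_norm//; field; exact: lt0r_neq0.
rewrite [in RHS](eq_measure_integral nu)/=; last by move=> A mA _; exact: nuE.
rewrite ge0_integral_mscale//= ge0_integral_pushforward//=.
rewrite muleA -EFinM mulVf ?normr_eq0// mul1e.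
by rewrite (_ : _ @^-1` _ = setT)// preimage_setT.
Qed.

Lemma integrable_dilate (k : R) (h : R -> R) : k != 0%R ->
  mu.-integrable setT (EFin \o h) ->
  mu.-integrable setT (EFin \o (fun x => h (k * x)%R)).
Proof.
move=> k0 /integrableP[mh ih]; apply/integrableP; split.
  by apply: (measurableT_comp mh); exact: mulrl_measurable.
rewrite (@ge0_integral_dilate k (fun x => `|(h x)%:E|))//; last first.
  exact: measurableT_comp.
by rewrite lte_mul_pinfty// lee_fin invr_ge0.
Qed.

Lemma Rintegral_dilate (k : R) (h : R -> R) : k != 0%R ->
  mu.-integrable setT (EFin \o h) ->
  (\int[mu]_x h (k * x) = `|k|^-1 * \int[mu]_x h x)%R.
Proof.
move=> k0 ih; have mh := measurable_int _ ih.
rewrite /Rintegral integralE [in RHS]integralE.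
have E1 := @ge0_integral_dilate k _ k0 (measurable_funepos mh) (fun=> funepos_ge0 _ _).
have E2 := @ge0_integral_dilate k _ k0 (measurable_funeneg mh) (fun=> funeneg_ge0 _ _).
have F1 := integrable_pos_fin_num measurableT ih.
have F2 := integrable_neg_fin_num measurableT ih.
have -> : \int[mu]_x (fun x => (h (k * x)%R)%:E)^\+ x =
  (`|k|^-1)%:E * \int[mu]_x (EFin \o h)^\+ x by rewrite -E1; apply: eq_integral => x _; rewrite unlock.
have -> : \int[mu]_x (fun x => (h (k * x)%R)%:E)^\- x =
  (`|k|^-1)%:E * \int[mu]_x (EFin \o h)^\- x by rewrite -E2; apply: eq_integral => x _; rewrite unlock.
rewrite -muleBr//; last by rewrite fin_num_adde_defl// fin_numN.
by rewrite fineM// fin_numB; apply/andP.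
Qed.

(** The dilation of ratio [-1] carries the integral over []-oo, 0[] to the one over []0, +oo[]. *)
Lemma ge0_integral_even (h : R -> R) :
  measurable_fun setT h -> (forall x, (0 <= h x)%R) -> (forall x, h (- x)%R = h x) ->
  \int[mu]_x (h x)%:E = 2%:E * \int[mu]_(x in `]0%R, +oo[) (h x)%:E.
Proof.
move=> mh h0 he.
have mE D : measurable_fun D (fun x => (h x)%:E).
  by apply/measurable_EFinP; exact: measurable_funTS.
have -> : [set: R] = `]-oo, 0%R[%classic `|` `[0%R, +oo[%classic.
  by rewrite -setCitvr setvU.
rewrite ge0_integral_setU//=; last 3 first.
- exact: mE.
- by move=> x _; rewrite lee_fin.
- by rewrite -setCitvr; exact/disj_setPCr.
rewrite -integral_itv_obnd_cbnd// mule_natl mule2n; congr (_ + _).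
rewrite integral_mkcond/= [in RHS]integral_mkcond/=.
pose g := (fun x => (h x)%:E) \_ `]0%R, +oo[.
have := @ge0_integral_dilate (-1) g; rewrite normrN1 invr1 mul1e => <-.
- apply: eq_integral => x _; rewrite /g !patchE mulN1r !mem_setE !in_itv/= andbT.
  by rewrite oppr_gt0 he.
- by rewrite oppr_eq0 oner_eq0.
- by apply/(measurable_restrictT _ _).1.
- by move=> x; rewrite /g patchE; case: ifP => // _; rewrite lee_fin.
Qed.

Lemma even_integrable (h : R -> R) : measurable_fun setT h ->
  (forall x, (0 <= h x)%R) -> (forall x, h (- x)%R = h x) ->
  \int[mu]_(x in `]0%R, +oo[) (h x)%:E < +oo -> mu.-integrable setT (EFin \o h).
Proof.
move=> mh h0 he hlty; apply/integrableP; split; first exact/measurable_EFinP.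
under eq_integral do rewrite /= ger0_norm//.
by rewrite ge0_integral_even// lte_mul_pinfty// lee_fin.
Qed.

Lemma ge0_integral_split_oy (a b : R) (h : R -> R) : (a < b)%R ->
  measurable_fun `]a, +oo[ h -> (forall x, (a < x)%R -> (0 <= h x)%R) ->
  \int[mu]_(x in `]a, +oo[) (h x)%:E =
  \int[mu]_(x in `]a, b[) (h x)%:E + \int[mu]_(x in `]b, +oo[) (h x)%:E.
Proof.
move=> ab mh h0.
have E : `]a, b[%classic `|` `[b, +oo[%classic = `]a, +oo[%classic.
  apply/seteqP; split => x /=; rewrite !in_itv/= ?andbT.
    by move=> [/andP[]//|]; exact: lt_le_trans.
  by move=> ax; case: (ltP x b) => ?; [left; apply/andP|right].
rewrite -E ge0_integral_setU//=.
- congr (_ + _); rewrite integral_itv_obnd_cbnd//; apply/measurable_EFinP.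
  apply: measurable_funS mh => // x /=; rewrite !in_itv/= !andbT.
  exact: lt_trans.
- by rewrite E; exact/measurable_EFinP.
- move=> x Hx; have : `]a, +oo[%classic x by rewrite -E.
  by rewrite /= in_itv/= andbT lee_fin; exact: h0.
- rewrite disj_set2E; apply/eqP; rewrite -subset0 => x [/=]; rewrite !in_itv/= andbT.
  by move=> /andP[_]; rewrite ltNge => /negP.
Qed.

Lemma ge0_integral_split_oo (a b c : R) (h : R -> R) : (a < b)%R -> (b < c)%R ->
  measurable_fun `]a, c[ h -> (forall x, (a < x < c)%R -> (0 <= h x)%R) ->
  \int[mu]_(x in `]a, c[) (h x)%:E =
  \int[mu]_(x in `]a, b[) (h x)%:E + \int[mu]_(x in `]b, c[) (h x)%:E.
Proof.
move=> ab bc mh h0.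
have E : `]a, b[%classic `|` `[b, c[%classic = `]a, c[%classic.
  apply/seteqP; split => x /=; rewrite !in_itv/=.
    by move=> [/andP[-> xb]|/andP[bx ->]]; rewrite ?(lt_trans xb bc) ?(lt_le_trans ab bx).
  by move=> /andP[ax xc]; case: (ltP x b) => ?; [left|right]; apply/andP.
rewrite -E ge0_integral_setU//=.
- congr (_ + _); rewrite integral_itv_obnd_cbnd//; apply/measurable_EFinP.
  apply: measurable_funS mh => // x /=; rewrite !in_itv/=.
  by move=> /andP[bx ->]; rewrite (lt_trans ab bx).
- by rewrite E; exact/measurable_EFinP.
- move=> x Hx; have : `]a, c[%classic x by rewrite -E.
  by rewrite /= in_itv/= lee_fin; exact: h0.
- rewrite disj_set2E; apply/eqP; rewrite -subset0 => x [/=]; rewrite !in_itv/=.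
  by move=> /andP[_]; rewrite ltNge => /negP xb /andP[].
Qed.

End Dilation.

(** * The logarithmic kernel *)

Section LogFacts.
Context {R : realType}.
Let mu := @lebesgue_measure R.

Lemma fcvg_near {T : Type} {F : set_system T} {FF : Filter F} (f g : T -> R) (a : R) :
  (\forall t \near F, g t = f t) -> g @ F --> a -> f @ F --> a.
Proof. by move=> fg; apply: cvg_trans; exact: near_eq_cvg. Qed.

Lemma cont_at (f : R -> R) (a b : R) : f x @[x --> a] --> b -> b = f a ->
  {for a, continuous f}.
Proof. by move=> + fa; rewrite fa. Qed.

Lemma near_pinfty_gt (c : R) : \forall x \near (+oo : set_system R), c < x.
Proof. by apply: nbhs_pinfty_gt; exact: num_real. Qed.

Lemma fcvg_invy (c : R) : (fun x : R => (x + c)^-1) @ +oo --> (0 : R).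
Proof.
apply/cvgrPdist_lt => e e0; near=> x.
have x0 : 0 < x + c.
  by rewrite -ltrBlDr sub0r; near: x; exact: near_pinfty_gt.
rewrite sub0r normrN gtr0_norm ?invr_gt0// -[ltRHS]invrK ltf_pV2 ?posrE ?invr_gt0//.
by rewrite -ltrBlDr; near: x; exact: near_pinfty_gt.
Unshelve. all: by end_near. Qed.

Lemma fcvg_invyl (c : R) : (fun x : R => (c + x)^-1) @ +oo --> (0 : R).
Proof. by under eq_fun do rewrite addrC; exact: fcvg_invy. Qed.

Lemma ln_le_subr1 (x : R) : 0 < x -> ln x <= x - 1.
Proof. by move=> x0; have := @le_ln1Dx R (x - 1); rewrite addrCA subrr addr0; apply; lra. Qed.

Lemma ln_ge_1subV (x : R) : 0 < x -> 1 - x^-1 <= ln x.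
Proof.
move=> x0; have := @ln_le_subr1 x^-1; rewrite invr_gt0 => /(_ x0).
by rewrite lnV ?posrE//; lra.
Qed.

Lemma ln_sqrt (x : R) : 0 < x -> ln x = 2 * ln (Num.sqrt x).
Proof.
by move=> x0; rewrite -{1}(sqr_sqrtr (ltW x0)) lnXn ?sqrtr_gt0// mulr_natl.
Qed.

(** With [|t| = s^2] the bound says [s * |ln s| <= 1], a consequence of [ln s >= 1 - 1 / s]. It
    provides the continuity of [t * ln |t|] at 0. *)
Lemma xln_bound (t : R) : `|t| <= 1 -> `|t * ln `|t| | <= 2 * Num.sqrt `|t|.
Proof.
move=> t1; have [->|t0] := eqVneq t 0; first by rewrite mul0r normr0 sqrtr0 mulr0.
have nt0 : 0 < `|t| by rewrite normr_gt0.
rewrite normrM (ler0_norm (ln_le0 t1)).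
set s := Num.sqrt `|t|; have s0 : 0 < s by rewrite sqrtr_gt0.
have ts : `|t| = s ^+ 2 by rewrite /s sqr_sqrtr.
have E : ln `|t| = 2 * ln s by exact: ln_sqrt.
have sV : s * s^-1 = 1 by rewrite divff ?lt0r_neq0.
have h : s * (1 - s^-1) <= s * ln s by rewrite ler_pM2l// ln_ge_1subV.
by rewrite E ts; nra.
Qed.

Lemma fcvg_xln {T : Type} {F : set_system T} {FF : Filter F} (f : T -> R) (a : R) :
  f @ F --> a -> (fun t => f t * ln `|f t|) @ F --> a * ln `|a|.
Proof.
apply: (@fcvg_comp R T F (fun t => t * ln `|t|)).
have [->|a0] := eqVneq a 0; last first.
  by apply: cont_at; [lims; rewrite normr_gt0|].
apply: (@cont_at _ 0 0); last by rewrite mul0r.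
have H : (fun t : R => 2 * Num.sqrt `|t|) @ (0 : R) --> (0 : R).
  by apply: fcvg_eq; [lims|rewrite normr0 sqrtr0 mulr0].
apply/cvgrPdist_lt => e e0; near=> t.
rewrite sub0r normrN; apply: le_lt_trans (xln_bound _) _.
  by near: t; apply: (filterS _ (@nbhs0_lt R R 1 ltr01)) => t /= /ltW.
near: t; move/cvgrPdist_lt: H => /(_ _ e0); apply: filterS => t /=.
by rewrite sub0r normrN ger0_norm// mulr_ge0// sqrtr_ge0.
Unshelve. all: by end_near. Qed.

End LogFacts.

Section LogKernel.
Context {R : realType}.
Let mu := @lebesgue_measure R.
Implicit Types x y : R.

(* The even part in y of -ln|1 - y/x|. *)
Definition logk y x : R := ln `|x| - (ln `|x - y| + ln `|x + y|) / 2.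

Lemma logkN y x : logk y (- x) = logk y x.
Proof.
rewrite /logk normrN; congr (_ - _ / 2).
by rewrite addrC; congr (ln _ + ln _); rewrite -normrN; congr (`|_|); ring.
Qed.

Lemma logkNy y x : logk (- y) x = logk y x.
Proof. by rewrite /logk opprK; congr (_ - _ / 2); rewrite addrC. Qed.

Lemma measurable_logk2 :
  measurable_fun [set: R * R] (fun p => logk p.2 p.1).
Proof.
have mln (f : R * R -> R) : measurable_fun setT f ->
    measurable_fun setT (fun p => ln `|f p|).
  by move=> mf; apply: (measurableT_comp (@measurable_ln R));
    apply: measurableT_comp.
apply: measurable_funB; first by apply: mln; exact: measurable_fst.
apply: measurable_funM => //; apply: measurable_funD; apply: mln.
  by apply: measurable_funB; [exact: measurable_fst|exact: measurable_snd].
by apply: measurable_funD; [exact: measurable_fst|exact: measurable_snd].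
Qed.

Lemma measurable_logk y : measurable_fun setT (logk y).
Proof.
rewrite (_ : logk y = (fun p : R * R => logk p.2 p.1) \o (fun x => (x, y)))//.
by apply: (measurableT_comp measurable_logk2); exact: measurable_pair2.
Qed.

(** Primitive of [logk y], normalised to tend to 0 at infinity. The form [t * ln |t|] of its terms
    makes it continuous also at the singularities [0], [y] and [- y] of the kernel. *)
Definition logkF y x : R :=
  x * ln `|x| - ((x - y) * ln `|x - y| + (x + y) * ln `|x + y|) / 2.

Lemma logkF_der y x : x != 0 -> x - y != 0 -> x + y != 0 ->
  is_derive x 1 (logkF y) (logk y x).
Proof.
move=> x0 xy0 xy1; apply: is_derive_eq; first by rewrite /logkF; der.
by rewrite /logk; field; rewrite x0 xy0 xy1.
Qed.

Lemma logkF_lim y (a : R) : logkF y x @[x --> a] --> logkF y a.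
Proof.
rewrite /logkF; apply: cvgB; first by apply: fcvg_xln; exact: cvg_id.
apply: cvgM; last exact: cvg_cst.
apply: cvgD; apply: fcvg_xln; lims.
Qed.

(** With [t = y / x] the terms in [ln x] cancel. There remain [x * ln (1 - t^2)], which is of order
    [y * t], and [y * ln ((1 + t) / (1 - t))]; both tend to 0. *)
Lemma logkF_limy y : 0 < y -> logkF y x @[x --> +oo] --> (0 : R).
Proof.
move=> y0.
pose t (x : R) := y * (x + 0)^-1.
have tc : t x @[x --> +oo] --> (0 : R).
  by apply: fcvg_eq; [apply: cvgM; [exact: cvg_cst|exact: fcvg_invy]|rewrite mulr0].
have H : - ((y * - (t x / (1 - t x ^+ 2))) + y * (ln (1 + t x) - ln (1 - t x))) / 2 @[x --> +oo] --> (0 : R).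
  apply: fcvg_eq.
    lims; try exact: tc; rewrite ?expr0n ?subr0 ?addr0 //=.
  by rewrite !(subr0, addr0, ln1, mul0r, mulr0, oppr0).
have H2 : - (y * (ln (1 + t x) - ln (1 - t x))) / 2 @[x --> +oo] --> (0 : R).
  apply: fcvg_eq.
    lims; try exact: tc; rewrite ?expr0n ?subr0 ?addr0 //=.
  by rewrite !(subr0, addr0, ln1, mul0r, mulr0, oppr0).
apply: (squeeze_cvgr _ H2 H); near=> x.
have yx : y < x by near: x; exact: near_pinfty_gt.
have x0 : 0 < x by lra.
have Et : t x = y / x by rewrite /t addr0.
have t0 : 0 < t x by rewrite Et divr_gt0.
have t1 : t x < 1 by rewrite Et ltr_pdivrMr// mul1r.
have E : logkF y x = - (x * ln (1 - t x ^+ 2) + y * (ln (1 + t x) - ln (1 - t x))) / 2.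
  have -> : 1 - t x ^+ 2 = (1 + t x) * (1 - t x) by ring.
  have E1 : `|x - y| = x * (1 - t x).
    by rewrite gtr0_norm ?subr_gt0// Et; field; exact: lt0r_neq0.
  have E2 : `|x + y| = x * (1 + t x).
    by rewrite gtr0_norm ?addr_gt0// Et; field; exact: lt0r_neq0.
  rewrite /logkF E1 E2 (gtr0_norm x0) !lnM ?posrE //; try lra.
have l0 : ln (1 - t x ^+ 2) <= 0 by rewrite ln_le0//; nra.
have l1 : - (t x ^+ 2 / (1 - t x ^+ 2)) <= ln (1 - t x ^+ 2).
  have tp : 0 < 1 - t x ^+ 2 by nra.
  apply: le_trans (ln_ge_1subV tp).
  by rewrite le_eqVlt; apply/orP; left; apply/eqP; field; exact: lt0r_neq0.
have l2 : - (y * (t x / (1 - t x ^+ 2))) <= x * ln (1 - t x ^+ 2).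
  have -> : - (y * (t x / (1 - t x ^+ 2))) = x * - (t x ^+ 2 / (1 - t x ^+ 2)).
    have -> : y = x * t x by rewrite Et; field; exact: lt0r_neq0.
    by ring.
  by rewrite ler_pM2l.
have l3 : x * ln (1 - t x ^+ 2) <= 0 by rewrite pmulr_rle0.
rewrite E; apply/andP; split; lra.
Unshelve. all: by end_near. Qed.

End LogKernel.

Section LogKernelIntegral.
Context {R : realType}.
Let mu := @lebesgue_measure R.
Implicit Types x y : R.

Lemma logk_cont y x : x != 0 -> x - y != 0 -> x + y != 0 ->
  {for x, continuous (logk y)}.
Proof.
by move=> x0 xy0 xy1; apply: cont_at; [rewrite /logk; lims; rewrite ?normr_gt0|].
Qed.

Lemma logk_eq y x : 0 < x -> 0 < y -> x != y ->
  logk y x = (ln (x ^+ 2) - ln `|x ^+ 2 - y ^+ 2|) / 2.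
Proof.
move=> x0 y0 xy; rewrite /logk subr_sqr normrM.
have xy' : x + y != 0 by neq.
rewrite [ln (`|_| * _)]lnM ?posrE ?normr_gt0 ?subr_eq0//.
by rewrite lnXn// (gtr0_norm x0) mulr2n; field.
Qed.

(** For [y > 0], [logk y] changes sign on the half line where [x^2 = y^2 - x^2], that is at
    [x = y * s]. *)
Let s : R := Num.sqrt 2^-1.
Let s2 : s ^+ 2 = 2^-1. Proof. by rewrite sqr_sqrtr. Qed.
Let s0 : 0 < s. Proof. by rewrite sqrtr_gt0. Qed.
Let s1 : s < 1. Proof. by have := s2; have := s0; nra. Qed.

Lemma logk_le0 y x : 0 < y -> 0 < x < y * s -> logk y x <= 0.
Proof.
move=> y0 /andP[x0 xc].
have H : x ^+ 2 <= y ^+ 2 / 2 by rewrite -s2 -exprMn lerXn2r ?nnegrE; nra.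
have xy : x < y by have := s1; nra.
rewrite logk_eq//; last by rewrite lt_eqF.
suff : ln (x ^+ 2) <= ln `|x ^+ 2 - y ^+ 2| by lra.
rewrite ler_ln ?posrE ?normr_gt0 ?exprn_gt0//; last by apply/eqP => ?; nra.
by rewrite distrC ger0_norm; nra.
Qed.

Lemma logk_ge0 y x : 0 < y -> y * s < x -> x != y -> 0 <= logk y x.
Proof.
move=> y0 xc xy.
have x0 : 0 < x by have := s0; nra.
have H : y ^+ 2 / 2 <= x ^+ 2.
  by rewrite -s2 -exprMn lerXn2r ?nnegrE ?(ltW xc) ?(ltW x0)// mulr_ge0// ltW.
rewrite logk_eq//.
suff : ln `|x ^+ 2 - y ^+ 2| <= ln (x ^+ 2) by lra.
have sq : x ^+ 2 - y ^+ 2 != 0.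
  by rewrite subr_sqr mulf_neq0 ?subr_eq0//; neq.
rewrite ler_ln ?posrE ?normr_gt0 ?exprn_gt0//.
by rewrite ler_norml; apply/andP; nra.
Qed.

(** The kernel has a constant sign on each of the three intervals, as the fundamental theorem for
    nonnegative functions requires. With signs restored the three values [- K], [logkF y y + K] and
    [- logkF y y] add up to 0. *)
Lemma logk_pieces y : 0 < y -> let K := - logkF y (y * s) in
  [/\ (\int[mu]_(x in `]0%R, (y * s)%R[) (- logk y x)%:E = K%:E)%E,
      (\int[mu]_(x in `](y * s)%R, y[) (logk y x)%:E = (logkF y y + K)%:E)%E &
      (\int[mu]_(x in `]y, +oo[) (logk y x)%:E = (- logkF y y)%:E)%E].
Proof.
move=> y0 K; have c0 : 0 < y * s by rewrite mulr_gt0.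
have cy : y * s < y by rewrite gtr_pMr.
split.
- rewrite (@ge0_FTCoo _ _ (fun x => - logkF y x) _ _ 0 K)// ?subr0//.
  + by move=> x xc; rewrite oppr_ge0 logk_le0.
  + move=> x /andP[x0 xc]; apply: cont_at; first by apply: cvgN; apply: logk_cont; neq.
    by [].
  + move=> x /andP[x0 xc]; rewrite /has_der; eapply (isder_opp (f := logkF y)); eapply logkF_der; neq.
  + apply: cvg_at_right_filter; apply: fcvg_eq.
      by apply: cvgN; exact: logkF_lim.
    rewrite /logkF mul0r !sub0r add0r normrN; ring.
  + by apply: cvg_at_left_filter; apply: cvgN; exact: logkF_lim.
- rewrite (@ge0_FTCoo _ _ (logkF y) _ _ (- K) (logkF y y))// ?opprK//.
  + by move=> x /andP[xc xy]; apply: logk_ge0 => //; rewrite lt_eqF.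
  + by move=> x /andP[x0 xc]; apply: logk_cont; neq.
  + by move=> x /andP[x0 xc]; apply: logkF_der; neq.
  + by apply: cvg_at_right_filter; apply: fcvg_eq; [exact: logkF_lim|rewrite ?/K ?opprK].
  + by apply: cvg_at_left_filter; exact: logkF_lim.
- rewrite (@ge0_FTCoy _ _ (logkF y) _ (logkF y y) 0)// ?sub0r//.
  + by move=> x xy; apply: logk_ge0 => //; [lra|rewrite gt_eqF].
  + by move=> x xy; apply: logk_cont; neq.
  + by move=> x xy; apply: logkF_der; neq.
  + by apply: cvg_at_right_filter; exact: logkF_lim.
  + exact: logkF_limy.
Qed.

(** The kernel is homogeneous of degree 0 in [(x, y)]; hence its L1 norm in [x] is exactly
    proportional to [|y|]. *)
Lemma logkF_scale y : 0 < y -> logkF y (y * s) = y * logkF 1 s.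
Proof.
move=> y0; rewrite /logkF.
have -> : y * s - y = y * (s - 1) by ring.
have -> : y * s + y = y * (s + 1) by ring.
rewrite !normrM (gtr0_norm y0) !lnM ?posrE ?normr_gt0 //; try (have := s0; have := s1; move=> ? ?; neq).
by field.
Qed.

Definition logk_cst : R := - 4 * logkF 1 s.

Lemma logk_int_pos y : 0 < y ->
  [/\ (\int[mu]_x (`|logk y x|)%:E = (logk_cst * y)%:E)%E,
      mu.-integrable setT (EFin \o logk y) & \int[mu]_x (logk y x) = 0].
Proof.
move=> y0; have [] := logk_pieces y0; set K := - _ => I1 I2 I3.
have c0 : 0 < y * s by rewrite mulr_gt0.
have cy : y * s < y by rewrite gtr_pMr.
have ml := measurable_logk y.
have mabs : measurable_fun setT (fun x => `|logk y x|) by exact: measurableT_comp.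
have mpsi : measurable_fun setT (fun x => `|logk y x| - logk y x).
  exact: measurable_funB.
have psi0 x : 0 <= `|logk y x| - logk y x by rewrite subr_ge0 ler_norm.
have Iabs : (\int[mu]_x (`|logk y x|)%:E = (4 * K)%:E)%E.
  rewrite ge0_integral_even//; last by move=> x; rewrite logkN.
  rewrite (@ge0_integral_split_oy _ 0 (y * s))//; last exact: measurable_funTS.
  rewrite (@ge0_integral_split_oy _ (y * s) y)//; last exact: measurable_funTS.
  have -> : (4 * K)%:E = (2%:E * (K%:E + ((logkF y y + K)%:E + (- logkF y y)%:E)))%E.
    by rewrite -!EFinD -EFinM; congr EFin; ring.
  rewrite -I1 -I2 -I3; congr (_ * (_ + (_ + _)))%E; apply: eq_integral => x.
  - by rewrite inE/= in_itv/= => xc; rewrite ler0_norm// logk_le0.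
  - rewrite inE/= in_itv/= => /andP[xc xy].
    by rewrite ger0_norm// logk_ge0// lt_eqF.
  - rewrite inE/= in_itv/= andbT => xy.
    by rewrite ger0_norm// logk_ge0// ?gt_eqF//; lra.
(* On the half line [|k| - k] is [2 * |k|] before [y * s] and 0 after it, and [|k|] has the same
   integral [K] before [y * s] as after. So [|k| - k] and [|k|] have equal integrals, and [k] has
   integral 0. *)
have Ipsi : (\int[mu]_x (`|logk y x| - logk y x)%:E = (4 * K)%:E)%E.
  rewrite ge0_integral_even//; last by move=> x; rewrite logkN.
  rewrite (@ge0_integral_split_oy _ 0 (y * s))//; last exact: measurable_funTS.
  rewrite (@ge0_integral_split_oy _ (y * s) y)//; last exact: measurable_funTS.
  rewrite [X in (_ + (X + _))%E]integral0_eq; last first.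
    move=> x; rewrite /= in_itv/= => /andP[xc xy].
    by rewrite ger0_norm ?subrr// logk_ge0// lt_eqF.
  rewrite [X in (_ + (_ + X))%E]integral0_eq; last first.
    move=> x; rewrite /= in_itv/= andbT => xy.
    by rewrite ger0_norm ?subrr// logk_ge0// ?gt_eqF//; lra.
  rewrite !adde0 (_ : 4 * K = 2 * (2 * K)); last by ring.
  rewrite EFinM; congr (_ * _)%E; rewrite EFinM -I1 -ge0_integralZl//; last 2 first.
  - by apply/measurable_EFinP; apply: measurable_funTS; exact: measurableT_comp.
  - by move=> x; rewrite /= in_itv/= => xc; rewrite lee_fin oppr_ge0 logk_le0.
  apply: eq_integral => x; rewrite inE/= in_itv/= => xc.
  by rewrite ler0_norm ?logk_le0// -EFinM; congr EFin; ring.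
have il : mu.-integrable setT (EFin \o logk y).
  by apply/integrableP; split; [exact/measurable_EFinP|rewrite /= Iabs ltry].
split=> //.
  by rewrite Iabs /K logkF_scale// /logk_cst; congr EFin; ring.
have iabs : mu.-integrable setT (EFin \o (fun x => `|logk y x|)).
  by apply: integrable_norm.
have : \int[mu]_x (`|logk y x| - logk y x) = 4 * K by rewrite /Rintegral Ipsi.
rewrite RintegralB//= /Rintegral Iabs /=; lra.
Qed.

Lemma logk_int y : y != 0 ->
  [/\ (\int[mu]_x (`|logk y x|)%:E = (logk_cst * `|y|)%:E)%E,
      mu.-integrable setT (EFin \o logk y) & \int[mu]_x (logk y x) = 0].
Proof.
rewrite neq_lt => /orP[y0|y0]; last by rewrite gtr0_norm//; exact: logk_int_pos.
have yN : 0 < - y by rewrite oppr_gt0.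
have := logk_int_pos yN; rewrite ltr0_norm//.
by rewrite (_ : logk (- y) = logk y)//; apply/funext => x; exact: logkNy.
Qed.

End LogKernelIntegral.

(** * The potential of the reference density [(1 + |y|)^-2] *)

Section ReferenceDensity.
Context {R : realType}.
Let mu := @lebesgue_measure R.
Implicit Types x y c : R.

Lemma fcvg_ln_div : ln t / t @[t --> +oo] --> (0 : R).
Proof.
have H : 2 * Num.sqrt (t + 0)^-1 @[t --> +oo] --> (0 : R).
  have := @fcvg_invy R 0 => h.
  by apply: fcvg_eq; [lims|rewrite sqrtr0 mulr0].
apply: (squeeze_cvgr _ (cvg_cst 0) H); near=> t.
have t1 : 1 <= t by near: t; apply: nbhs_pinfty_ge; exact: num_real.
have t0 : 0 < t by lra.
rewrite divr_ge0 ?ln_ge0 ?(ltW t0)//= addr0 sqrtrV ?(ltW t0)//.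
rewrite ln_sqrt// ler_pdivrMr// -mulrA ler_pM2l//.
set s := Num.sqrt t; have s0 : 0 < s by rewrite sqrtr_gt0.
have -> : t = s * s by rewrite -expr2 sqr_sqrtr// ltW.
by rewrite mulrA mulVf ?mul1r ?lt0r_neq0// ltW// ln_sublinear.
Unshelve. all: by end_near. Qed.

Lemma fcvg_ln_sub (k : R) : ln (t - k) - ln t @[t --> +oo] --> (0 : R).
Proof.
have H : ln (1 - k * (t + 0)^-1) @[t --> +oo] --> (0 : R).
  have := @fcvg_invy R 0 => h.
  by apply: fcvg_eq; [lims; rewrite mulr0 subr0|rewrite mulr0 subr0 ln1].
apply: fcvg_near H; near=> t.
have t0 : 0 < t by near: t; exact: near_pinfty_gt.
have tk : k < t by near: t; exact: near_pinfty_gt.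
rewrite addr0 -ln_div ?posrE ?subr_gt0//; congr (ln _); field; exact: lt0r_neq0.
Unshelve. all: by end_near. Qed.

(** Primitive of [ln |y - c| / (1 + y)^2], obtained by parts and normalised to vanish at
    infinity. *)
Definition logprim c y : R :=
  ((y - c) * ln `|y - c| - (1 + y) * ln `|1 + y|) / ((1 + c) * (1 + y)).

Lemma logprim_der c y : 1 + c != 0 -> 0 < y -> y != c ->
  is_derive y 1 (logprim c) (ln `|y - c| * ((1 + y) ^+ 2)^-1).
Proof.
move=> c0 y0 yc; have yc' : y - c != 0 by rewrite subr_eq0.
have y1 : 1 + y != 0 by neq.
apply: is_derive_eq.
  by rewrite /logprim; der => //; rewrite mulf_neq0.
by field; rewrite c0 yc' y1.
Qed.

Lemma logprim_lim c (a : R) : 1 + c != 0 -> 0 <= a ->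
  logprim c y @[y --> a] --> logprim c a.
Proof.
move=> c0 a0.
apply: cvgM; last first.
  by lims; rewrite mulf_neq0//; neq.
have h1 : y - c @[y --> a] --> a - c by lims.
have h2 : 1 + y @[y --> a] --> 1 + a by lims.
by apply: cvgB; [exact: fcvg_xln h1|exact: fcvg_xln h2].
Qed.

Lemma logprim_limy c : 1 + c != 0 -> logprim c y @[y --> +oo] --> (0 : R).
Proof.
move=> c0; pose k := 1 + c.
pose h t := (ln (t - k) - ln t) / k - ln t / t - (ln (t - k) - ln t) * (t + 0)^-1.
have H : h t @[t --> +oo] --> (0 : R).
  have h1 := @fcvg_invy R 0; have h2 := fcvg_ln_sub k; have h3 := fcvg_ln_div.
  by rewrite /h; apply: fcvg_eq; [lims|rewrite mul0r mulr0 !subr0].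
have H2 : h (1 + y) @[y --> +oo] --> (0 : R).
  by move: H; apply: cvg_comp; exact: cvg_addrl.
apply: fcvg_near H2; near=> y.
have y1 : 0 < 1 + y.
  by rewrite -ltrBlDl; near: y; exact: near_pinfty_gt.
have yc : 0 < y - c by rewrite subr_gt0; near: y; exact: near_pinfty_gt.
rewrite /h /logprim (gtr0_norm y1) (gtr0_norm yc) (_ : 1 + y - k = y - c); last by rewrite /k; ring.
rewrite /k addr0; field; rewrite c0 (lt0r_neq0 y1)//=.
Unshelve. all: by end_near. Qed.

Lemma logprim0 c : logprim c 0 = - (c * ln `|c| / (1 + c)).
Proof.
rewrite /logprim sub0r addr0 normr1 ln1 mulr0 subr0 mulr1 normrN.
by rewrite !mulNr.
Qed.

(** Reference density: bounded, with a tail in [y^-2] like the densities of the problem, and with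
    explicit mass and potential. *)
Definition rden y : R := ((1 + `|y|) ^+ 2)^-1.

Lemma rden_ge0 y : 0 <= rden y. Proof. by rewrite invr_ge0 sqr_ge0. Qed.

Lemma rdenN y : rden (- y) = rden y. Proof. by rewrite /rden normrN. Qed.

Lemma rden_pos y : 0 <= y -> rden y = ((1 + y) ^+ 2)^-1.
Proof. by move=> y0; rewrite /rden ger0_norm. Qed.

Lemma rden_den y : (1 + `|y|) ^+ 2 != 0.
Proof. by rewrite expf_neq0// gt_eqF// ltr_pwDl. Qed.

Lemma measurable_rden : measurable_fun setT rden.
Proof.
apply: (measurableT_comp (@measurable_inv R)).
by apply: measurable_funX; apply: measurable_funD => //; exact: measurableT_comp.
Qed.

Lemma measurable_lnabs (f : R -> R) : measurable_fun setT f ->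
  measurable_fun setT (fun y => ln `|f y|).
Proof.
by move=> mf; apply: (measurableT_comp (@measurable_ln R)); exact: measurableT_comp.
Qed.

Lemma rden_int0 : (\int[mu]_(y in `]0%R, +oo[) (rden y)%:E = 1%:E)%E.
Proof.
rewrite (@ge0_FTCoy _ _ (fun y => - (1 + y)^-1) _ (- 1) 0).
- by rewrite sub0r opprK.
- by move=> y _; exact: rden_ge0.
- move=> y y0; apply: cont_at; first by rewrite /rden; lims; exact: rden_den.
  by [].
- move=> y y0; rewrite /has_der rden_pos ?ltW//; apply: is_derive_eq; first by der; neq.
  by field; neq.
- apply: cvg_at_right_filter; apply: fcvg_eq; first by lims; neq.
  by rewrite addr0 invr1.
- have h := @fcvg_invyl R 1.
  by apply: fcvg_eq; [lims|rewrite oppr0].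
Qed.

Lemma rden_integrable : mu.-integrable setT (EFin \o rden).
Proof.
apply: even_integrable; first exact: measurable_rden.
- exact: rden_ge0.
- exact: rdenN.
- by rewrite rden_int0 ltry.
Qed.

Lemma rden_int : \int[mu]_y rden y = 2.
Proof.
rewrite /Rintegral ge0_integral_even; last 3 first.
- exact: measurable_rden.
- exact: rden_ge0.
- exact: rdenN.
by rewrite rden_int0 /= mulr1.
Qed.

(* Both summands of the decomposition ln|x-y| = l - (l - ln|x-y|) are >= 0. *)
Definition lbig x y : R := ln (1 + x + `|y|).
Definition lgap x y : R := 2 * lbig x y - ln `|x - y| - ln `|x + y|.

Section ReferencePotential.
Variable x : R.
Hypotheses (x0 : 0 < x) (x1 : x != 1).

Let c1 : 1 + - (1 + x) != 0. Proof. by rewrite opprD addrA subrr sub0r oppr_eq0 gt_eqF. Qed.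
Let c2 : 1 + x != 0. Proof. by rewrite gt_eqF// addr_gt0. Qed.
Let c3 : 1 + - x != 0. Proof. by rewrite subr_eq0 eq_sym. Qed.

Lemma lbig_ge0 y : 0 <= lbig x y.
Proof. by rewrite /lbig ln_ge0// -addrA lerDl addr_ge0// ltW. Qed.

Lemma lnabs_le_lbig y : ln `|x - y| <= lbig x y.
Proof.
have X0 := x0.
have [->|xy] := eqVneq (x - y) 0; first by rewrite normr0 ln0// lbig_ge0.
have p : 0 < 1 + x + `|y| by have := normr_ge0 y; lra.
rewrite ler_ln ?posrE ?normr_gt0// (le_trans (ler_normB _ _))//.
by rewrite (gtr0_norm x0); lra.
Qed.

Lemma lnabs_le_lbig2 y : ln `|x + y| <= lbig x y.
Proof. by have := lnabs_le_lbig (- y); rewrite opprK /lbig normrN. Qed.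

Lemma lgap_ge0 y : 0 <= lgap x y.
Proof. have X0 := x0; rewrite /lgap; have := lnabs_le_lbig y; have := lnabs_le_lbig2 y; lra. Qed.

Lemma lgapN y : lgap x (- y) = lgap x y.
Proof. by rewrite /lgap /lbig normrN opprK; lra. Qed.

Lemma measurable_lbig : measurable_fun setT (lbig x).
Proof.
have X0 := x0.
apply: (measurableT_comp (@measurable_ln R)).
by apply: measurable_funD => //; exact: measurableT_comp.
Qed.

Lemma measurable_lgap : measurable_fun setT (lgap x).
Proof.
have X0 := x0.
apply: measurable_funB; last by apply: measurable_lnabs; exact: measurable_funD.
apply: measurable_funB; last by apply: measurable_lnabs; exact: measurable_funB.
by apply: measurable_funM => //; exact: measurable_lbig.
Qed.

Let lbigE y : 0 < y -> lbig x y = ln `|y - - (1 + x)|.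
Proof.
have X0 := x0.
by move=> y0; rewrite /lbig opprK (gtr0_norm y0) gtr0_norm; [congr ln; lra|lra].
Qed.

Lemma lbig_int0 :
  (\int[mu]_(y in `]0%R, +oo[) (lbig x y * rden y)%:E =
   ((1 + x) * ln (1 + x) / x)%:E)%E.
Proof.
have X0 := x0.
rewrite (@ge0_FTCoy _ _ (logprim (- (1 + x))) _ (logprim (- (1 + x)) 0) 0).
- rewrite sub0r logprim0 opprK normrN gtr0_norm; last by lra.
  by congr EFin; field; apply/andP; split; neq.
- by move=> y _; rewrite mulr_ge0 ?lbig_ge0 ?rden_ge0.
- move=> y y0; apply: cont_at; first (rewrite /rden /lbig; lims).
  + by have := normr_ge0 y; lra.
  + exact: rden_den.
  + by [].
- move=> y y0; have yc : y != - (1 + x) by neq.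
  rewrite /has_der.
  rewrite rden_pos; last exact: ltW.
  rewrite lbigE; last exact: y0.
  exact: (logprim_der c1 y0 yc).
- by apply: cvg_at_right_filter; exact: logprim_lim.
- exact: logprim_limy.
Qed.

(** The three logarithms are the cases [c = - (1 + x)], [c = x] and [c = - x] of [logprim]. The
    integral is cut at the singularity [y = x], across which the primitive is continuous. *)
Lemma lgap_int0 :
  (\int[mu]_(y in `]0%R, +oo[) (lgap x y * rden y)%:E =
   (2 * ((1 + x) * ln (1 + x) / x) - 2 * x ^+ 2 * ln x / (x ^+ 2 - 1))%:E)%E.
Proof.
have X0 := x0.
pose G y := 2 * logprim (- (1 + x)) y - logprim x y - logprim (- x) y.
have Gd y : 0 < y -> y != x -> has_der G y (lgap x y * rden y).
  move=> y0 yx; rewrite /has_der.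
  have d1 := logprim_der c1 y0 (_ : y != - (1 + x)).
  have d2 := logprim_der c2 y0 yx.
  have d3 := logprim_der c3 y0 (_ : y != - x).
  have {}d1 := d1 ltac:(neq). have {}d3 := d3 ltac:(neq).
  have d := isder_add (isder_add (isder_mul (isder_cst 2 y) d1) (isder_opp d2)) (isder_opp d3).
  apply: (is_derive_eq d).
  rewrite rden_pos ?ltW// /lgap lbigE// (distrC x y) (addrC x y) !opprK.
  by ring.
have Gl (a : R) : 0 <= a -> G y @[y --> a] --> G a.
  move=> a0; have h1 := logprim_lim c1 a0; have h2 := logprim_lim c2 a0.
  by have h3 := logprim_lim c3 a0; rewrite /G; lims.
have Gc y : 0 < y -> y != x -> {for y, continuous (fun y => lgap x y * rden y)}.
  move=> y0 yx; apply: cont_at; first (rewrite /rden /lgap /lbig; lims).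
  - by have := normr_ge0 y; lra.
  - by rewrite normr_gt0 subr_eq0 eq_sym.
  - by rewrite normr_gt0; neq.
  - exact: rden_den.
  - by [].
have h0 y : 0 <= lgap x y * rden y by rewrite mulr_ge0 ?lgap_ge0 ?rden_ge0.
rewrite (@ge0_integral_split_oy _ 0 x)//; last first.
  by apply: measurable_funTS; apply: measurable_funM; [exact: measurable_lgap|exact: measurable_rden].
have -> : (\int[mu]_(y in `]0%R, x[) (lgap x y * rden y)%:E = (G x - G 0)%:E)%E.
  apply: (ge0_FTCoo (F := G)).
  - exact: x0.
  - by move=> y _; exact: h0.
  - by move=> y /andP[y0 yx]; apply: Gc => //; rewrite lt_eqF.
  - by move=> y /andP[y0 yx]; apply: Gd; [exact: y0|rewrite lt_eqF].
  - by apply: cvg_at_right_filter; exact: Gl.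
  - by apply: cvg_at_left_filter; apply: Gl; exact: ltW.
have -> : (\int[mu]_(y in `]x, +oo[) (lgap x y * rden y)%:E = (0 - G x)%:E)%E.
  apply: (ge0_FTCoy (F := G)).
  - by move=> y _; exact: h0.
  - by move=> y yx; apply: Gc; [lra|rewrite gt_eqF].
  - by move=> y yx; apply: Gd; [lra|rewrite gt_eqF].
  - by apply: cvg_at_right_filter; apply: Gl; exact: ltW.
  - have h1 := logprim_limy c1; have h2 := logprim_limy c2.
    have h3 := logprim_limy c3; rewrite /G.
    by apply: fcvg_eq; [lims|rewrite mulr0 !subr0].
rewrite -EFinD; congr EFin; rewrite /G !logprim0 !normrN (gtr0_norm x0) gtr0_norm; last by lra.
have e1 : x ^+ 2 - 1 != 0 by rewrite subr_sqr_1 mulf_neq0 ?subr_eq0//; neq.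
have e2 : x != 0 by neq.
by field; rewrite e1 e2 c3 c2 c1.
Qed.

Lemma lbig_integrable : mu.-integrable setT (EFin \o (fun y => lbig x y * rden y)).
Proof.
apply: even_integrable.
- by apply: measurable_funM; [exact: measurable_lbig|exact: measurable_rden].
- by move=> y; rewrite mulr_ge0 ?lbig_ge0 ?rden_ge0.
- by move=> y; rewrite rdenN /lbig normrN.
- by rewrite lbig_int0 ltry.
Qed.

Lemma lgap_integrable : mu.-integrable setT (EFin \o (fun y => lgap x y * rden y)).
Proof.
apply: even_integrable.
- by apply: measurable_funM; [exact: measurable_lgap|exact: measurable_rden].
- by move=> y; rewrite mulr_ge0 ?lgap_ge0 ?rden_ge0.
- by move=> y; rewrite rdenN lgapN.
- by rewrite lgap_int0 ltry.
Qed.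

Let lbig_int : \int[mu]_y (lbig x y * rden y) = 2 * ((1 + x) * ln (1 + x) / x).
Proof.
rewrite /Rintegral ge0_integral_even ?lbig_int0//.
- by apply: measurable_funM; [exact: measurable_lbig|exact: measurable_rden].
- by move=> y; rewrite mulr_ge0 ?lbig_ge0 ?rden_ge0.
- by move=> y; rewrite rdenN /lbig normrN.
Qed.

Let lgap_int : \int[mu]_y (lgap x y * rden y) =
  2 * (2 * ((1 + x) * ln (1 + x) / x) - 2 * x ^+ 2 * ln x / (x ^+ 2 - 1)).
Proof.
rewrite /Rintegral ge0_integral_even ?lgap_int0//.
- by apply: measurable_funM; [exact: measurable_lgap|exact: measurable_rden].
- by move=> y; rewrite mulr_ge0 ?lgap_ge0 ?rden_ge0.
- by move=> y; rewrite rdenN lgapN.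
Qed.

Lemma lnabs_rden_integrable_pos :
  mu.-integrable setT (EFin \o (fun y => ln `|x - y| * rden y)) /\
  mu.-integrable setT (EFin \o (fun y => ln `|x + y| * rden y)).
Proof.
have ig : mu.-integrable setT
    (EFin \o ((fun y => lbig x y * rden y) \+ (fun y => lgap x y * rden y))).
  exact: (integrableD measurableT lbig_integrable lgap_integrable).
split; apply: (le_integrable measurableT _ _ ig) => /=.
- apply/measurable_EFinP; apply: measurable_funM; last exact: measurable_rden.
  by apply: measurable_lnabs; exact: measurable_funB.
- move=> y _; rewrite lee_fin -mulrDl !normrM ler_wpM2r//.
  apply: le_trans (ler_norm _); rewrite ler_norml /lgap.
  have := lnabs_le_lbig y; have := lnabs_le_lbig2 y; have := lbig_ge0 y.
  by move=> ? ? ?; apply/andP; split; lra.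
- apply/measurable_EFinP; apply: measurable_funM; last exact: measurable_rden.
  by apply: measurable_lnabs; exact: measurable_funD.
- move=> y _; rewrite lee_fin -mulrDl !normrM ler_wpM2r//.
  apply: le_trans (ler_norm _); rewrite ler_norml /lgap.
  have := lnabs_le_lbig y; have := lnabs_le_lbig2 y; have := lbig_ge0 y.
  by move=> ? ? ?; apply/andP; split; lra.
Qed.

(** The auxiliary terms [(1 + x) * ln (1 + x) / x] brought by [lbig] and [lgap] cancel, and what
    remains is [2 * ln x - 2 * x^2 * ln x / (x^2 - 1)]. *)
Lemma logk_rden_int_pos :
  \int[mu]_y (logk y x * rden y) = - (2 * ln x / (x ^+ 2 - 1)).
Proof.
have X0 := x0.
have E y : logk y x * rden y =
    ln x * rden y - lbig x y * rden y + 2^-1 * (lgap x y * rden y).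
  by rewrite /logk /lgap (gtr0_norm x0); field.
have i1 := rden_integrable; have i2 := lbig_integrable; have i3 := lgap_integrable.
have i1' : mu.-integrable setT (EFin \o (fun y => ln x * rden y)).
  exact: (integrableZl measurableT (ln x) i1).
have i3' : mu.-integrable setT (EFin \o (fun y => 2^-1 * (lgap x y * rden y))).
  exact: (integrableZl measurableT 2^-1 i3).
have i4 : mu.-integrable setT (EFin \o (fun y => ln x * rden y - lbig x y * rden y)).
  exact: (integrableB measurableT i1' i2).
under eq_Rintegral do rewrite E.
rewrite RintegralD// RintegralB// !RintegralZl// rden_int lbig_int lgap_int.
have e1 : x ^+ 2 - 1 != 0.
  by rewrite subr_sqr_1 mulf_neq0 ?subr_eq0// gt_eqF// addr_gt0.
have e2 : x != 0 by neq.
by field; rewrite e1 e2.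
Qed.

End ReferencePotential.

Lemma lnabs_rden_integrable x : x != 0 -> `|x| != 1 ->
  mu.-integrable setT (EFin \o (fun y => ln `|x - y| * rden y)).
Proof.
rewrite neq_lt => /orP[x0|x0]; last first.
  by rewrite gtr0_norm// => x1; have [] := lnabs_rden_integrable_pos x0 x1.
rewrite ltr0_norm// => x1; have xN : 0 < - x by rewrite oppr_gt0.
have [_] := lnabs_rden_integrable_pos xN x1; apply: eq_integrable => // y _ /=.
by rewrite -(normrN (x - y)) opprB addrC.
Qed.

Lemma logk_rden_int x : x != 0 -> `|x| != 1 ->
  \int[mu]_y (logk y x * rden y) = - (2 * ln `|x| / (x ^+ 2 - 1)).
Proof.
move=> x0 x1; have nx0 : 0 < `|x| by rewrite normr_gt0.
rewrite -(real_normK (num_real x)) -logk_rden_int_pos//.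
apply: eq_Rintegral => y _; congr (_ * _); have [_|_] := ger0P x => //.
by rewrite logkN.
Qed.

End ReferenceDensity.

(** * The integral of [2 * ln |x| / (x^2 - 1)] *)

Section LogRatioIntegral.
Context {R : realType}.
Let mu := @lebesgue_measure R.
Implicit Types x y : R.

Lemma ae_notin (s : seq R) (P : R -> Prop) :
  (forall x, x \notin s -> P x) -> {ae mu, forall x, P x}.
Proof.
move=> sP; exists [set` s]; split.
- apply: countable_measurable; first by move=> t; exact: measurable_set1.
  by apply: finite_set_countable; exact: finite_seq.
- apply: countable_lebesgue_measure0; apply: finite_set_countable; exact: finite_seq.
- by move=> x /= nPx; apply: contrapT => /negP xs; apply: nPx; exact: sP.
Qed.

Lemma eq_integral_notin (s : seq R) (f g : R -> \bar R) :
  measurable_fun setT f -> measurable_fun setT g ->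
  (forall x, x \notin s -> f x = g x) ->
  (\int[mu]_x f x = \int[mu]_x g x)%E.
Proof.
move=> mf mg fg; apply: ae_eq_integral => //.
by apply: (ae_notin (s := s)) => x xs _; exact: fg.
Qed.

Lemma fcvg_atan_scaley (c : R) : 0 < c -> atan (c * x) @[x --> +oo] --> (pi / 2 : R).
Proof.
move=> c0; have H : c * x @[x --> +oo] --> +oo by apply: gt0_cvgMry => //; exact: cvg_id.
by move: (@cvgy_atan R); apply: cvg_comp.
Qed.

Lemma sqrt_cvgy : Num.sqrt x @[x --> +oo] --> (+oo : set_system R).
Proof.
apply/cvgryPge => A; near=> x.
have [A0|A0] := leP A 0; first by rewrite (le_trans A0)// sqrtr_ge0.
have H : A ^+ 2 <= x by near: x; apply: nbhs_pinfty_ge; exact: num_real.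
by have := ler_wsqrtr H; rewrite sqrtr_sqr gtr0_norm.
Unshelve. all: by end_near. Qed.

(** Chosen so that its integral in [y] is twice the logarithmic ratio, while its integral in [x] is
    elementary. *)
Definition kern2 x y : R := ((1 + `|y|) * (1 + x ^+ 2 * `|y|))^-1.

Lemma kern2_ge0 x y : 0 <= kern2 x y.
Proof. by rewrite invr_ge0 mulr_ge0// addr_ge0// mulr_ge0// sqr_ge0. Qed.

Lemma measurable_kern2 : measurable_fun [set: R * R] (fun p => kern2 p.1 p.2).
Proof.
apply: (measurableT_comp (@measurable_inv R)).
have m2 : measurable_fun [set: R * R] (fun p : R * R => `|p.2|).
  by apply: measurableT_comp => //; exact: measurable_snd.
apply: measurable_funM; apply: measurable_funD => //.
by apply: measurable_funM => //; apply: measurable_funX; exact: measurable_fst.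
Qed.

Let measurable_kern2y x : measurable_fun setT (kern2 x).
Proof.
rewrite (_ : kern2 x = (fun p : R * R => kern2 p.1 p.2) \o (fun y => (x, y)))//.
by apply: (measurableT_comp measurable_kern2); exact: measurable_pair1.
Qed.

Let measurable_kern2x y : measurable_fun setT (kern2 ^~ y).
Proof.
rewrite (_ : kern2 ^~ y = (fun p : R * R => kern2 p.1 p.2) \o (fun x => (x, y)))//.
by apply: (measurableT_comp measurable_kern2); exact: measurable_pair2.
Qed.

Let pos1 (a y : R) : 0 <= a -> 0 < y -> 0 < 1 + a * y.
Proof. by move=> a0 y0; rewrite ltr_pwDl// mulr_ge0// ltW. Qed.

Lemma kern2_int_y x : x != 0 -> `|x| != 1 ->
  (\int[mu]_y (kern2 x y)%:E = (4 * (ln `|x| / (x ^+ 2 - 1)))%:E)%E.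
Proof.
move=> x0 x1; rewrite ge0_integral_even; last 3 first.
- exact: measurable_kern2y.
- exact: kern2_ge0.
- by move=> y; rewrite /kern2 normrN.
set a := x ^+ 2; have a0 : 0 < a by rewrite /a exprn_even_gt0.
have a1 : 1 - a != 0.
  rewrite subr_eq0 eq_sym /a -(real_normK (num_real x)).
  by rewrite -[X in _ == X](expr1n R 2) eqrXn2.
have aV0 : a != 0 by rewrite gt_eqF.
have kE y : 0 < y -> kern2 x y = ((1 + y) * (1 + a * y))^-1.
  by move=> y0; rewrite /kern2 (gtr0_norm y0).
have -> : (\int[mu]_(y in `]0%R, +oo[) (kern2 x y)%:E =
    ((- ln a) / (1 - a) - 0)%:E)%E.
  apply: (ge0_FTCoy (F := fun y => (ln (1 + y) - ln (1 + a * y)) / (1 - a))).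
  - by move=> y _; exact: kern2_ge0.
  - move=> y y0; have p := pos1 (ltW a0) y0.
    apply: cont_at; first (rewrite /kern2; lims).
      by rewrite (gtr0_norm y0) mulf_neq0//; [neq|rewrite gt_eqF].
    by [].
  - move=> y y0; have p := pos1 (ltW a0) y0; have p1 : 0 < 1 + y by lra.
    rewrite /has_der kE//; isder => //.
    by field; rewrite a1 (gt_eqF p) (gt_eqF p1).
  - apply: cvg_at_right_filter; apply: fcvg_eq; first by lims => //; rewrite ?mulr0 addr0 ltr01.
    by rewrite mulr0 !addr0 ln1 subrr mul0r.
  - have H : (ln (y - (- 1)) - ln y - (ln (y - (- a^-1)) - ln y) - ln a) / (1 - a)
       @[y --> +oo] --> (- ln a / (1 - a) : R).
      have h1 := @fcvg_ln_sub R (- 1); have h2 := @fcvg_ln_sub R (- a^-1).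
      by apply: fcvg_eq; [lims|rewrite subrr sub0r].
    apply: fcvg_near H; near=> y.
    have y0 : 0 < y by near: y; exact: near_pinfty_gt.
    have aVp : 0 < a^-1 by rewrite invr_gt0.
    have -> : 1 + a * y = a * (y - - a^-1) by field.
    rewrite lnM ?posrE//; last by lra.
    rewrite !opprK (addrC y 1); congr (_ / _); lra.
rewrite -EFinM; congr EFin; rewrite subr0.
have -> : ln a = 2 * ln `|x|.
  by rewrite /a -(real_normK (num_real x)) lnXn ?normr_gt0// mulr_natl.
have a2 : a - 1 != 0 by rewrite -oppr_eq0 opprB.
by field; rewrite a1 a2.
Unshelve. all: by end_near. Qed.

Lemma kern2_int_x y : y != 0 ->
  (\int[mu]_x (kern2 x y)%:E = (pi * ((Num.sqrt `|y|)^-1 / (1 + `|y|)))%:E)%E.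
Proof.
move=> y0; rewrite ge0_integral_even; last 3 first.
- exact: measurable_kern2x.
- by move=> x; exact: kern2_ge0.
- by move=> x; rewrite /kern2 sqrrN.
set b := `|y|; have b0 : 0 < b by rewrite normr_gt0.
set s := Num.sqrt b; have s0 : 0 < s by rewrite sqrtr_gt0.
have bs : b = s ^+ 2 by rewrite /s sqr_sqrtr// ltW.
have sn : s != 0 by rewrite gt_eqF.
have bn : 1 + b != 0 by neq.
have xn x : 1 + x ^+ 2 * b != 0 by rewrite gt_eqF// ltr_pwDl// mulr_ge0 ?sqr_ge0 ?(ltW b0).
have -> : (\int[mu]_(x in `]0%R, +oo[) (kern2 x y)%:E =
    ((pi / 2) * (s^-1 / (1 + b)) - 0)%:E)%E.
  apply: (ge0_FTCoy (F := fun x => atan (s * x) * (s^-1 / (1 + b)))).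
  - by move=> x _; exact: kern2_ge0.
  - move=> x x0; apply: cont_at; first (rewrite /kern2 -/b; lims).
      by rewrite mulf_neq0.
    by [].
  - move=> x x0; rewrite /has_der /kern2 -/b; isder => //.
    have := xn x; rewrite {2}bs => xn'; rewrite bs in xn' bn *.
    by field; rewrite sn bn -exprMn mulrC in xn' *; rewrite ?xn' //.
  - apply: cvg_at_right_filter; apply: fcvg_eq; first by lims.
    by rewrite mulr0 atan0 mul0r.
  - have h := fcvg_atan_scaley s0; lims.
by rewrite -EFinM; congr EFin; rewrite subr0; field; rewrite sn bn.
Qed.

Let sqrtden_int : (\int[mu]_y (pi * ((Num.sqrt `|y|)^-1 / (1 + `|y|)))%:E = (2 * pi ^+ 2)%:E)%E.
Proof.
have p0 : 0 <= (pi : R) := pi_ge0 R.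
have h0 (y : R) : 0 <= pi * ((Num.sqrt `|y|)^-1 / (1 + `|y|)).
  by rewrite mulr_ge0// divr_ge0 ?invr_ge0 ?sqrtr_ge0// addr_ge0.
rewrite ge0_integral_even//; last 2 first.
- apply: measurable_funM => //; apply: measurable_funM.
    apply: (measurableT_comp (@measurable_inv R)).
    by apply: (measurableT_comp (@measurable_sqrt R)); exact: normr_measurable.
  apply: (measurableT_comp (@measurable_inv R)).
  by apply: measurable_funD => //; exact: normr_measurable.
- by move=> y; rewrite normrN.
have -> : (\int[mu]_(y in `]0%R, +oo[) (pi * ((Num.sqrt `|y|)^-1 / (1 + `|y|)))%:E =
    (pi * (2 * (pi / 2)) - 0)%:E)%E.
  apply: (ge0_FTCoy (F := fun y => pi * (2 * atan (Num.sqrt y)))).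
  - by move=> y _; exact: h0.
  - move=> y y0; apply: cont_at; first lims.
    + by rewrite sqrtr_eq0 -ltNge (gtr0_norm y0).
    + by rewrite (gtr0_norm y0); neq.
    + by [].
  - move=> y y0; rewrite /has_der (gtr0_norm y0); isder => //.
    have sn : Num.sqrt y != 0 by rewrite sqrtr_eq0 -ltNge.
    have yn : 1 + y != 0 by neq.
    by rewrite sqr_sqrtr ?(ltW y0)//; field; rewrite sn yn.
  - apply: cvg_at_right_filter; apply: fcvg_eq; first by lims.
    by rewrite sqrtr0 atan0 !mulr0.
  - have h : atan (Num.sqrt y) @[y --> +oo] --> (pi / 2 : R).
      by move: (@cvgy_atan R); apply: cvg_comp; exact: sqrt_cvgy.
    by lims.
by rewrite -EFinM; congr EFin; field.
Qed.

Lemma lnratio_ge0 x : 0 <= 2 * ln `|x| / (x ^+ 2 - 1).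
Proof.
have [->|x0] := eqVneq x 0; first by rewrite normr0 ln0// mulr0 mul0r.
rewrite -mulrA mulr_ge0//.
have nx : 0 < `|x| by rewrite normr_gt0.
rewrite -(real_normK (num_real x)).
have [x1|x1] := leP 1 `|x|.
  by rewrite divr_ge0 ?ln_ge0// subr_ge0 exprn_ege1.
rewrite -mulrNN -invrN mulr_ge0//; first by rewrite oppr_ge0 ln_le0// ltW.
by rewrite invr_ge0 opprB subr_ge0 exprn_ile1// ltW.
Qed.

Lemma measurable_lnratio : measurable_fun setT (fun x : R => 2 * ln `|x| / (x ^+ 2 - 1)).
Proof.
apply: measurable_funM.
  by apply: measurable_funM => //; apply: measurable_lnabs; exact: measurable_id.
apply: (measurableT_comp (@measurable_inv R)).
by apply: measurable_funB => //; exact: measurable_funX.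
Qed.

(** Twice the left side is the double integral of [kern2]. Integrating in [x] first leaves
    [pi / (sqrt |y| * (1 + |y|))], whose primitive on the half line is [2 * pi * atan (sqrt y)]. The
    closed forms are valid off [0], [1] and [-1], a null set. *)
Lemma lnratio_int0 : (\int[mu]_x (2 * ln `|x| / (x ^+ 2 - 1))%:E = (pi ^+ 2)%:E)%E.
Proof.
have mk : measurable_fun setT (fun p : R * R => (kern2 p.1 p.2)%:E).
  by apply/measurable_EFinP; exact: measurable_kern2.
have k0 (p : R * R) : (0 <= (kern2 p.1 p.2)%:E)%E by rewrite lee_fin kern2_ge0.
have E : (2%:E * \int[mu]_x (2 * ln `|x| / (x ^+ 2 - 1))%:E = (2 * pi ^+ 2)%:E)%E.
  rewrite -ge0_integralZl//; last 2 first.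
  - by apply/measurable_EFinP; exact: measurable_lnratio.
  - by move=> x _; rewrite lee_fin lnratio_ge0.
  rewrite -sqrtden_int.
  transitivity (\int[mu]_x \int[mu]_y (kern2 x y)%:E)%E.
    apply: (@eq_integral_notin [:: 0; 1; -1]).
    - apply: measurable_funeM; apply/measurable_EFinP; exact: measurable_lnratio.
    - exact: (measurable_fun_fubini_tonelli_F (m2 := mu) _ mk k0).
    - move=> x; rewrite !inE !negb_or => /and3P[x0 x1 xN1].
      rewrite kern2_int_y//; last first.
        by rewrite eqr_norml negb_and negb_or x1 xN1.
      by rewrite -EFinM; congr EFin; ring.
  rewrite (fubini_tonelli (m1 := mu) (m2 := mu) _ mk k0).
  apply: (@eq_integral_notin [:: 0]).
  - exact: (measurable_fun_fubini_tonelli_G (m1 := mu) _ mk k0).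
  - apply/measurable_EFinP; apply: measurable_funM => //; apply: measurable_funM.
      apply: (measurableT_comp (@measurable_inv R)).
      by apply: (measurableT_comp (@measurable_sqrt R)); exact: normr_measurable.
    apply: (measurableT_comp (@measurable_inv R)).
    by apply: measurable_funD => //; exact: normr_measurable.
  - by move=> y; rewrite inE => y0; exact: kern2_int_x.
have : (2^-1%:E * (2%:E * \int[mu]_x (2 * ln `|x| / (x ^+ 2 - 1))%:E) = 2^-1%:E * (2 * pi ^+ 2)%:E)%E.
  by rewrite E.
by rewrite muleA -!EFinM mulrA mulVf// mul1e mul1r.
Qed.

Lemma lnratio_integrable :
  mu.-integrable setT (EFin \o (fun x : R => 2 * ln `|x| / (x ^+ 2 - 1))).
Proof.
apply/integrableP; split; first by apply/measurable_EFinP; exact: measurable_lnratio.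
under eq_integral do rewrite /= ger0_norm ?lnratio_ge0//.
by rewrite lnratio_int0 ltry.
Qed.

Lemma lnratio_int : \int[mu]_x (2 * ln `|x| / (x ^+ 2 - 1)) = pi ^+ 2.
Proof. by rewrite /Rintegral lnratio_int0. Qed.

End LogRatioIntegral.

(** * The integrated potential of an even neutral measure *)

Section HtEven.
Context {R : realType}.
Let mu := @lebesgue_measure R.
Implicit Types x y : R.

Lemma measurable_notin (s : seq R) (f g : R -> R) : measurable_fun setT g ->
  (forall x, x \notin s -> f x = g x) -> measurable_fun setT f.
Proof.
move=> mg fg.
have cs (A : set R) : A `<=` [set` s] -> measurable A.
  move=> As; apply: countable_measurable; first by move=> t; exact: measurable_set1.
  apply: finite_set_countable; apply: sub_finite_set As _; exact: finite_seq.
rewrite -(setUv [set` s]); apply/measurable_funU.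
- by apply: cs.
- by apply: measurableC; apply: cs.
split; first by move=> _ Y mY; apply: cs; exact: subIsetl.
apply: (eq_measurable_fun g); last exact: measurable_funTS.
by move=> x; rewrite inE /= => /negP xs; rewrite fg.
Qed.

Lemma Rintegral_notin (s : seq R) (f g : R -> R) : measurable_fun setT g ->
  (forall x, x \notin s -> f x = g x) -> \int[mu]_x f x = \int[mu]_x g x.
Proof.
move=> mg fg; rewrite /Rintegral; congr fine; apply: (@eq_integral_notin _ s).
- by apply/measurable_EFinP; exact: (measurable_notin mg fg).
- exact/measurable_EFinP.
- by move=> x xs; rewrite fg.
Qed.

Section EvenDensity.
Variables (f : R -> R) (a p kappa : R).
Hypotheses (mf : measurable_fun setT f) (fe : forall y, f (- y) = f y).
Variables C1 C2 : R.
(** [f1] makes the potential converge at each [x]. [f2] has the extra factor [|y|] because the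
    kernel has an L1 norm proportional to [|y|], and is what Fubini needs. [f0] is neutrality, the
    atoms at [p] and [- p] having mass [a] each. *)
Hypotheses (f1 : forall y, `|f y| <= C1 * rden y)
  (f2 : forall y, `|y| * `|f y + kappa * rden y| <= C2 * rden y)
  (f0 : \int[mu]_y f y = - (2 * a)).

Let g y := f y + kappa * rden y.
Let mg : measurable_fun setT g.
Proof.
by apply: measurable_funD => //; apply: measurable_funM => //; exact: measurable_rden.
Qed.

Lemma dominated_rden (h k : R -> R) (C : R) :
  measurable_fun setT h -> measurable_fun setT k ->
  (forall y, `|k y| <= C * rden y) ->
  mu.-integrable setT (EFin \o (fun y => h y * rden y)) ->
  mu.-integrable setT (EFin \o (fun y => h y * k y)).
Proof.
move=> mh mk kC ih.
have iC : mu.-integrable setT (EFin \o (fun y => C * (h y * rden y))).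
  exact: (integrableZl measurableT C ih).
apply: (le_integrable measurableT _ _ iC) => /=.
  by apply/measurable_EFinP; exact: measurable_funM.
move=> y _; rewrite lee_fin mulrCA !normrM ler_wpM2l// (le_trans (kC y))//.
by rewrite -normrM ler_norm.
Qed.

Let f_int : mu.-integrable setT (EFin \o f).
Proof.
have i1 : mu.-integrable setT (EFin \o (fun y => 1 * rden y)).
  by apply: eq_integrable (@rden_integrable R) => // y _ /=; rewrite mul1r.
have := dominated_rden (h := fun _ => 1) (k := f) _ mf f1 i1.
by move=> /(_ (measurable_cst _)); apply: eq_integrable => // y _ /=; rewrite mul1r.
Qed.

Let lnm x y := ln `|x - y|.
Let mlnm x : measurable_fun setT (lnm x).
Proof. by apply: measurable_lnabs; exact: measurable_funB. Qed.

Let logk_rden_integrable x : x != 0 -> `|x| != 1 ->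
  mu.-integrable setT (EFin \o (fun y => logk y x * rden y)).
Proof.
move=> x0 x1; have i1 := lnabs_rden_integrable x0 x1.
have i2 : mu.-integrable setT (EFin \o (fun y => ln `|x + y| * rden y)).
  have := integrable_dilate (k := -1) _ i1; rewrite oppr_eq0 oner_eq0 => /(_ isT).
  by apply: eq_integrable => // y _ /=; rewrite mulN1r opprK rdenN.
have i3 : mu.-integrable setT (EFin \o (fun y => ln `|x| * rden y)).
  exact: (integrableZl measurableT (ln `|x|) (@rden_integrable R)).
have i12 : mu.-integrable setT (EFin \o (fun y => 2^-1 * (ln `|x - y| * rden y + ln `|x + y| * rden y))).
  exact: (integrableZl measurableT 2^-1 (integrableD measurableT i1 i2)).
have := integrableB measurableT i3 i12; apply: eq_integrable => // y _ /=.
by rewrite -EFinB; congr EFin; rewrite /logk; field.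
Qed.

Let measurable_logky x : measurable_fun setT (logk ^~ x).
Proof.
apply: measurable_funB => //; apply: measurable_funM => //.
apply: measurable_funD; apply: measurable_lnabs.
  exact: measurable_funB.
exact: measurable_funD.
Qed.

(** Neutrality lets [ln |x|] be added to the kernel at no cost, evenness lets the kernel be
    symmetrised in [y], and the part [- kappa * rden] of the density contributes its explicit
    potential. *)
Let pot_eq x : x != 0 -> `|x| != 1 ->
  \int[mu]_y (- ln `|x - y| * f y) + - (a * (ln `|x - p| + ln `|x + p|)) =
  \int[mu]_y (logk y x * g y) + 2 * a * logk p x + kappa * (2 * ln `|x| / (x ^+ 2 - 1)).
Proof.
move=> x0 x1; have ir := lnabs_rden_integrable x0 x1.
have i1 : mu.-integrable setT (EFin \o (fun y => ln `|x - y| * f y)).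
  exact: (dominated_rden (mlnm x) mf f1 ir).
have i1' : mu.-integrable setT (EFin \o (fun y => ln `|x + y| * f y)).
  have := integrable_dilate (k := -1) _ i1; rewrite oppr_eq0 oner_eq0 => /(_ isT).
  by apply: eq_integrable => // y _ /=; rewrite mulN1r opprK fe.
have e1 : \int[mu]_y (ln `|x + y| * f y) = \int[mu]_y (ln `|x - y| * f y).
  have := Rintegral_dilate (k := -1) _ i1; rewrite oppr_eq0 oner_eq0 => /(_ isT).
  rewrite normrN1 invr1 mul1r => <-; apply: eq_Rintegral => y _.
  by rewrite mulN1r opprK fe.
have ik := logk_rden_integrable x0 x1.
have i2 : mu.-integrable setT (EFin \o (fun y => logk y x * f y)).
  exact: (dominated_rden (measurable_logky x) mf f1 ik).
have i3 : mu.-integrable setT (EFin \o (fun y => kappa * (logk y x * rden y))).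
  exact: (integrableZl measurableT kappa ik).
have eg : \int[mu]_y (logk y x * g y) =
    \int[mu]_y (logk y x * f y) + kappa * \int[mu]_y (logk y x * rden y).
  rewrite -RintegralZl// -RintegralD//; apply: eq_Rintegral => y _.
  by rewrite /g; ring.
have i4 : mu.-integrable setT (EFin \o (fun y => ln `|x| * f y)).
  exact: (integrableZl measurableT (ln `|x|) f_int).
have i12 : mu.-integrable setT (EFin \o (fun y => ln `|x - y| * f y + ln `|x + y| * f y)).
  exact: (integrableD measurableT i1 i1').
have i12' : mu.-integrable setT (EFin \o (fun y => 2^-1 * (ln `|x - y| * f y + ln `|x + y| * f y))).
  exact: (integrableZl measurableT 2^-1 i12).
have ef : \int[mu]_y (logk y x * f y) = - (ln `|x| * (2 * a)) - \int[mu]_y (ln `|x - y| * f y).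
  transitivity (\int[mu]_y (ln `|x| * f y - 2^-1 * (ln `|x - y| * f y + ln `|x + y| * f y))).
    by apply: eq_Rintegral => y _; rewrite /logk; field.
  rewrite RintegralB// RintegralZl// RintegralZl// RintegralD// e1 f0.
  by field.
rewrite eg logk_rden_int// ef.
have -> : \int[mu]_y (- ln `|x - y| * f y) = - \int[mu]_y (ln `|x - y| * f y).
  rewrite -[RHS]mulN1r -RintegralZl//; apply: eq_Rintegral => y _.
  by rewrite mulN1r mulNr.
by rewrite [logk p x]/logk; move: (x ^+ 2 - 1)^-1 => z; field.
Qed.

Let F (q : R * R) := (logk q.2 q.1 * g q.2)%:E.

Let mF : measurable_fun setT F.
Proof.
apply/measurable_EFinP; apply: measurable_funM; first exact: measurable_logk2.
by apply: (measurableT_comp mg); exact: measurable_snd.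
Qed.

Let logk0 x : logk 0 x = 0.
Proof. by rewrite /logk subr0 addr0; field. Qed.

Let logk_absint y : (\int[mu]_x (`|logk y x|)%:E = (@logk_cst R * `|y|)%:E)%E.
Proof.
have [->|y0] := eqVneq y 0; last by have [] := logk_int y0.
rewrite normr0 mulr0 integral0_eq// => x _; by rewrite logk0 normr0.
Qed.

Let logk_integrable y : mu.-integrable setT (EFin \o logk y).
Proof.
have [->|y0] := eqVneq y 0; last by have [] := logk_int y0.
by apply: eq_integrable (integrable0 _ _) => // x _ /=; rewrite logk0.
Qed.

Let logk_int0 y : \int[mu]_x logk y x = 0.
Proof.
have [->|y0] := eqVneq y 0; last by have [] := logk_int y0.
by rewrite /Rintegral integral0_eq// => x _; rewrite logk0.
Qed.

Let iF : (mu \x mu)%E.-integrable setT F.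
Proof.
apply (integrable21ltyP mu mu mF).
have E y : (\int[mu]_x `|F (x, y)| = (@logk_cst R * (`|y| * `|g y|))%:E)%E.
  under eq_integral do rewrite /F /= normrM mulrC EFinM.
  rewrite ge0_integralZl//.
  - by rewrite logk_absint -EFinM; congr EFin; ring.
  - by apply/measurable_EFinP; apply: measurableT_comp => //; exact: measurable_logk.
under eq_integral do rewrite E.
have iC : mu.-integrable setT (EFin \o (fun y => @logk_cst R * (C2 * rden y))).
  exact: (integrableZl measurableT (@logk_cst R) (integrableZl measurableT C2 (@rden_integrable R))).
have c0 : 0 <= @logk_cst R.
  by rewrite -lee_fin -[@logk_cst R]mulr1 -(normr1 R) -logk_absint integral_ge0.
apply: le_lt_trans (integrable_lty measurableT iC).
apply: ge0_le_integral => //=.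
- by move=> y _; rewrite lee_fin mulr_ge0// mulr_ge0.
- apply/measurable_EFinP; apply: measurable_funM => //; apply: measurable_funM.
    exact: normr_measurable.
  exact: measurableT_comp.
- by apply/measurable_EFinP; apply: measurable_funM => //; apply: measurable_funM => //;
    exact: measurable_rden.
- by move=> y _; rewrite lee_fin ler_wpM2l.
Qed.

Let Fg_integrable : mu.-integrable setT (fun x => \int[mu]_y F (x, y))%E.
Proof. exact: integrable_fubini_F. Qed.

Let Fg_int : (\int[mu]_x \int[mu]_y F (x, y) = 0)%E.
Proof.
rewrite (Fubini iF) integral0_eq// => y _.
have -> : (\int[mu]_x F (x, y) = (g y)%:E * \int[mu]_x (logk y x)%:E)%E.
  rewrite -integralZl//; last exact: logk_integrable.
  by apply: eq_integral => x _; rewrite /F /= mulrC EFinM.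
have fi := integrable_fin_num measurableT (logk_integrable y).
rewrite -[X in (_ * X)%E](fineK fi) (_ : fine _ = 0) ?mule0//.
exact: logk_int0.
Qed.

(** Of the three terms of [pot_eq], the first integrates to 0 by Fubini, since every [logk y] has
    integral 0; the second does so for the same reason; the third gives [kappa * pi^2]. *)
Lemma Ht_even (m : smeas R) : dens m = f ->
  (forall x, \sum_(q <- atoms m) q.2 * (- ln `|x - q.1|) =
             - (a * (ln `|x - p| + ln `|x + p|))) ->
  Ht m = pi ^+ 2 * kappa.
Proof.
move=> mE sumE.
pose V x := fine (\int[mu]_y F (x, y))%E + 2 * a * logk p x + kappa * (2 * ln `|x| / (x ^+ 2 - 1)).
have i1 : mu.-integrable setT (EFin \o (fun x => fine (\int[mu]_y F (x, y))%E)).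
  have mG : measurable_fun setT (fun x => fine (\int[mu]_y F (x, y))%E).
    by apply: measurableT_comp => //; exact: (measurable_int _ Fg_integrable).
  apply: le_integrable Fg_integrable => //; first exact/measurable_EFinP.
  by move=> x _ /=; case: (\int[mu]_y F (x, y))%E => //= ; rewrite normr0 ?leey.
have i2 : mu.-integrable setT (EFin \o (fun x => 2 * a * logk p x)).
  exact: (integrableZl measurableT (2 * a) (logk_integrable p)).
have i3 : mu.-integrable setT (EFin \o (fun x : R => kappa * (2 * ln `|x| / (x ^+ 2 - 1)))).
  exact: (integrableZl measurableT kappa (@lnratio_integrable R)).
have i12 : mu.-integrable setT
    (EFin \o (fun x => fine (\int[mu]_y F (x, y))%E + 2 * a * logk p x)).
  exact: (integrableD measurableT i1 i2).
have mV : measurable_fun setT V.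
  by apply/measurable_EFinP; apply: (measurable_int mu); exact: (integrableD measurableT i12 i3).
rewrite /Ht (@Rintegral_notin [:: 0; 1; -1] _ V)//; last first.
  move=> x; rewrite !inE !negb_or => /and3P[x0 x1 xN1].
  rewrite /potential mE sumE pot_eq//.
  by rewrite eqr_norml negb_and negb_or x1 xN1.
rewrite (RintegralD measurableT i12 i3) (RintegralD measurableT i1 i2).
rewrite (RintegralZl _ measurableT (logk_integrable p)).
rewrite (RintegralZl _ measurableT (@lnratio_integrable R)).
rewrite lnratio_int logk_int0 mulr0 addr0.
have -> : \int[mu]_x fine (\int[mu]_y F (x, y))%E = 0.
  rewrite /Rintegral (_ : (\int[mu]_x _)%E = 0%E)// -[RHS]Fg_int.
  apply: ae_eq_integral => //.
  - exact: (measurable_int _ i1).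
  - exact: (measurable_int _ Fg_integrable).
  - have := integrable_ae measurableT Fg_integrable.
    by apply: filterS => x /(_ I) /fineK h _.
by rewrite add0r mulrC.
Qed.

End EvenDensity.
End HtEven.

(** * The densities and their neutrality *)

Section Tails.
Context {R : realType}.
Let mu := @lebesgue_measure R.
Implicit Types (f : R -> R) (x y : R).

(** This is the form that the expansion of the square root delivers, and it is stable under
    dilation; [tail_rden] turns it into the comparison with [rden] that [Ht_even] expects. *)
Definition tail_bounded f (kappa : R) : Prop :=
  (exists K : R, forall y : R, `|f y| <= K) /\
  (exists M C : R, [/\ 0 < M, 0 <= C &
     forall y : R, M <= `|y| -> `|f y + kappa / y ^+ 2| <= C / `|y| ^+ 3]).

Lemma tail_scale f kappa l : 0 < l -> tail_bounded f kappa ->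
  tail_bounded (fun y => f (y / l)) (kappa * l ^+ 2).
Proof.
move=> l0 [[K fK] [M [C [M0 C0 fC]]]]; split; first by exists K => y; exact: fK.
exists (M * l), (C * l ^+ 3); split; first exact: mulr_gt0.
  by rewrite mulr_ge0// exprn_ge0// ltW.
move=> y My; have := fC (y / l).
have nl : `|y / l| = `|y| / l by rewrite normrM [X in _ * X]gtr0_norm ?invr_gt0.
rewrite nl ler_pdivlMr// => /(_ My).
have y0 : 0 < `|y| by apply: lt_le_trans My; exact: mulr_gt0.
have yn : y != 0 by rewrite -normr_gt0.
have -> : kappa / (y / l) ^+ 2 = kappa * l ^+ 2 / y ^+ 2.
  by field; rewrite yn gt_eqF.
have -> // : C / (`|y| / l) ^+ 3 = C * l ^+ 3 / `|y| ^+ 3.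
by field; rewrite !gt_eqF.
Qed.

Lemma rden_lb (M y : R) : 0 <= M -> `|y| <= M -> 1 <= (1 + M) ^+ 2 * rden y.
Proof.
move=> M0 yM; rewrite /rden ler_pdivlMr ?mul1r; last first.
  by rewrite exprn_gt0// ltr_pwDl.
by rewrite lerXn2r ?nnegrE ?addr_ge0// lerD2l.
Qed.

Lemma rden_far (y : R) : 1 <= `|y| -> (`|y| ^+ 2)^-1 <= 4 * rden y.
Proof.
move=> y1; have y0 : 0 < `|y| by lra.
have p : 0 < (1 + `|y|) ^+ 2 by rewrite exprn_gt0//; lra.
rewrite /rden ler_pdivlMr// ler_pdivrMl ?exprn_gt0//.
nra.
Qed.

(** For [|y| <= M] boundedness is enough, [rden] being bounded below there. Beyond [M], replacing
    [1 / y^2] by [rden y] costs one more error of order [|y|^-3]. *)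
Lemma tail_rden f kappa : tail_bounded f kappa ->
  exists C1 C2 : R, (forall y, `|f y| <= C1 * rden y) /\
    (forall y, `|y| * `|f y + kappa * rden y| <= C2 * rden y).
Proof.
move=> [[K fK] [M' [C [M0' C0 fC']]]].
have K0 : 0 <= K by apply: le_trans (fK 0).
pose M := Num.max M' 1.
have M1 : 1 <= M by rewrite le_max lexx orbT.
have fC y : M <= `|y| -> `|f y + kappa / y ^+ 2| <= C / `|y| ^+ 3.
  by move=> My; apply: fC'; apply: le_trans My; rewrite le_max lexx.
have M0 : 0 <= M by lra.
have M20 : 0 <= (1 + M) ^+ 2 by exact: sqr_ge0.
have rle1 y : rden y <= 1.
  by rewrite /rden invf_le1 ?exprn_gt0 ?ltr_pwDl// exprn_ege1// lerDl.
exists (K * (1 + M) ^+ 2 + 4 * (`|kappa| + C)),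
  (M * (K + `|kappa|) * (1 + M) ^+ 2 + (4 * C + 3 * `|kappa|)); split=> y.
  have r0 := rden_ge0 y.
  have [yM|yM] := leP `|y| M.
    have h := rden_lb M0 yM.
    apply: (le_trans (fK y)); rewrite mulrDl -mulrA.
    apply: ler_wpDr; first by rewrite !mulr_ge0// addr_ge0.
    by rewrite -[leLHS]mulr1 ler_wpM2l.
  have y1 : 1 <= `|y| by lra.
  have y0 : 0 < `|y| by lra.
  have h := rden_far y1; have h2 := fC y (ltW yM).
  rewrite mulrDl; apply: ler_wpDl; first by rewrite mulr_ge0// mulr_ge0.
  have e1 : `|kappa / y ^+ 2| = `|kappa| * (`|y| ^+ 2)^-1.
    by rewrite normrM normfV normrX.
  have e2 : C / `|y| ^+ 3 <= C * (`|y| ^+ 2)^-1.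
    by rewrite ler_wpM2l// lef_pV2 ?posrE ?exprn_gt0// ler_weXn2l.
  have -> : f y = (f y + kappa / y ^+ 2) - kappa / y ^+ 2 by ring.
  rewrite (le_trans (ler_normB _ _))// e1.
  have := normr_ge0 kappa => k0; nra.
have r0 := rden_ge0 y; have k0 := normr_ge0 kappa.
have [yM|yM] := leP `|y| M.
  have h := rden_lb M0 yM.
  rewrite mulrDl; apply: ler_wpDr; first by rewrite !mulr_ge0// addr_ge0// mulr_ge0.
  have h1 : `|f y + kappa * rden y| <= K + `|kappa|.
    rewrite (le_trans (ler_normD _ _))// lerD// normrM (ger0_norm r0).
    by rewrite ler_piMr.
  apply: (@le_trans _ _ (M * (K + `|kappa|))); first by rewrite ler_pM.
  have k1 : 0 <= M * (K + `|kappa|) by rewrite mulr_ge0// addr_ge0.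
  by have := ler_wpM2l k1 h; rewrite mulr1 mulrA.
have y1 : 1 <= `|y| by lra.
have y0 : 0 < `|y| by lra.
have yn : y != 0 by rewrite -normr_gt0.
have h := rden_far y1; have h2 := fC y (ltW yM).
rewrite mulrDl; apply: ler_wpDl; first by rewrite !mulr_ge0// addr_ge0.
have -> : f y + kappa * rden y = (f y + kappa / y ^+ 2) - kappa * (`|y| ^+ 2)^-1 * (1 - `|y| ^+ 2 * rden y).
  rewrite -(real_normK (num_real y)); field; exact: lt0r_neq0.
apply: (@le_trans _ _ (C * (`|y| ^+ 2)^-1 + 3 * `|kappa| * rden y)); last by nra.
apply: (@le_trans _ _ (`|y| * (C / `|y| ^+ 3) + 3 * `|kappa| * rden y)); last first.
  rewrite lerD2r le_eqVlt; apply/orP; left; apply/eqP; field; exact: lt0r_neq0.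
have e1 : 1 - `|y| ^+ 2 * rden y = (1 + 2 * `|y|) * rden y.
  rewrite /rden; field; rewrite gt_eqF//; lra.
have e3 : `|kappa * (`|y| ^+ 2)^-1 * ((1 + 2 * `|y|) * rden y)| =
    `|kappa| * (`|y| ^+ 2)^-1 * ((1 + 2 * `|y|) * rden y).
  rewrite !normrM normfV (ger0_norm r0) (@ger0_norm _ (1 + _)) ?addr_ge0 ?mulr_ge0//.
  by rewrite (@ger0_norm _ (`|y| ^+ 2)) ?exprn_ge0.
have e4 : `|y| * (`|kappa| * (`|y| ^+ 2)^-1 * ((1 + 2 * `|y|) * rden y)) <= 3 * `|kappa| * rden y.
  have -> : `|y| * (`|kappa| * (`|y| ^+ 2)^-1 * ((1 + 2 * `|y|) * rden y)) =
    (`|kappa| * rden y) * ((1 + 2 * `|y|) / `|y|) by field; exact: lt0r_neq0.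
  have : (1 + 2 * `|y|) / `|y| <= 3 by rewrite ler_pdivrMr//; lra.
  by move=> h3; rewrite [leRHS](_ : _ = (`|kappa| * rden y) * 3); [rewrite ler_wpM2l// mulr_ge0|ring].
apply: (@le_trans _ _ (`|y| * (`|f y + kappa / y ^+ 2| + `|kappa * (`|y| ^+ 2)^-1 * (1 - `|y| ^+ 2 * rden y)|))).
  by rewrite ler_wpM2l// ler_normB.
rewrite e1 e3 mulrDr lerD// ler_wpM2l//.
Qed.

Lemma tail_integrable f kappa : measurable_fun setT f -> tail_bounded f kappa ->
  mu.-integrable setT (EFin \o f).
Proof.
move=> mf /tail_rden[C1 [_ [f1 _]]].
have i1 : mu.-integrable setT (EFin \o (fun y => 1 * rden y)).
  by apply: eq_integrable (@rden_integrable R) => // y _ /=; rewrite mul1r.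
have := dominated_rden (h := fun _ => 1) (measurable_cst _) mf f1 i1.
by apply: eq_integrable => // y _ /=; rewrite mul1r.
Qed.

(* With t = sqrt(1 - z) one has exactly (t - 1) + z/2 = - (1 - t)^2 / 2. *)
Lemma sqrt_taylor (z : R) : z <= 1 -> `|Num.sqrt (1 - z) - 1 + z / 2| <= z ^+ 2 / 2.
Proof.
move=> z1; set t := Num.sqrt _.
have t0 : 0 <= t by rewrite sqrtr_ge0.
have tz : t ^+ 2 = 1 - z by rewrite /t sqr_sqrtr// subr_ge0.
have -> : z = 1 - t ^+ 2 by rewrite tz; ring.
have -> : t - 1 + (1 - t ^+ 2) / 2 = - ((1 - t) ^+ 2 / 2) by field.
rewrite normrN ger0_norm; last by rewrite divr_ge0// sqr_ge0.
rewrite ler_pM2r ?invr_gt0//.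
have -> : 1 - t ^+ 2 = (1 - t) * (1 + t) by ring.
rewrite exprMn ler_peMr ?sqr_ge0//; nra.
Qed.

End Tails.

Section Densities.
Context {R : realType}.
Let mu := @lebesgue_measure R.
Implicit Types (A B a l x : R).

Definition densI a x : R := -1 + Num.sqrt (x ^+ 2 - a ^+ 2) / `|x|.

Definition densAB A B x : R :=
  -1 + Num.sqrt ((x ^+ 2 - B) * (x ^+ 2 - A)) / `|x ^+ 2 - 1|.

Lemma densI_tail a : 0 < a -> tail_bounded (densI a) (a ^+ 2 / 2).
Proof.
move=> a0.
have E x : x != 0 -> densI a x = Num.sqrt (1 - a ^+ 2 / x ^+ 2) - 1.
  move=> x0; rewrite /densI addrC; congr (_ - 1).
  rewrite -(sqrtr_sqr x) -sqrtrV ?sqr_ge0// mulrC -sqrtrM ?invr_ge0 ?sqr_ge0//.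
  by congr Num.sqrt; field.
split.
  exists 1 => x; have s0 : 0 <= Num.sqrt (x ^+ 2 - a ^+ 2) / `|x|.
    by rewrite divr_ge0 ?sqrtr_ge0.
  have s1 : Num.sqrt (x ^+ 2 - a ^+ 2) / `|x| <= 1.
    have [->|x0] := eqVneq x 0; first by rewrite normr0 invr0 mulr0.
    rewrite ler_pdivrMr ?normr_gt0// mul1r -(sqrtr_sqr x) ler_wsqrtr//.
    by rewrite gerBl sqr_ge0.
  by rewrite /densI ler_norml; apply/andP; split; lra.
exists (a + 1), (a ^+ 4 / 2); split=> [||x xa]; first lra.
  by rewrite divr_ge0// exprn_ge0// ltW.
have x0 : 0 < `|x| by lra.
have xn : x != 0 by rewrite -normr_gt0.
have x1 : 1 <= `|x| by lra.
have ax : a ^+ 2 <= x ^+ 2.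
  by rewrite -(real_normK (num_real x)) lerXn2r ?nnegrE//; lra.
have z1 : a ^+ 2 / x ^+ 2 <= 1 by rewrite ler_pdivrMr ?mul1r// exprn_even_gt0.
rewrite E// (_ : a ^+ 2 / 2 / x ^+ 2 = a ^+ 2 / x ^+ 2 / 2); last by ring.
rewrite (le_trans (sqrt_taylor z1))//.
have -> : (a ^+ 2 / x ^+ 2) ^+ 2 / 2 = a ^+ 4 / 2 * (`|x| ^+ 4)^-1.
  by rewrite -(real_normK (num_real x)); field; rewrite gt_eqF.
rewrite ler_wpM2l//; first by rewrite divr_ge0// exprn_ge0// ltW.
by rewrite lef_pV2 ?posrE ?exprn_gt0// ler_weXn2l.
Qed.

Lemma measurable_densI a : measurable_fun setT (densI a).
Proof.
apply: measurable_funD => //; apply: measurable_funM.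
  apply: (measurableT_comp (@measurable_sqrt R)).
  by apply: measurable_funB => //; exact: measurable_funX.
by apply: (measurableT_comp (@measurable_inv R)); exact: normr_measurable.
Qed.

Lemma measurable_densAB A B : measurable_fun setT (densAB A B).
Proof.
apply: measurable_funD => //; apply: measurable_funM.
  apply: (measurableT_comp (@measurable_sqrt R)).
  by apply: measurable_funM; apply: measurable_funB => //; exact: measurable_funX.
apply: (measurableT_comp (@measurable_inv R)); apply: measurableT_comp => //.
by apply: measurable_funB => //; exact: measurable_funX.
Qed.

Lemma densIN a x : densI a (- x) = densI a x.
Proof. by rewrite /densI sqrrN normrN. Qed.

Lemma densABN A B x : densAB A B (- x) = densAB A B x.
Proof. by rewrite /densAB sqrrN. Qed.

(** The danger is at [x^2 = 1]. A positive radicand forces [x^2 > B] or [x^2 < A], hence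
    [|x^2 - 1| >= min (B - 1) (1 - A)]; otherwise the square root is 0. *)
Lemma densAB_bounded A B : 0 <= A -> A < 1 -> 1 < B ->
  exists K : R, forall x, `|densAB A B x| <= K.
Proof.
move=> A0 A1 B1; pose r := Num.min (B - 1) (1 - A).
have r0 : 0 < r by rewrite lt_min; apply/andP; lra.
pose D := `|A + B - 2|.
exists (2 + D / r) => x.
have D0 : 0 <= D by exact: normr_ge0.
have Dr0 : 0 <= D / r by rewrite divr_ge0// ltW.
rewrite /densAB; set T := (x ^+ 2 - B) * _; set w := `|x ^+ 2 - 1|.
have w0 : 0 <= w by exact: normr_ge0.
have [T0|T0] := leP T 0.
  by rewrite ler0_sqrtr// mul0r addr0 normrN1; lra.
have w2 : w ^+ 2 = (x ^+ 2 - 1) ^+ 2 by rewrite real_normK ?num_real.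
have rw : r <= w.
  have [x1|x1] := leP 1 (x ^+ 2).
    rewrite /w ger0_norm ?subr_ge0// (@le_trans _ _ (B - 1)) ?ge_min ?lexx//.
    by have := T0; rewrite /T; nra.
  rewrite /w ltr0_norm ?subr_lt0// (@le_trans _ _ (1 - A)) ?ge_min ?lexx ?orbT//.
  by have := T0; rewrite /T; nra.
have wp : 0 < w by lra.
have Tw : T <= w ^+ 2 * (1 + D / r).
  have h1 : T <= w ^+ 2 + D * w.
    rewrite w2 /D /w -normrM (@le_trans _ _ ((x ^+ 2 - 1) ^+ 2 - (A + B - 2) * (x ^+ 2 - 1)))//.
      by rewrite /T; nra.
    by rewrite lerD2l -mulNr (le_trans (ler_norm _))// !normrM normrN.
  apply: (le_trans h1); rewrite mulrDr mulr1 lerD2l.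
  rewrite mulrA ler_pdivlMr// expr2 [leRHS]mulrC -mulrA ler_wpM2l//.
  by rewrite ler_wpM2l.
have s0 : 0 <= Num.sqrt T / w by rewrite divr_ge0 ?sqrtr_ge0.
have s1 : Num.sqrt T / w <= 1 + D / r.
  rewrite ler_pdivrMr//.
  have p0 : 0 <= (1 + D / r) * w by rewrite mulr_ge0//; lra.
  rewrite -[leRHS]ger0_norm// -sqrtr_sqr ler_wsqrtr// (le_trans Tw)//.
  rewrite exprMn mulrC ler_wpM2r ?sqr_ge0// expr2 ler_peMr//; lra.
by rewrite ler_norml; apply/andP; split; lra.
Qed.

(** With [v = x^2 - 1] and [c = (B - 1) * (1 - A)] the radicand is [v^2 - d * v - c = v^2 * (1 - z)]
    where [z = d / v + c / v^2], and [sqrt_taylor] applies. Passing from [d / v] to [d / x^2] costs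
    a term of order [x^-4]. *)
Lemma densAB_tail A B : 0 <= A -> A < 1 -> 1 < B ->
  tail_bounded (densAB A B) ((A + B - 2) / 2).
Proof.
move=> A0 A1 B1; split; first exact: densAB_bounded.
pose d := A + B - 2.
have [c cE] : exists c, c = (B - 1) * (1 - A) by eexists.
have c0 : 0 < c by rewrite cE mulr_gt0//; lra.
(* [E] dominates both coefficients of [z], so that [|z| <= E / v <= 1] as soon as [|x| >= 2 + E]. *)
pose E := `|d| + c; have E0 : 0 < E by have := normr_ge0 d; rewrite /E; lra.
exists (2 + E), (2 * E ^+ 2 + 2 * E); split=> [||x xE]; first by lra.
  by rewrite addr_ge0// mulr_ge0// ?exprn_ge0// ltW.
rewrite -/d.
have x0 : 0 < `|x| by lra.
have xn : x != 0 by rewrite -normr_gt0.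
pose u := x ^+ 2; have uE : u = `|x| ^+ 2 by rewrite real_normK ?num_real.
pose v := u - 1.
have v1 : 1 + E <= v by rewrite /v uE; nra.
have vu : u <= 2 * v by rewrite /v uE; nra.
have u0 : 0 < u by rewrite uE exprn_gt0.
have v0 : 0 < v by lra.
pose r := v^-1; pose s := u^-1.
have vr : v * r = 1 by rewrite /r divff// gt_eqF.
have us : u * s = 1 by rewrite /s divff// gt_eqF.
have r0 : 0 < r by rewrite invr_gt0.
have s0 : 0 < s by rewrite invr_gt0.
have rs : r <= 2 * s.
  have -> : r = r * s * u by rewrite -mulrA (mulrC s) us mulr1.
  have -> : 2 * s = r * s * (2 * v).
    by transitivity (2 * s * (v * r)); [rewrite vr mulr1|ring].
  by rewrite ler_wpM2l// mulr_ge0// ltW.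
have rE : r * E <= 1 by rewrite -vr mulrC ler_wpM2r ?(ltW r0)//; lra.
have r1 : r <= 1 by rewrite -vr ler_peMl ?(ltW r0)//; lra.
pose z := d * r + c * r ^+ 2.
have zE : `|z| <= E * r.
  rewrite /z (le_trans (ler_normD _ _))// !normrM (gtr0_norm r0) (gtr0_norm c0).
  rewrite /E mulrDl lerD2l ler_wpM2l ?(ltW c0)//.
  by rewrite ler_piMr// ltW.
have z1 : z <= 1 by apply: (le_trans (ler_norm _)); apply: (le_trans zE); rewrite mulrC.
have fE : densAB A B x = Num.sqrt (1 - z) - 1.
  rewrite /densAB addrC -/u -/v (gtr0_norm v0); congr (_ - 1).
  have -> : (u - B) * (u - A) = v ^+ 2 * (1 - z).
    have -> : v ^+ 2 * (1 - z) = v ^+ 2 - d * v * (v * r) - c * (v * r) ^+ 2 by rewrite /z; ring.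
    by rewrite vr /v /d cE; ring.
  rewrite sqrtrM ?sqr_ge0// sqrtr_sqr (gtr0_norm v0); field; exact: lt0r_neq0.
have -> : densAB A B x + d / 2 / x ^+ 2 = (Num.sqrt (1 - z) - 1 + z / 2) - (d * (r * s) + c * r ^+ 2) / 2.
  have -> : r * s = r - s.
    have -> : r - s = r * (u * s) - s * (v * r) by rewrite us vr !mulr1.
    by rewrite /v; ring.
  by rewrite fE /z /s /u; field.
have b1 : `|Num.sqrt (1 - z) - 1 + z / 2| <= 2 * E ^+ 2 * s ^+ 2.
  apply: (le_trans (sqrt_taylor z1)); rewrite -(real_normK (num_real z)).
  have := normr_ge0 z => z0.
  have : `|z| ^+ 2 <= (E * (2 * s)) ^+ 2.
    rewrite lerXn2r ?nnegrE//; first by rewrite mulr_ge0 ?mulr_ge0// ltW.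
    by rewrite (le_trans zE)// ler_wpM2l// ltW.
  by rewrite !exprMn; lra.
have b2 : `|(d * (r * s) + c * r ^+ 2) / 2| <= 2 * E * s ^+ 2.
  rewrite normrM (@ger0_norm _ 2^-1)//.
  have : `|d * (r * s) + c * r ^+ 2| <= `|d| * (2 * s ^+ 2) + c * (4 * s ^+ 2).
    rewrite (le_trans (ler_normD _ _))// lerD//.
      rewrite normrM ler_wpM2l// ger0_norm; last by rewrite mulr_ge0// ltW.
      by rewrite expr2 mulrA ler_wpM2r// ltW.
    rewrite ger0_norm; last by rewrite mulr_ge0// ?sqr_ge0// ltW.
    rewrite ler_wpM2l ?(ltW c0)//; nra.
  have := normr_ge0 d => d0; have : 0 <= `|d| * s ^+ 2 by rewrite mulr_ge0// sqr_ge0.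
  by rewrite /E; lra.
apply: (@le_trans _ _ ((2 * E ^+ 2 + 2 * E) * s ^+ 2)).
  by have := lerD b1 b2; rewrite -mulrDl; apply: le_trans; exact: ler_normB.
rewrite ler_wpM2l//.
  by rewrite addr_ge0// mulr_ge0// ?exprn_ge0// ltW.
rewrite /s uE exprVn -exprM lef_pV2 ?posrE ?exprn_gt0//.
by rewrite ler_weXn2l//; lra.
Qed.

End Densities.

(** * Elementary integrals with a single square root *)

Section SqrtIntegrals.
Context {R : realType}.
Let mu := @lebesgue_measure R.
Implicit Types (f : R -> R) (x y a b : R).

(** The splitting lemmas concern nonnegative functions; [f] goes through its positive and negative
    parts, which inherit evenness and integrability. *)
Lemma even_Rintegral f b : 0 < b -> mu.-integrable setT (EFin \o f) ->
  (forall x, f (- x) = f x) ->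
  \int[mu]_x f x = 2 * (\int[mu]_(x in `]0, b[) f x + \int[mu]_(x in `]b, +oo[) f x).
Proof.
move=> b0 fi fe.
have mf : measurable_fun setT f by apply/measurable_EFinP; exact: (measurable_int mu).
pose h1 x : R := Num.max (f x) 0; pose h2 x : R := Num.max (- f x) 0.
have m1 : measurable_fun setT h1 by exact: measurable_maxr.
have m2 : measurable_fun setT h2 by apply: measurable_maxr => //; exact: measurableT_comp.
have h10 x : 0 <= h1 x by rewrite le_max lexx orbT.
have h20 x : 0 <= h2 x by rewrite le_max lexx orbT.
have i1 : mu.-integrable setT (EFin \o h1).
  apply: (le_integrable measurableT _ _ fi); first exact/measurable_EFinP.
  move=> x _ /=; rewrite lee_fin ger0_norm// /h1 ge_max normr_ge0 ler_norm//.
have i2 : mu.-integrable setT (EFin \o h2).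
  apply: (le_integrable measurableT _ _ fi); first exact/measurable_EFinP.
  move=> x _ /=; rewrite lee_fin ger0_norm// /h2 ge_max normr_ge0 andbT -normrN ler_norm//.
have fE x : f x = h1 x - h2 x.
  rewrite /h1 /h2; have [f0|f0] := leP 0 (f x).
    by rewrite max_r ?oppr_le0// subr0.
  by rewrite max_l ?oppr_ge0 ?(ltW f0)// sub0r opprK.
have key (h : R -> R) : measurable_fun setT h -> (forall x, 0 <= h x) -> (forall x, h (- x) = h x) ->
    mu.-integrable setT (EFin \o h) ->
    \int[mu]_x h x = 2 * (\int[mu]_(x in `]0, b[) h x + \int[mu]_(x in `]b, +oo[) h x).
  move=> mh h0 he ih; rewrite /Rintegral ge0_integral_even//.
  rewrite (@ge0_integral_split_oy _ 0 b)//; last exact: measurable_funTS.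
  have j1 : mu.-integrable `]0, b[ (EFin \o h) by apply: integrableS ih.
  have j2 : mu.-integrable `]b, +oo[ (EFin \o h) by apply: integrableS ih.
  have n1 : (\int[mu]_(x in `]0%R, b[) (h x)%:E)%E \is a fin_num.
    by apply: integrable_fin_num j1; exact: measurable_itv.
  have n2 : (\int[mu]_(x in `]b, +oo[) (h x)%:E)%E \is a fin_num.
    by apply: integrable_fin_num j2; exact: measurable_itv.
  by rewrite -(fineK n1) -(fineK n2) -EFinD -EFinM.
have e1 x : h1 (- x) = h1 x by rewrite /h1 fe.
have e2 x : h2 (- x) = h2 x by rewrite /h2 fe.
have k1 := key _ m1 h10 e1 i1; have k2 := key _ m2 h20 e2 i2.
have S (D : set R) : measurable D ->
    \int[mu]_(x in D) f x = \int[mu]_(x in D) h1 x - \int[mu]_(x in D) h2 x.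
  move=> mD; rewrite -RintegralB//; first by apply: eq_Rintegral => x _; rewrite fE.
  - by apply: integrableS i1.
  - by apply: integrableS i2.
rewrite !S; try solve [exact: measurable_itv | exact: measurableT].
by rewrite k1 k2; ring.
Qed.

Lemma sqrt_sub_cvgy a : Num.sqrt (x ^+ 2 - a ^+ 2) @[x --> +oo] --> (+oo : set_system R).
Proof.
apply/cvgryPge => A; near=> x.
have x0 : `|a| < x by near: x; exact: near_pinfty_gt.
have a0 := normr_ge0 a.
have H : A + `|a| <= x by near: x; apply: nbhs_pinfty_ge; exact: num_real.
apply: (@le_trans _ _ (x - `|a|)); first by lra.
rewrite -[leLHS]ger0_norm; last lra.
rewrite -sqrtr_sqr ler_wsqrtr// -(real_normK (num_real a)); nra.
Unshelve. all: by end_near. Qed.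

Lemma fcvg_atan_sqrt a c : 0 < c -> atan (Num.sqrt (x ^+ 2 - a ^+ 2) * c) @[x --> +oo] --> (pi / 2 : R).
Proof.
move=> c0; move: (@cvgy_atan R); apply: cvg_comp.
by apply: gt0_cvgMly => //; exact: sqrt_sub_cvgy.
Qed.

Lemma fcvg_sub_sqrt a : x - Num.sqrt (x ^+ 2 - a ^+ 2) @[x --> +oo] --> (0 : R).
Proof.
have H : a ^+ 2 * (x + 0)^-1 @[x --> +oo] --> (0 : R).
  by have h := @fcvg_invy R 0; apply: fcvg_eq; [lims|rewrite mulr0].
apply: (squeeze_cvgr _ (cvg_cst 0) H); near=> x.
have x0 : `|a| < x by near: x; exact: near_pinfty_gt.
have a0 := normr_ge0 a; have xp : 0 < x by lra.
set s := Num.sqrt _.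
have ax : a ^+ 2 <= x ^+ 2 by rewrite -(real_normK (num_real a)) lerXn2r ?nnegrE//; lra.
have s2 : s ^+ 2 = x ^+ 2 - a ^+ 2 by rewrite /s sqr_sqrtr// subr_ge0.
have s0 : 0 <= s by rewrite sqrtr_ge0.
have sx : s <= x.
  rewrite -[leRHS]gtr0_norm// -sqrtr_sqr ler_wsqrtr//; have := sqr_ge0 a; lra.
rewrite subr_ge0 sx/= addr0 ler_pdivlMr//; nra.
Unshelve. all: by end_near. Qed.

Section SqrtPrimitives.
Variable a : R.
Hypothesis a0 : 0 < a.
Let s x := Num.sqrt (x ^+ 2 - a ^+ 2).

Let spos x : a < x -> 0 < x ^+ 2 - a ^+ 2.
Proof. by have A := a0 => ax; nra. Qed.

Let s2 x : a < x -> s x ^+ 2 = x ^+ 2 - a ^+ 2.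
Proof. by move=> ax; rewrite /s sqr_sqrtr// ltW// spos. Qed.

Let s0 x : a < x -> s x != 0.
Proof. by move=> ax; rewrite gt_eqF// sqrtr_gt0 spos. Qed.

Let s_at x : s y @[y --> x] --> s x.
Proof. by rewrite /s; lims. Qed.

Let sa : s a = 0. Proof. by rewrite /s subrr sqrtr0. Qed.

Let atan_lim c x : atan (s y * c) @[y --> x] --> atan (s x * c).
Proof. by have h := @s_at x; lims. Qed.

(** [atan (s x / a)] is [acos (a / x)], the angular part of the primitive of [s x / x]. *)
Lemma int_one_sub_sqrt :
  (\int[mu]_(x in `]a, +oo[) (1 - s x / x)%:E = (a * (pi / 2) - a)%:E)%E.
Proof.
have A := a0; have an : a != 0 by rewrite gt_eqF.
apply: (ge0_FTCoy (F := fun x => (x - s x) + a * atan (s x * a^-1))).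
- move=> x ax; rewrite subr_ge0 ler_pdivrMr ?mul1r; last by lra.
  rewrite -[leRHS]gtr0_norm; last lra.
  rewrite -sqrtr_sqr ler_wsqrtr//; have := sqr_ge0 a; lra.
- move=> x ax; apply: cont_at; first (rewrite /s; lims); first by neq.
  by [].
- move=> x ax; rewrite /has_der /s; isder; try exact: spos.
  rewrite -/(s x); have sx := s0 ax; have sx2 := s2 ax.
  have xn : x != 0 by neq.
  have -> : (1 + (s x * a^-1) ^+ 2)^-1 = a ^+ 2 / x ^+ 2.
    rewrite -[RHS]invf_div; congr (_^-1); rewrite exprMn sx2; field; exact: an.
  have e : s x / x = (x ^+ 2 - a ^+ 2) / (x * s x).
    by rewrite -sx2; field; rewrite xn sx.
  by rewrite e /=; field; rewrite an xn sx.
- apply: cvg_at_right_filter; have h := @s_at a; have h2 := @atan_lim a^-1 a.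
  by apply: fcvg_eq; [lims|rewrite sa mul0r atan0; ring].
- have h := @fcvg_sub_sqrt a; have aV : 0 < a^-1 by rewrite invr_gt0.
  have h2 := @fcvg_atan_sqrt a _ aV.
  by apply: fcvg_eq; [rewrite /s; lims|rewrite add0r].
Qed.

(** The choice of [k] gives [s x ^ 2 + k ^ 2 = x ^ 2 - 1], so that differentiating [atan (s x / k)]
    produces the factor [x ^ 2 - 1], just as [atan (s x / a)] produces [x ^ 2]. *)
Lemma int_sqrt_ratio k : 0 < k -> k ^+ 2 = a ^+ 2 - 1 ->
  (\int[mu]_(x in `]a, +oo[) (s x / (x * (x ^+ 2 - 1)))%:E = ((a - k) * (pi / 2))%:E)%E.
Proof.
move=> k0 ka; have A := a0; have an : a != 0 by rewrite gt_eqF.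
have kn : k != 0 by rewrite gt_eqF.
have x1 x : a < x -> 0 < x ^+ 2 - 1 by move=> ax; nra.
rewrite -[RHS]/(((a - k) * (pi / 2))%:E) -[X in X%:E]subr0.
apply: (ge0_FTCoy (F := fun x => a * atan (s x * a^-1) - k * atan (s x * k^-1))).
- move=> x ax; rewrite divr_ge0 ?sqrtr_ge0// mulr_ge0//; first lra.
  by rewrite ltW// x1.
- move=> x ax; apply: cont_at; first (rewrite /s; lims).
    by rewrite mulf_neq0//; [neq|rewrite gt_eqF// x1].
  by [].
- move=> x ax; rewrite /has_der /s; isder; try exact: spos.
  rewrite -/(s x); have sx := s0 ax; have sx2 := s2 ax.
  have xn : x != 0 by neq.
  have xn1 : x ^+ 2 - 1 != 0 by rewrite gt_eqF// x1.
  have -> : (1 + (s x * a^-1) ^+ 2)^-1 = a ^+ 2 / x ^+ 2.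
    rewrite -[RHS]invf_div; congr (_^-1); rewrite exprMn sx2; field; exact: an.
  have -> : (1 + (s x * k^-1) ^+ 2)^-1 = k ^+ 2 / (x ^+ 2 - 1).
    rewrite -[RHS]invf_div; congr (_^-1); rewrite exprMn sx2.
    have -> : a ^+ 2 = k ^+ 2 + 1 by rewrite ka; ring.
    by field.
  have e : s x / (x * (x ^+ 2 - 1)) = (x ^+ 2 - a ^+ 2) / (x * (x ^+ 2 - 1) * s x).
    by rewrite -sx2; field; rewrite xn xn1 sx.
  by rewrite e ka /=; field; rewrite kn an xn xn1 sx.
- apply: cvg_at_right_filter; have h := @atan_lim k^-1 a; have h2 := @atan_lim a^-1 a.
  by apply: fcvg_eq; [lims|rewrite sa !mul0r atan0; ring].
- have aV : 0 < a^-1 by rewrite invr_gt0. have kV : 0 < k^-1 by rewrite invr_gt0.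
  have h2 := @fcvg_atan_sqrt a _ aV; have h3 := @fcvg_atan_sqrt a _ kV.
  by apply: fcvg_eq; [rewrite /s; lims|ring].
Qed.

End SqrtPrimitives.
End SqrtIntegrals.

Section ElementaryNeutrality.
Context {R : realType}.
Let mu := @lebesgue_measure R.
Implicit Types (f : R -> R) (x y a b : R).

Lemma ge0_integrable_val (D : set R) (f : R -> R) (v : R) : measurable D ->
  measurable_fun setT f -> (forall x, D x -> 0 <= f x) ->
  (\int[mu]_(x in D) (f x)%:E = v%:E)%E -> mu.-integrable D (EFin \o f).
Proof.
move=> mD mf f0 E; apply/integrableP; split.
  by apply/measurable_EFinP; exact: measurable_funTS.
under eq_integral => x xD.
  rewrite /= ger0_norm; last by apply: f0; rewrite inE in xD.
  over.
by rewrite E ltry.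
Qed.

Lemma Rintegral_cst_oo a b (c : R) : a < b -> \int[mu]_(x in `]a, b[) c = c * (b - a).
Proof.
move=> ab; rewrite Rintegral_cst; last exact: measurable_itv.
congr (_ * _); have -> : (b - a) = fine (b - a)%:E by [].
by congr fine; have := @lebesgue_measure_itv R `]a, b[; rewrite /= lte_fin ab -EFinB.
Qed.

Lemma densI_neutral a : 0 < a -> \int[mu]_x densI a x = - (pi * a).
Proof.
move=> a0; have md := measurable_densI a.
have di := tail_integrable md (densI_tail a0).
rewrite (even_Rintegral a0 di (densIN a)).
have -> : \int[mu]_(x in `]0, a[) densI a x = - a.
  rewrite (_ : - a = -1 * (a - 0)); last by ring.
  rewrite -Rintegral_cst_oo//; apply: eq_Rintegral => x.
  rewrite inE/= in_itv/= => /andP[x0 xa]; rewrite /densI ler0_sqrtr ?mul0r ?addr0//.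
  nra.
have -> : \int[mu]_(x in `]a, +oo[) densI a x = a - a * (pi / 2).
  rewrite /Rintegral.
  have -> : (\int[mu]_(x in `]a, +oo[) (densI a x)%:E =
      - \int[mu]_(x in `]a, +oo[) (1 - Num.sqrt (x ^+ 2 - a ^+ 2) / x)%:E)%E.
    rewrite -integral_ge0N; last first.
      move=> x; rewrite /= in_itv/= andbT => ax; rewrite lee_fin.
      rewrite subr_ge0 ler_pdivrMr ?mul1r; last by lra.
      rewrite -[leRHS]gtr0_norm; last lra.
      rewrite -sqrtr_sqr ler_wsqrtr//; have := sqr_ge0 a; lra.
    apply: eq_integral => x; rewrite inE/= in_itv/= andbT => ax.
    rewrite /densI gtr0_norm; last lra.
    by rewrite addrC -opprB.
  by rewrite int_one_sub_sqrt//= ; ring.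
by field.
Qed.

(** For [A = 0] the square root is [x * s x], and [x * s / (x^2 - 1) - 1 = s / (x * (x^2 - 1)) - (1
    - s / x)] is a difference of two nonnegative functions with known integrals. *)
Lemma densAB0_neutral B : 1 < B ->
  \int[mu]_x densAB 0 B x = - (pi * Num.sqrt (B - 1)).
Proof.
move=> B1; have md := @measurable_densAB R 0 B.
have di := tail_integrable md (densAB_tail (lexx 0) ltr01 B1).
pose a := Num.sqrt B; have a0 : 0 < a by rewrite sqrtr_gt0; lra.
have a2 : a ^+ 2 = B by rewrite sqr_sqrtr//; lra.
have a1 : 1 < a by nra.
pose k := Num.sqrt (B - 1); have k0 : 0 < k by rewrite sqrtr_gt0; lra.
have k2 : k ^+ 2 = a ^+ 2 - 1 by rewrite a2 sqr_sqrtr//; lra.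
rewrite (even_Rintegral a0 di (@densABN R 0 B)) -/k.
have -> : \int[mu]_(x in `]0, a[) densAB 0 B x = - a.
  rewrite (_ : - a = -1 * (a - 0)); last by ring.
  rewrite -Rintegral_cst_oo//; apply: eq_Rintegral => x.
  rewrite inE/= in_itv/= => /andP[x0 xa]; rewrite /densAB ler0_sqrtr ?mul0r ?addr0//.
  rewrite subr0 -a2 nmulr_rle0; [exact: sqr_ge0|nra].
pose s x := Num.sqrt (x ^+ 2 - a ^+ 2).
have E1 := int_one_sub_sqrt a0; have E2 := int_sqrt_ratio a0 k0 k2.
have ms : measurable_fun setT s.
  apply: (measurableT_comp (@measurable_sqrt R)).
  by apply: measurable_funB => //; exact: measurable_funX.
have m1 : measurable_fun setT (fun x => 1 - s x / x).
  apply: measurable_funB => //; apply: measurable_funM => //.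
  exact: measurable_inv.
have m2 : measurable_fun setT (fun x => s x / (x * (x ^+ 2 - 1))).
  apply: measurable_funM => //; apply: (measurableT_comp (@measurable_inv R)).
  by apply: measurable_funM => //; apply: measurable_funB => //.
have i1 : mu.-integrable `]a, +oo[ (EFin \o (fun x => 1 - s x / x)).
  apply: ge0_integrable_val E1 => // x; rewrite /= in_itv/= andbT => ax.
  rewrite subr_ge0 ler_pdivrMr ?mul1r; last by lra.
  rewrite -[leRHS]gtr0_norm; last lra.
  rewrite -sqrtr_sqr ler_wsqrtr//; have := sqr_ge0 a; lra.
have i2 : mu.-integrable `]a, +oo[ (EFin \o (fun x => s x / (x * (x ^+ 2 - 1)))).
  apply: ge0_integrable_val E2 => // x; rewrite /= in_itv/= andbT => ax.
  by rewrite divr_ge0 ?sqrtr_ge0// mulr_ge0//; nra.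
have -> : \int[mu]_(x in `]a, +oo[) densAB 0 B x = (a - k) * (pi / 2) - (a * (pi / 2) - a).
  transitivity (\int[mu]_(x in `]a, +oo[) (s x / (x * (x ^+ 2 - 1)) - (1 - s x / x))).
    apply: eq_Rintegral => x; rewrite inE/= in_itv/= andbT => ax.
    have x0 : 0 < x by lra.
    have x1 : 0 < x ^+ 2 - 1 by nra.
    rewrite /densAB subr0 -a2 (mulrC (x ^+ 2 - a ^+ 2)) sqrtrM ?sqr_ge0// sqrtr_sqr (gtr0_norm x0) (gtr0_norm x1).
    by rewrite -/(s x); field; rewrite (gt_eqF x0) (gt_eqF x1).
  rewrite RintegralB; [|exact: measurable_itv|exact: i2|exact: i1].
  by rewrite /Rintegral E1 E2.
by field.
Qed.

(** No sign is imposed on [e + s * d]: where it is negative, the integrand is [0^-1 = 0] and the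
    primitive is constantly 0. If the sign changes, the interval is cut at [- e / s]. This is what
    allows [d] to move while a point [x] enters or leaves the gap of the density. *)
Lemma affine_sqrt_int (e s a b : R) : s != 0 -> a < b ->
  (\int[mu]_(d in `]a, b[) ((Num.sqrt (e + s * d))^-1)%:E =
   (2 / s * (Num.sqrt (e + s * b) - Num.sqrt (e + s * a)))%:E)%E.
Proof.
move=> s0.
have cvx a' b' d : a' < d < b' -> (b' - a') * (e + s * d) = (b' - d) * (e + s * a') + (d - a') * (e + s * b').
  by move=> _; ring.
have pos a' b' : a' < b' -> 0 <= e + s * a' -> 0 <= e + s * b' ->
    (\int[mu]_(d in `]a', b'[) ((Num.sqrt (e + s * d))^-1)%:E =
     (2 / s * (Num.sqrt (e + s * b') - Num.sqrt (e + s * a')))%:E)%E.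
  move=> ab ea eb.
  have ep d : a' < d < b' -> 0 < e + s * d.
    move=> adb; have := cvx a' b' d adb; case/andP: adb => ad db H.
    have : 0 <= (b' - a') * (e + s * d).
      by rewrite H addr_ge0// mulr_ge0//; lra.
    rewrite pmulr_rge0 ?subr_gt0// le_eqVlt => /predU1P[E0|//].
    move: H; rewrite -E0 mulr0 => H.
    have p1 : 0 <= (b' - d) * (e + s * a') by rewrite mulr_ge0//; lra.
    have p2 : 0 <= (d - a') * (e + s * b') by rewrite mulr_ge0//; lra.
    have q1 : (b' - d) * (e + s * a') = 0 by lra.
    have q2 : (d - a') * (e + s * b') = 0 by lra.
    move/eqP: q1; rewrite mulf_eq0 subr_eq0 gt_eqF//= => /eqP z1.
    move/eqP: q2; rewrite mulf_eq0 subr_eq0 gt_eqF//= => /eqP z2.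
    have : s * (b' - a') = 0 by lra.
    by move/eqP; rewrite mulf_eq0 (negPf s0) subr_eq0 gt_eqF.
  rewrite mulrBr; apply: (ge0_FTCoo (F := fun d => 2 / s * Num.sqrt (e + s * d))).
  - exact: ab.
  - by move=> d _; rewrite invr_ge0 sqrtr_ge0.
  - move=> d /ep dp; apply: cont_at; first (lims; rewrite sqrtr_eq0 -ltNge//).
    by [].
  - move=> d /ep dp; rewrite /has_der; isder => //.
    by field; rewrite s0 sqrtr_eq0 -ltNge dp.
  - by apply: cvg_at_right_filter; lims.
  - by apply: cvg_at_left_filter; lims.
have neg a' b' : a' < b' -> e + s * a' <= 0 -> e + s * b' <= 0 ->
    (\int[mu]_(d in `]a', b'[) ((Num.sqrt (e + s * d))^-1)%:E =
     (2 / s * (Num.sqrt (e + s * b') - Num.sqrt (e + s * a')))%:E)%E.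
  move=> ab ea eb; rewrite !ler0_sqrtr// subrr mulr0 integral0_eq// => d.
  rewrite /= in_itv/= => adb; rewrite ler0_sqrtr ?invr0//.
  have := cvx a' b' d adb; case/andP: adb => ad db H.
  rewrite -(@pmulr_rle0 _ (b' - a')) ?subr_gt0// H.
  have : (b' - d) * (e + s * a') <= 0 by rewrite mulr_ge0_le0//; lra.
  have : (d - a') * (e + s * b') <= 0 by rewrite mulr_ge0_le0//; lra.
  lra.
move=> ab.
have mk : measurable_fun setT (fun d => (Num.sqrt (e + s * d))^-1).
  apply: (measurableT_comp (@measurable_inv R)); apply: (measurableT_comp (@measurable_sqrt R)).
  by apply: measurable_funD => //; exact: measurable_funM.
have split z : a < z < b -> e + s * z = 0 ->
   ((\int[mu]_(d in `]a, z[) ((Num.sqrt (e + s * d))^-1)%:E =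
     (2 / s * (Num.sqrt (e + s * z) - Num.sqrt (e + s * a)))%:E)%E) ->
   ((\int[mu]_(d in `]z, b[) ((Num.sqrt (e + s * d))^-1)%:E =
     (2 / s * (Num.sqrt (e + s * b) - Num.sqrt (e + s * z)))%:E)%E) ->
    (\int[mu]_(d in `]a, b[) ((Num.sqrt (e + s * d))^-1)%:E =
     (2 / s * (Num.sqrt (e + s * b) - Num.sqrt (e + s * a)))%:E)%E.
  move=> /andP[az zb] z0 H1 H2.
  rewrite (@ge0_integral_split_oo _ a z b _ az zb); last 2 first.
  - exact: measurable_funTS mk.
  - by move=> d _; rewrite invr_ge0 sqrtr_ge0.
  by rewrite H1 H2 -EFinD; congr EFin; ring.
have zE : e + s * (- e / s) = 0 by field.
have dz d : e + s * d = s * (d - (- e / s)) by field.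
have mix : (e + s * a) * (e + s * b) < 0 -> a < - e / s < b.
  move: dz; move: (- e / s) => z dz; rewrite !dz.
  have s2 : 0 < s ^+ 2 by rewrite exprn_even_gt0.
  have -> : s * (a - z) * (s * (b - z)) = s ^+ 2 * ((a - z) * (b - z)) by ring.
  rewrite pmulr_rlt0// => H; apply/andP; split; rewrite ltNge; apply/negP => h; nra.
have [ea|ea] := leP 0 (e + s * a); have [eb|eb] := leP 0 (e + s * b).
- exact: pos.
- have [ea0|ea0] := leP (e + s * a) 0; first by apply: neg => //; exact: ltW.
  have zab : a < - e / s < b by apply: mix; nra.
  by case/andP: (zab) => az zb; apply: (split _ zab zE);
    [apply: pos|apply: neg] => //; rewrite ?zE// ltW.
- have [eb0|eb0] := leP (e + s * b) 0; first by apply: neg => //; exact: ltW.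
  have zab : a < - e / s < b by apply: mix; nra.
  by case/andP: (zab) => az zb; apply: (split _ zab zE);
    [apply: neg|apply: pos] => //; rewrite ?zE// ltW.
- by apply: neg => //; exact: ltW.
Qed.

End ElementaryNeutrality.

(** * The inversion [x -> a * b / x] *)

Section Inversion.
Context {R : realType}.
Let mu := @lebesgue_measure R.
Implicit Types (f : R -> R) (x y a b d : R).

Lemma tonelli_on (D E : set R) (k : R * R -> R) :
  measurable D -> measurable E -> measurable_fun setT k -> (forall p, 0 <= k p) ->
  (\int[mu]_(x in D) \int[mu]_(y in E) (k (x, y))%:E =
   \int[mu]_(y in E) \int[mu]_(x in D) (k (x, y))%:E)%E.
Proof.
move=> mD mE mk k0.
pose f (p : R * R) : \bar R := (k p * \1_D p.1 * \1_E p.2)%:E.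
have mD1 : measurable_fun setT (\1_D : R -> R) by exact: measurable_indic.
have mE1 : measurable_fun setT (\1_E : R -> R) by exact: measurable_indic.
have mf : measurable_fun setT f.
  apply/measurable_EFinP; apply: measurable_funM; first apply: measurable_funM => //.
    exact: (measurableT_comp mD1 measurable_fst).
  exact: (measurableT_comp mE1 measurable_snd).
have f0 p : (0 <= f p)%E by rewrite lee_fin !mulr_ge0// indicE.
have := fubini_tonelli (m1 := mu) (m2 := mu) f mf f0.
have e1 x : (\int[mu]_y f (x, y) = ((fun x => \int[mu]_(y in E) (k (x, y))%:E) \_ D) x)%E.
  rewrite patchE; case: ifPn => xD.
    rewrite [RHS]integral_mkcond; apply: eq_integral => y _.
    rewrite /f /= !indicE xD patchE; case: ifPn => yE; rewrite ?mulr1//.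
    by rewrite mulr0.
  by rewrite integral0_eq// => y _; rewrite /f /= !indicE (negPf xD) mulr0 mul0r.
have e2 y : (\int[mu]_x f (x, y) = ((fun y => \int[mu]_(x in D) (k (x, y))%:E) \_ E) y)%E.
  rewrite patchE; case: ifPn => yE.
    rewrite [RHS]integral_mkcond; apply: eq_integral => x _.
    rewrite /f /= !indicE yE patchE; case: ifPn => xD; rewrite ?mulr1//.
    by rewrite mulr0.
  by rewrite integral0_eq// => x _; rewrite /f /= !indicE (negPf yE) mulr0.
under eq_integral do rewrite e1.
under [in RHS]eq_integral do rewrite e2.
by rewrite -!integral_mkcond.
Qed.

(* The library changes variables on compact intervals only, hence the exhaustion. *)
Lemma ge0_integral_inversion (k a : R) (G : R -> R) : 0 < a -> 0 < k ->
  (forall y, 0 < y < k / a -> 0 <= G y) ->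
  (forall y, 0 < y < k / a -> {for y, continuous G}) ->
  (\int[mu]_(y in `]0%R, (k / a)%R[) (G y)%:E =
   \int[mu]_(x in `]a, +oo[) (G (k / x) * (k / x ^+ 2))%:E)%E.
Proof.
move=> a0 k0 G0 cG.
pose h (n : nat) : R := n.+1%:R^-1.
pose u n := a + h n; pose v (n : nat) : R := a + 2 + n%:R.
have h0 n : 0 < h n by rewrite invr_gt0.
have hle m n : (m <= n)%N -> h n <= h m.
  by move=> mn; rewrite lef_pV2 ?posrE ?ler_nat.
have h1 n : h n <= 1 by apply: (le_trans (hle 0%N n _)) => //; rewrite /h invr1.
have hc : h n @[n --> \oo] --> 0 by exact: cvg_harmonic.
have uv n : u n < v n by have := h1 n; have := ler0n R n; rewrite /u /v; lra.
have u0 n : 0 < u n by have := h0 n; rewrite /u; lra.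
have v0 n : 0 < v n by rewrite (lt_trans (u0 n)).
pose F x : R := k / x.
have Fd x : x != 0 -> is_derive x 1 F (- (k / x ^+ 2)).
  by move=> x0; rewrite /F; isder => //; field.
have F' x : x != 0 -> derive1 F x = - (k / x ^+ 2).
  by move=> x0; rewrite derive1E; have [] := Fd x x0.
pose E n := `[u n, v n]%classic; pose E' n := `[F (v n), F (u n)]%classic.
have kx x y : 0 < x -> 0 < y -> (F x <= F y) = (y <= x).
  by move=> x0 y0; rewrite /F ler_pM2l// lef_pV2.
have kxl x y : 0 < x -> 0 < y -> (F x < F y) = (y < x).
  by move=> x0 y0; rewrite /F ltr_pM2l// ltf_pV2.
have FK x : x != 0 -> F (F x) = x by move=> x0; rewrite /F; field; rewrite x0 gt_eqF.
have inE' n y : E' n y -> 0 < y < k / a.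
  rewrite /E'/= in_itv/= => /andP[y1 y2].
  have Fv : 0 < F (v n) by rewrite /F divr_gt0.
  rewrite (lt_le_trans Fv y1)/= (le_lt_trans y2)// -/(F a) kxl//.
  by rewrite /u ltrDl.
have EU : `]a, +oo[%classic = \bigcup_n E n.
  apply/seteqP; split => x.
    rewrite /= in_itv/= andbT => ax.
    have m0 : 0 < x - a by lra.
    have [N _ /(_ _) hN] := (cvgrPdist_lt _ _).1 hc _ m0.
    have [M _ /(_ _) hM] := (cvgryPge _).1 (@cvgr_idn R) x.
    exists (maxn N M) => //; have := hN (maxn N M) (leq_maxl _ _).
    have := hM (maxn N M) (leq_maxr _ _).
    rewrite /= sub0r normrN gtr0_norm// => ? ?.
    by rewrite /E/= in_itv/= /u /v; apply/andP; lra.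
  by move=> [n _]; rewrite /E/= !in_itv/= andbT /u => /andP[]; have := h0 n; lra.
have EU' : `]0, (k / a)[%classic = \bigcup_n E' n.
  apply/seteqP; split => y; last by move=> [n _ /inE'] /=; rewrite in_itv.
  rewrite /= in_itv/= => /andP[y0 yk].
  have Fy0 : 0 < F y by rewrite /F divr_gt0.
  have : `]a, +oo[%classic (F y).
    by rewrite /= in_itv/= andbT -(FK a) ?gt_eqF// kxl// /F divr_gt0.
  rewrite EU => -[n _]; rewrite /E/= in_itv/= => /andP[e1 e2]; exists n => //.
  have yn : y != 0 by rewrite gt_eqF.
  by rewrite /E'/= in_itv/= -(FK y yn) !kx// e1 e2.
have ndu m n : (m <= n)%N -> u n <= u m by move=> mn; rewrite /u lerD2l hle.
have ndv m n : (m <= n)%N -> v m <= v n by move=> mn; rewrite /v lerD2l ler_nat.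
have sub n : (\int[mu]_(y in E' n) (G y)%:E =
    \int[mu]_(x in E n) (G (k / x) * (k / x ^+ 2))%:E)%E.
  have xn x : u n <= x -> x != 0 by move=> ux; rewrite gt_eqF// (lt_le_trans (u0 n)).
  have cF' x : x != 0 -> {for x, continuous (fun x => - (k / x ^+ 2))}.
    by move=> x0; apply: cont_at; [lims; rewrite expf_neq0|].
  have nearF' x : x != 0 -> \forall t \near x, - (k / t ^+ 2) = derive1 F t.
    move=> x0; have : \forall t \near x, t != 0.
      exact: (@cvgr_neq0 R R R (nbhs x) _ (fun z => z) x (@cvg_id _ _) x0).
    by apply: filterS => t t0; rewrite F'.
  have cvgF' x : x != 0 -> derive1 F t @[t --> x] --> - (k / x ^+ 2).
    by move=> x0; apply: fcvg_near (nearF' x x0) _; exact: cF'.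
  rewrite (@integration_by_substitution_decreasing R F G _ _ (ltW (uv n))).
  - apply: eq_integral => x; rewrite inE /E/= in_itv/= => /andP[ux _].
    by rewrite -[LHS]/((G (F x) * - derive1 F x)%:E) F' ?xn// opprK.
  - move=> x y; rewrite !in_itv/= => /andP[ux _] /andP[uy _] xy.
    by rewrite kxl// ?(lt_le_trans (u0 n)).
  - move=> x; rewrite in_itv/= => /andP[ux _].
    have x0 : x != 0 by rewrite xn// ltW.
    by have := cvgF' x x0; rewrite -F'.
  - by apply/cvg_ex; exists (- (k / u n ^+ 2)); apply: cvg_at_right_filter; apply: cvgF'; rewrite gt_eqF.
  - by apply/cvg_ex; exists (- (k / v n ^+ 2)); apply: cvg_at_left_filter; apply: cvgF'; rewrite gt_eqF.
  - split.
    + by move=> x; rewrite in_itv/= => /andP[ux _]; have [] := Fd x (xn x (ltW ux)).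
    + by apply: cvg_at_right_filter; apply: (isder_continuous (Fd _ _)); rewrite gt_eqF.
    + by apply: cvg_at_left_filter; apply: (isder_continuous (Fd _ _)); rewrite gt_eqF.
  - apply: continuous_in_subspaceT => y; rewrite inE => /inE'; exact: cG.
have c1 : (\int[mu]_(y in E' n) (G y)%:E @[n --> \oo] --> \int[mu]_(y in `]0%R, (k / a)%R[) (G y)%:E)%E.
  rewrite EU'; apply: ge0_nondecreasing_set_cvg_integral.
  - move=> m n mn; apply/subsetPset => y; rewrite /E'/= !in_itv/= => /andP[y1 y2].
    rewrite (le_trans _ y1) ?kx ?ndv//= (le_trans y2)// kx// ndu//.
  - by move=> n; exact: measurable_itv.
  - move=> n; apply/measurable_EFinP; apply: subspace_continuous_measurable_fun.
      exact: measurable_itv.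
    by apply: continuous_in_subspaceT => y; rewrite inE => /inE'; exact: cG.
  - by move=> n y /inE' yE; rewrite lee_fin G0.
have c2 : (\int[mu]_(x in E n) (G (k / x) * (k / x ^+ 2))%:E @[n --> \oo] -->
    \int[mu]_(x in `]a, +oo[) (G (k / x) * (k / x ^+ 2))%:E)%E.
  have Eax n x : E n x -> a < x.
    by rewrite /E/= in_itv/= /u => /andP[]; have := h0 n; lra.
  have axy x : a < x -> 0 < k / x < k / a.
    move=> ax; have x0 : 0 < x by lra.
    by rewrite divr_gt0//= -/(F x) -/(F a) kxl.
  rewrite EU; apply: ge0_nondecreasing_set_cvg_integral.
  - move=> m n mn; apply/subsetPset => y; rewrite /E/= !in_itv/= => /andP[y1 y2].
    by rewrite (le_trans _ y1) ?ndu//= (le_trans y2)// ndv.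
  - by move=> n; exact: measurable_itv.
  - move=> n; apply/measurable_EFinP; apply: subspace_continuous_measurable_fun.
      exact: measurable_itv.
    apply: continuous_in_subspaceT => y; rewrite inE => /Eax ay.
    have y0 : y != 0 by neq.
    have cc1 : {for y, continuous (fun x => G (k / x))}.
      apply: (@continuous_comp _ _ _ F G); first exact: (isder_continuous (Fd _ y0)).
      exact/cG/axy.
    have cc2 : {for y, continuous (fun x => k / x ^+ 2)}.
      by apply: cont_at; [lims; rewrite expf_neq0|].
    exact: cvgM cc1 cc2.
  - move=> n y /Eax ay; rewrite lee_fin mulr_ge0 ?G0 ?axy//.
    by rewrite divr_ge0 ?sqr_ge0// ltW.
have c2' : (\int[mu]_(y in E' n) (G y)%:E @[n --> \oo] -->
    \int[mu]_(x in `]a, +oo[) (G (k / x) * (k / x ^+ 2))%:E)%E.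
  by under eq_fun do rewrite sub.
exact: cvg_unique c1 c2'.
Qed.

(** The integrand [K] vanishes between [a] and [b], so that only []b, +oo[] and []0, a[] count. The
    inversion exchanges them, and [T (a * b / x) = (a * b / x^2)^2 * T x] cancels its Jacobian. *)
Lemma elliptic_inversion (a b : R) : 0 < a -> a < 1 -> 1 < b ->
  (\int[mu]_(x in `]1%R, +oo[) ((Num.sqrt ((x ^+ 2 - b ^+ 2) * (x ^+ 2 - a ^+ 2)))^-1)%:E =
   \int[mu]_(x in `]0%R, 1%R[) ((Num.sqrt ((x ^+ 2 - b ^+ 2) * (x ^+ 2 - a ^+ 2)))^-1)%:E)%E.
Proof.
move=> a0 a1 b1; pose T x : R := (x ^+ 2 - b ^+ 2) * (x ^+ 2 - a ^+ 2).
pose K x : R := (Num.sqrt (T x))^-1.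
change (\int[mu]_(x in `]1%R, +oo[) (K x)%:E = \int[mu]_(x in `]0%R, 1%R[) (K x)%:E)%E.
have mK : measurable_fun setT K.
  apply: (measurableT_comp (@measurable_inv R)); apply: (measurableT_comp (@measurable_sqrt R)).
  by apply: measurable_funM; apply: measurable_funB => //; exact: measurable_funX.
have K0 x : 0 <= K x by rewrite invr_ge0 sqrtr_ge0.
have Tneg x : a <= x <= b -> T x <= 0.
  by move=> /andP[ax xb]; rewrite /T mulr_le0_ge0// ?subr_ge0 ?subr_le0; nra.
have Kz x : a < x < b -> K x = 0.
  by move=> /andP[/ltW ax /ltW xb]; rewrite /K ler0_sqrtr ?invr0// Tneg ?ax.
rewrite (@ge0_integral_split_oy _ 1 b _ b1); [|exact: measurable_funTS|by move=> x _; exact: K0].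
rewrite (@ge0_integral_split_oo _ 0 a 1 _ a0 a1); [|exact: measurable_funTS|by move=> x _; exact: K0].
rewrite [X in (X + _)%E]integral0_eq ?add0e; last first.
  by move=> x; rewrite /= in_itv/= => /andP[x1 xb]; rewrite Kz//; apply/andP; lra.
rewrite [X in (_ + X)%E]integral0_eq ?adde0; last first.
  by move=> x; rewrite /= in_itv/= => /andP[x1 xb]; rewrite Kz//; apply/andP; lra.
have b0 : 0 < b by lra.
have ab0 : 0 < a * b by rewrite mulr_gt0.
have abK : a * b / b = a by rewrite mulfK// gt_eqF.
have Tpos y : 0 < y < a -> 0 < T y.
  by move=> /andP[y0 ya]; rewrite /T nmulr_rgt0; nra.
have := @ge0_integral_inversion (a * b) b K b0 ab0; rewrite abK => ->.
- apply: eq_integral => x; rewrite inE/= in_itv/= andbT => bx; congr EFin.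
  have x0 : 0 < x by lra.
  have xn : x != 0 by rewrite gt_eqF.
  rewrite /K (_ : T (a * b / x) = (a * b / x ^+ 2) ^+ 2 * T x); last first.
    by rewrite /T; field.
  rewrite (sqrtrM (T x) (sqr_ge0 (a * b / x ^+ 2))) sqrtr_sqr gtr0_norm; last by rewrite divr_gt0// exprn_gt0.
  have [->|sn] := eqVneq (Num.sqrt (T x)) 0; first by rewrite mulr0 invr0 mul0r.
  by field; rewrite sn xn (gt_eqF a0) (gt_eqF b0).
- by move=> y _; exact: K0.
- move=> y ya; apply: cont_at; first (rewrite /K /T; lims).
    by rewrite sqrtr_eq0 -ltNge; exact: Tpos.
  by [].
Qed.

End Inversion.

(** * Neutrality along the curve [(B - 1) * (1 - A) = c] *)

Section Neutrality.
Context {R : realType}.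
Let mu := @lebesgue_measure R.
Implicit Types (f : R -> R) (x y a b d A B : R).

(* With [c] fixed, [K (x, d)] is, up to the factor [2 * (1 - x ^+ 2)^-1], the
   derivative in [d = A + B - 2] of the square root in the density. *)
Lemma densAB_neutral A B : 0 < A -> A < 1 -> 1 < B ->
  \int[mu]_x densAB A B x = - (pi * Num.sqrt ((B - 1) * (1 - A))).
Proof.
move=> A0 A1 B1; pose c := (B - 1) * (1 - A).
have c0 : 0 < c by rewrite mulr_gt0// subr_gt0.
rewrite -/c.
have c1 : 1 < 1 + c by lra.
have <- : \int[mu]_x densAB 0 (1 + c) x = - (pi * Num.sqrt c).
  by rewrite densAB0_neutral// addrAC subrr add0r.
have m0 := @measurable_densAB R A B; have m1 := @measurable_densAB R 0 (1 + c).
have i0 := tail_integrable m0 (densAB_tail (ltW A0) A1 B1).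
have i1 := tail_integrable m1 (densAB_tail (lexx 0) ltr01 c1).
rewrite (even_Rintegral ltr01 i0 (densABN A B)) (even_Rintegral ltr01 i1 (densABN 0 (1 + c))).
congr (2 * _).
pose f0 := densAB A B; pose f1 := densAB 0 (1 + c); rewrite -/f0 -/f1.
(* [d1] is the value of [A + B - 2] at the end [A = 0], [B = 1 + c] of the curve, where neutrality
   is already known; [d0] exceeds it by [A * B]. *)
pose d0 := A + B - 2; pose d1 := c - 1.
have d01 : d1 < d0 by rewrite /d0 /d1 /c -subr_gt0; nra.
pose K (z : R * R) : R := (Num.sqrt (((z.1 ^+ 2 - 1) ^+ 2 - c) + (- (z.1 ^+ 2 - 1)) * z.2))^-1.
have K0 z : 0 <= K z by rewrite invr_ge0 sqrtr_ge0.
have mK : measurable_fun setT K.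
  apply: (measurableT_comp (@measurable_inv R)); apply: (measurableT_comp (@measurable_sqrt R)).
  have mu1 : measurable_fun setT (fun z : R * R => z.1 ^+ 2 - 1).
    by apply: measurable_funB => //; apply: measurable_funX; exact: measurable_fst.
  apply: measurable_funD; first by apply: measurable_funB => //; exact: measurable_funX.
  by apply: measurable_funM; [exact: measurableT_comp|exact: measurable_snd].
(* The sign of [x^2 - 1] decides the direction: as [d] grows, the density goes down outside
   [[-1, 1]] and up inside. *)
have inner x : x ^+ 2 - 1 != 0 ->
    (\int[mu]_(d in `]d1, d0[) (K (x, d))%:E =
     (2 * (`|x ^+ 2 - 1| / (x ^+ 2 - 1)) * (f1 x - f0 x))%:E)%E.
  move=> u0; rewrite /K/= affine_sqrt_int ?oppr_eq0//; congr EFin.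
  rewrite /f0 /f1 /densAB.
  have -> : (x ^+ 2 - 1) ^+ 2 - c + - (x ^+ 2 - 1) * d0 = (x ^+ 2 - B) * (x ^+ 2 - A).
    by rewrite /d0 /c; ring.
  have -> : (x ^+ 2 - 1) ^+ 2 - c + - (x ^+ 2 - 1) * d1 = (x ^+ 2 - (1 + c)) * (x ^+ 2 - 0).
    by rewrite /d1; ring.
  move: (Num.sqrt _) (Num.sqrt _) u0 => s0 s1; move: (x ^+ 2 - 1) => u u0.
  have v0 : `|u| != 0 by rewrite normr_eq0.
  by move: (`|u|) v0 => v v0; field; rewrite u0 v0.
have hi x : 1 < x -> (\int[mu]_(d in `]d1, d0[) (K (x, d))%:E = (2 * (f1 x - f0 x))%:E)%E.
  move=> x1; have u0 : 0 < x ^+ 2 - 1 by nra.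
  by rewrite inner ?gt_eqF// gtr0_norm// divff ?gt_eqF// mulr1.
have lo x : 0 < x < 1 -> (\int[mu]_(d in `]d1, d0[) (K (x, d))%:E = (2 * (f0 x - f1 x))%:E)%E.
  move=> /andP[x0 x1]; have u0 : x ^+ 2 - 1 < 0 by nra.
  rewrite inner ?lt_eqF// ltr0_norm// mulNr divff ?lt_eqF//; congr EFin; ring.
(* For fixed [d] the radicand, as a polynomial in [x^2], has the roots [b2] and [a2]: they are the
   values of [B] and [A] at that point of the curve. The condition [d1 < d] is what makes [a2]
   positive. *)
have flip d : d1 < d < d0 -> (\int[mu]_(x in `]1%R, +oo[) (K (x, d))%:E =
    \int[mu]_(x in `]0%R, 1%R[) (K (x, d))%:E)%E.
  move=> /andP[dd1 dd0]; pose D := Num.sqrt (d ^+ 2 + 4 * c).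
  have D2 : D ^+ 2 = d ^+ 2 + 4 * c by rewrite sqr_sqrtr//; nra.
  have D0 : 0 <= D by exact: sqrtr_ge0.
  have Dd : `|d| < D.
    by rewrite -(@ltr_pXn2r _ 2%N) ?nnegrE// D2 real_normK ?num_real//; lra.
  have [Dd1 Dd2] : - D < d /\ d < D by move: Dd; rewrite ltr_norml => /andP[].
  pose b2 := 1 + (d + D) / 2; pose a2 := 1 - (D - d) / 2.
  have b21 : 1 < b2 by rewrite /b2; lra.
  have a20 : 0 < a2.
    have : D < 2 + d.
      rewrite -(@ltr_pXn2r _ 2%N) ?nnegrE//; last by move: dd1; rewrite /d1; lra.
      by rewrite D2; move: dd1; rewrite /d1; lra.
    by rewrite /a2; lra.
  have a21 : a2 < 1 by rewrite /a2; lra.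
  have := @elliptic_inversion R (Num.sqrt a2) (Num.sqrt b2).
  have b20 : 0 < b2 by lra.
  rewrite !sqr_sqrtr ?(ltW a20) ?(ltW b20)//.
  have s1 : Num.sqrt a2 < 1 by rewrite -[ltRHS]sqrtr1 ltr_sqrt.
  have s2 : 1 < Num.sqrt b2 by rewrite -[ltLHS]sqrtr1 ltr_sqrt.
  rewrite sqrtr_gt0 => /(_ a20 s1 s2).
  suff E x : K (x, d) = (Num.sqrt ((x ^+ 2 - b2) * (x ^+ 2 - a2)))^-1.
    by under eq_integral do rewrite -E; under [in RHS]eq_integral do rewrite -E.
  rewrite /K/=; congr (Num.sqrt _)^-1.
  have -> : (x ^+ 2 - b2) * (x ^+ 2 - a2) =
     (x ^+ 2 - 1) ^+ 2 - (x ^+ 2 - 1) * d + (d ^+ 2 - D ^+ 2) / 4.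
    by rewrite /b2 /a2; field.
  by rewrite D2; field.
(* [flip] integrated over [d], after an exchange of integrals: what []1, +oo[] loses between [d1]
   and [d0], []0, 1[] gains. *)
have key : (\int[mu]_(x in `]1%R, +oo[) (2 * (f1 x - f0 x))%:E =
    \int[mu]_(x in `]0%R, 1%R[) (2 * (f0 x - f1 x))%:E)%E.
  transitivity (\int[mu]_(x in `]1%R, +oo[) \int[mu]_(d in `]d1, d0[) (K (x, d))%:E)%E.
    by apply: eq_integral => x; rewrite inE/= in_itv/= andbT => x1; rewrite hi.
  transitivity (\int[mu]_(x in `]0%R, 1%R[) \int[mu]_(d in `]d1, d0[) (K (x, d))%:E)%E; last first.
    by apply: eq_integral => x; rewrite inE/= in_itv/= => x1; rewrite lo.
  rewrite (@tonelli_on R _ _ K _ _ mK K0); [|exact: measurable_itv|exact: measurable_itv].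
  rewrite [RHS](@tonelli_on R _ _ K _ _ mK K0); [|exact: measurable_itv|exact: measurable_itv].
  by apply: eq_integral => d; rewrite inE/= in_itv/=; exact: flip.
have sub f (D : set (measurableTypeR R)) : mu.-integrable setT (EFin \o f) -> measurable D -> mu.-integrable D (EFin \o f).
  by move=> fi mD; apply: integrableS fi.
have ii (D : set (measurableTypeR R)) (g h : R -> R) : mu.-integrable setT (EFin \o g) -> mu.-integrable setT (EFin \o h) ->
   measurable D -> \int[mu]_(x in D) (2 * (g x - h x)) = 2 * (\int[mu]_(x in D) g x - \int[mu]_(x in D) h x).
  move=> gi hi' mD; rewrite RintegralZl//; last first.
    by have := integrableB mD (sub _ _ gi mD) (sub _ _ hi' mD).
  by rewrite RintegralB//; exact: sub.
have : \int[mu]_(x in `]1, +oo[) (2 * (f1 x - f0 x)) = \int[mu]_(x in `]0, 1[) (2 * (f0 x - f1 x)).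
  by congr fine.
rewrite ii//; rewrite ii//.
have lin (a b a' b' : R) : 2 * (a - b) = 2 * (a' - b') -> a' + b = b' + a by clear; lra.
exact: lin.
Qed.

End Neutrality.

(** * The condition [Phi = 0] *)

Section Moments.
Context {R : realType}.
Let mu := @lebesgue_measure R.
Implicit Types (f : R -> R) (x y a b d : R).

(* [2 * atan (v / (u + w))] is the polar angle of [(w, v)], where [u] is the radius. *)
Lemma isder_angle (v w u : R -> R) (x v' w' u' : R) :
  is_derive x 1 v v' -> is_derive x 1 w w' -> is_derive x 1 u u' ->
  u x ^+ 2 = v x ^+ 2 + w x ^+ 2 -> u x * u' = v x * v' + w x * w' ->
  0 < u x -> 0 <= w x ->
  is_derive x 1 (fun t => 2 * atan (v t / (u t + w t))) ((v' * w x - v x * w') / u x ^+ 2).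
Proof.
move=> dv dw du e1 e2 u0 w0.
have uw : u x + w x != 0 by neq.
have un : u x != 0 by rewrite gt_eqF.
isder; first exact: uw.
have -> : 1 + (v x * (u x + w x)^-1) ^+ 2 = 2 * u x / (u x + w x).
  apply: (mulIf (expf_neq0 2 uw)).
  transitivity ((u x + w x) ^+ 2 + v x ^+ 2); first by field.
  have -> : v x ^+ 2 = u x ^+ 2 - w x ^+ 2 by rewrite e1; ring.
  by field.
have -> : u' = (v x * v' + w x * w') / u x by rewrite -e2; field.
apply: (mulIf (expf_neq0 2 un)).
rewrite mulfVK ?expf_neq0//.
transitivity (((u x ^+ 2 - v x ^+ 2) * v' + u x * (v' * w x - v x * w') - v x * w x * w')
   / (u x + w x)); first by field; rewrite un uw.
have -> : u x ^+ 2 - v x ^+ 2 = w x ^+ 2 by rewrite e1; ring.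
by field.
Qed.

Variables (L r : R).
Hypotheses (L0 : 0 <= L) (Lr : L < r).
Let c0 := (r ^+ 2 + L ^+ 2) / 2.
Let m := (r ^+ 2 - L ^+ 2) / 2.
Definition ellq x : R := Num.sqrt ((r ^+ 2 - x ^+ 2) * (x ^+ 2 - L ^+ 2)).
Local Notation S := ellq.

Let m0 : 0 < m. Proof. by have h1 := L0; have h2 := Lr; rewrite /m; nra. Qed.

Lemma ellq_arg_gt0 x : L < x < r -> 0 < (r ^+ 2 - x ^+ 2) * (x ^+ 2 - L ^+ 2).
Proof. by have h1 := L0; move=> /andP[Lx xr]; rewrite mulr_gt0//; nra. Qed.

Lemma ellq_gt0 x : L < x < r -> 0 < S x.
Proof. by move=> xLr; rewrite sqrtr_gt0 ellq_arg_gt0. Qed.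

Lemma ellq_sqr x : L < x < r -> S x ^+ 2 = (r ^+ 2 - x ^+ 2) * (x ^+ 2 - L ^+ 2).
Proof. by move=> xLr; rewrite sqr_sqrtr// ltW// ellq_arg_gt0. Qed.

Lemma ellq_L : S L = 0. Proof. by rewrite /S subrr mulr0 sqrtr0. Qed.
Lemma ellq_r : S r = 0. Proof. by rewrite /S subrr mul0r sqrtr0. Qed.

Lemma ellq_der x : L < x < r -> is_derive x 1 S (- (2 * x * (x ^+ 2 - c0)) / S x).
Proof.
move=> xLr; have s0 : S x != 0 by rewrite gt_eqF// ellq_gt0.
rewrite /S; isder; first exact: ellq_arg_gt0.
by rewrite -/(S x) /c0; field.
Qed.

Lemma ellq_cvg a : S x @[x --> a] --> S a.
Proof. by rewrite /S; lims. Qed.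

(** On [[L, r]] this is the arc sine of [(x^2 - c0) / m], an angle on the circle
    [(x^2 - c0)^2 + S^2 = m^2]. The half-angle form keeps the denominator nonzero at the ends, where
    [S] vanishes. *)
Definition ellG1 x : R := 2 * atan ((x ^+ 2 - c0) / (m + S x)).
Local Notation G1 := ellG1.

Let mS a : m + S a != 0.
Proof. by have := sqrtr_ge0 ((r ^+ 2 - a ^+ 2) * (a ^+ 2 - L ^+ 2)); have h := m0; rewrite -/(S a) => ?; neq. Qed.

Lemma ellG1_der x : L < x < r -> is_derive x 1 G1 (2 * x / S x).
Proof.
move=> xLr; have s0 := ellq_gt0 xLr; have s2 := ellq_sqr xLr.
have sn : S x != 0 by rewrite gt_eqF.
have M := m0; have mn : m != 0 by rewrite gt_eqF.
have e : m ^+ 2 = (x ^+ 2 - c0) ^+ 2 + S x ^+ 2 by rewrite s2 /m /c0; field.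
have dv : is_derive x 1 (fun t => t ^+ 2 - c0) (2 * x) by isder; rewrite /=; ring.
have e2 : m * 0 = (x ^+ 2 - c0) * (2 * x) + S x * (- (2 * x * (x ^+ 2 - c0)) / S x) by field.
have dS := ellq_der xLr; have dm := isder_cst m x.
refine (isder_eq (isder_angle dv dS dm e e2 M (ltW s0)) _).
transitivity (2 * x * (S x ^+ 2 + (x ^+ 2 - c0) ^+ 2) / (S x * m ^+ 2)).
  by field; rewrite mn sn.
by rewrite [S x ^+ 2 + _]addrC -e; field; rewrite mn sn.
Qed.

Lemma ellG1_cvg a : G1 x @[x --> a] --> G1 a.
Proof. by rewrite /G1; have h := @ellq_cvg a; lims; exact: mS. Qed.

Lemma ellG1_r : G1 r = pi / 2.
Proof.
rewrite /G1 ellq_r addr0 (_ : _ / m = 1) ?atan1; first by field.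
by have M := m0; have mn : m != 0; first (by rewrite gt_eqF); rewrite -[RHS](divff mn); congr (_ / _); rewrite /m /c0; field.
Qed.

Lemma ellG1_L : G1 L = - (pi / 2).
Proof.
rewrite /G1 ellq_L addr0 (_ : _ / m = -1) ?atanN ?atan1; first by field.
by have M := m0; have mn : m != 0; first (by rewrite gt_eqF); rewrite (_ : L ^+ 2 - c0 = - m) ?mulNr ?divff//; rewrite /m /c0; field.
Qed.

(** In the variable [x^2] this is half the area of a half disc of radius [m] centred at [c0]. *)
Lemma ellq_int_x :
  (\int[mu]_(x in `]L, r[) (S x * x)%:E = (pi * m ^+ 2 / 4)%:E)%E.
Proof.
have h1 := L0; have h2 := Lr.
have -> : (pi * m ^+ 2 / 4)%:E = (m ^+ 2 * (pi / 2) / 4 - m ^+ 2 * (- (pi / 2)) / 4)%:E :> \bar R.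
  by congr EFin; field.
apply: (ge0_FTCoo (F := fun x => ((x ^+ 2 - c0) * S x + m ^+ 2 * G1 x) / 4)).
- exact: h2.
- by move=> x /andP[Lx _]; rewrite mulr_ge0 ?sqrtr_ge0//; lra.
- move=> x _; have h := @ellq_cvg x; apply: cont_at; [by lims|by []].
- move=> x xLr; have dS := ellq_der xLr; have dG := ellG1_der xLr; rewrite /has_der.
  have s0 := ellq_gt0 xLr; have s2 := ellq_sqr xLr; have sn : S x != 0 by rewrite gt_eqF.
  isder => /=.
  have e : m ^+ 2 = (x ^+ 2 - c0) ^+ 2 + S x ^+ 2 by rewrite s2 /m /c0; field.
  by rewrite e; field.
- apply: cvg_at_right_filter; have h := @ellq_cvg L; have h' := @ellG1_cvg L.
  by apply: fcvg_eq; [lims|rewrite ellq_L ellG1_L; field].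
- apply: cvg_at_left_filter; have h := @ellq_cvg r; have h' := @ellG1_cvg r.
  by apply: fcvg_eq; [lims|rewrite ellq_r ellG1_r; field].
Qed.

(** The same half disc as for [ellq_int_x]; by symmetry its centre of mass has abscissa [c0]. *)
Lemma ellq_int_x3 :
  (\int[mu]_(x in `]L, r[) (S x * x ^+ 3)%:E = (c0 * (pi * m ^+ 2 / 4))%:E)%E.
Proof.
have h1 := L0; have h2 := Lr.
have -> : (c0 * (pi * m ^+ 2 / 4))%:E = (c0 * (m ^+ 2 * (pi / 2) / 4) - c0 * (m ^+ 2 * (- (pi / 2)) / 4))%:E :> \bar R.
  by congr EFin; field.
apply: (ge0_FTCoo (F := fun x => c0 * (((x ^+ 2 - c0) * S x + m ^+ 2 * G1 x) / 4) - S x ^+ 3 / 6)).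
- exact: h2.
- by move=> x /andP[Lx _]; rewrite mulr_ge0 ?sqrtr_ge0// exprn_ge0//; lra.
- move=> x _; have h := @ellq_cvg x; apply: cont_at; [by lims|by []].
- move=> x xLr; have dS := ellq_der xLr; have dG := ellG1_der xLr; rewrite /has_der.
  have s0 := ellq_gt0 xLr; have s2 := ellq_sqr xLr; have sn : S x != 0 by rewrite gt_eqF.
  isder => /=.
  have e : m ^+ 2 = (x ^+ 2 - c0) ^+ 2 + S x ^+ 2 by rewrite s2 /m /c0; field.
  by rewrite e; field.
- apply: cvg_at_right_filter; have h := @ellq_cvg L; have h' := @ellG1_cvg L.
  by apply: fcvg_eq; [lims|rewrite ellq_L ellG1_L; field].
- apply: cvg_at_left_filter; have h := @ellq_cvg r; have h' := @ellG1_cvg r.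
  by apply: fcvg_eq; [lims|rewrite ellq_r ellG1_r; field].
Qed.

(** For [x > 0] this is [- ellG1 (r * L / x)]: the inversion preserves [[L, r]] and turns [x / S]
    into [1 / (x * S)] up to constants. *)
Definition ellG2 x : R := 2 * atan ((c0 * x ^+ 2 - (r * L) ^+ 2) / (m * x ^+ 2 + r * L * S x)).
Local Notation G2 := ellG2.

Hypothesis L1 : 0 < L.
Let r0 : 0 < r. Proof. exact: lt_trans Lr. Qed.

Let mxS a : a != 0 -> m * a ^+ 2 + r * L * S a != 0.
Proof.
move=> a0; have := sqrtr_ge0 ((r ^+ 2 - a ^+ 2) * (a ^+ 2 - L ^+ 2)); rewrite -/(S a) => S0.
have h1 : 0 < m * a ^+ 2 by rewrite mulr_gt0// ?m0// exprn_even_gt0.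
have h2 : 0 <= r * L * S a by rewrite mulr_ge0// mulr_ge0// ltW// r0.
by neq.
Qed.

Lemma ellG2_der x : L < x < r -> is_derive x 1 G2 (2 * (r * L) / (x * S x)).
Proof.
move=> xLr; have s0 := ellq_gt0 xLr; have s2 := ellq_sqr xLr.
have sn : S x != 0 by rewrite gt_eqF.
have M := m0; have mn : m != 0 by rewrite gt_eqF.
have h1 := L1; have h2 := r0.
have x0 : 0 < x by move: xLr => /andP[]; lra.
have xn : x != 0 by rewrite gt_eqF.
have e : (m * x ^+ 2) ^+ 2 = (c0 * x ^+ 2 - (r * L) ^+ 2) ^+ 2 + (r * L * S x) ^+ 2.
  by rewrite !exprMn s2 /m /c0; field.
have dv : is_derive x 1 (fun t => c0 * t ^+ 2 - (r * L) ^+ 2) (2 * c0 * x) by isder; rewrite /=; ring.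
have dS := ellq_der xLr.
have dw : is_derive x 1 (fun t => r * L * S t) (r * L * (- (2 * x * (x ^+ 2 - c0)) / S x)) by isder; rewrite /=; field.
have du : is_derive x 1 (fun t => m * t ^+ 2) (m * (2 * x)) by isder; rewrite /=; ring.
have e2 : m * x ^+ 2 * (m * (2 * x)) =
   (c0 * x ^+ 2 - (r * L) ^+ 2) * (2 * c0 * x) + r * L * S x * (r * L * (- (2 * x * (x ^+ 2 - c0)) / S x)).
  by rewrite /m /c0; field.
have u0 : 0 < m * x ^+ 2 by rewrite mulr_gt0// exprn_gt0.
have w0 : 0 <= r * L * S x by rewrite !mulr_ge0// ltW.
refine (isder_eq (isder_angle dv dw du e e2 u0 w0) _).
transitivity (2 * x * (r * L) * (c0 * S x ^+ 2 + (c0 * x ^+ 2 - (r * L) ^+ 2) * (x ^+ 2 - c0)) / (S x * (m * x ^+ 2) ^+ 2)).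
  by field; rewrite mn sn xn.
have -> : c0 * S x ^+ 2 + (c0 * x ^+ 2 - (r * L) ^+ 2) * (x ^+ 2 - c0) = m ^+ 2 * x ^+ 2.
  by rewrite s2 /c0 /m; field.
by field; rewrite mn sn xn.
Qed.

Lemma ellG2_cvg a : a != 0 -> G2 x @[x --> a] --> G2 a.
Proof. by move=> a0; rewrite /G2; have h := @ellq_cvg a; lims; exact: mxS. Qed.

Lemma ellG2_r : G2 r = pi / 2.
Proof.
have M := m0; have h2 := r0; have mn : m * r ^+ 2 != 0 by rewrite gt_eqF// mulr_gt0// exprn_gt0.
rewrite /G2 ellq_r mulr0 addr0 (_ : _ / (m * _) = 1) ?atan1; first by field.
by rewrite -[RHS](divff mn); congr (_ / _); rewrite /m /c0; field.
Qed.

Lemma ellG2_L : G2 L = - (pi / 2).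
Proof.
have M := m0; have h2 := L1; have mn : m * L ^+ 2 != 0 by rewrite gt_eqF// mulr_gt0// exprn_gt0.
rewrite /G2 ellq_L mulr0 addr0 (_ : _ / (m * _) = -1) ?atanN ?atan1; first by field.
by rewrite (_ : c0 * L ^+ 2 - (r * L) ^+ 2 = - (m * L ^+ 2)) ?mulNr ?divff//; rewrite /m /c0; field.
Qed.

(** Writing [S / x] as [S^2 / (x * S)] and expanding [S^2] in powers of [x^2] gives a combination of
    the derivatives of [S], [ellG1] and [ellG2]. *)
Lemma ellq_int_xV :
  (\int[mu]_(x in `]L, r[) (S x / x)%:E = (pi / 4 * (r - L) ^+ 2)%:E)%E.
Proof.
have h1 := L1; have h2 := Lr; have h3 := r0.
have -> : (pi / 4 * (r - L) ^+ 2)%:E = ((c0 - r * L) * (pi / 2) / 2 - (c0 - r * L) * (- (pi / 2)) / 2)%:E :> \bar R.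
  by congr EFin; rewrite /c0; field.
apply: (ge0_FTCoo (F := fun x => (S x + c0 * G1 x - r * L * G2 x) / 2)).
- exact: h2.
- by move=> x /andP[Lx _]; rewrite mulr_ge0 ?sqrtr_ge0// invr_ge0; lra.
- move=> x /andP[xL _]; have h := @ellq_cvg x; apply: cont_at; [lims|by []].
  by neq.
- move=> x xLr; have dS := ellq_der xLr; have dG := ellG1_der xLr; have dG2 := ellG2_der xLr.
  rewrite /has_der.
  have s0 := ellq_gt0 xLr; have s2 := ellq_sqr xLr; have sn : S x != 0 by rewrite gt_eqF.
  have xn : x != 0 by move: xLr => /andP[? _]; neq.
  isder => /=.
  transitivity (S x ^+ 2 / (x * S x)); last by field; rewrite sn xn.
  by rewrite s2 /c0; field; rewrite sn xn.
- apply: cvg_at_right_filter; have h := @ellq_cvg L; have h' := @ellG1_cvg L.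
  have h'' := @ellG2_cvg L (lt0r_neq0 h1).
  by apply: fcvg_eq; [lims|rewrite ellq_L ellG1_L ellG2_L; field].
- apply: cvg_at_left_filter; have h := @ellq_cvg r; have h' := @ellG1_cvg r.
  have h'' := @ellG2_cvg r (lt0r_neq0 h3).
  by apply: fcvg_eq; [lims|rewrite ellq_r ellG1_r ellG2_r; field].
Qed.

End Moments.

(** * Evaluation of the principal value *)

Section PrincipalValue.
Context {R : realType}.
Let mu := @lebesgue_measure R.
Implicit Types (f : R -> R) (x y a b d : R).

Lemma bounded_integrable_oo f a b K : measurable_fun setT f ->
  (forall x, a < x < b -> `|f x| <= K) -> mu.-integrable `]a, b[ (EFin \o f).
Proof.
move=> mf fK; apply: measurable_bounded_integrable.
- exact: measurable_itv.
- by have := @lebesgue_measure_itv R `]a, b[; rewrite /= => ->; case: ifP => _; rewrite ?ltry// -EFinB ltry.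
- exact: measurable_funTS.
- exists K; split; first exact: num_real.
  by move=> M KM x; rewrite /= in_itv/= => /fK /le_trans; apply; exact: ltW.
Qed.

Lemma Rintegral_split_oo f a b c : a < b -> b < c -> measurable_fun setT f ->
  (forall x, a < x < c -> 0 <= f x) -> mu.-integrable `]a, c[ (EFin \o f) ->
  \int[mu]_(x in `]a, c[) f x = \int[mu]_(x in `]a, b[) f x + \int[mu]_(x in `]b, c[) f x.
Proof.
move=> ab bc mf f0 fi.
have i1 : mu.-integrable `]a, b[ (EFin \o f).
  apply: integrableS fi; [exact: measurable_itv|exact: measurable_itv|].
  by move=> x; rewrite /= !in_itv/= => /andP[-> /lt_trans]; exact.
have i2 : mu.-integrable `]b, c[ (EFin \o f).
  apply: integrableS fi; [exact: measurable_itv|exact: measurable_itv|].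
  by move=> x; rewrite /= !in_itv/= => /andP[/(lt_trans ab) -> ->].
have j1 : (\int[mu]_(x in `]a, b[) (f x)%:E \is a fin_num)%E.
  by apply: integrable_fin_num i1; exact: measurable_itv.
have j2 : (\int[mu]_(x in `]b, c[) (f x)%:E \is a fin_num)%E.
  by apply: integrable_fin_num i2; exact: measurable_itv.
rewrite -(fineD j1 j2) -(@ge0_integral_split_oo R a b c f ab bc)//.
exact: measurable_funTS.
Qed.

Lemma Rintegral_oo_bound f a b K : a < b -> measurable_fun setT f ->
  (forall x, a < x < b -> 0 <= f x <= K) ->
  0 <= \int[mu]_(x in `]a, b[) f x <= K * (b - a).
Proof.
move=> ab mf fK; apply/andP; split.
  by apply: Rintegral_ge0 => x; rewrite /= in_itv/= => /fK /andP[].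
rewrite -Rintegral_cst_oo//; apply: le_Rintegral.
- exact: measurable_itv.
- apply: (bounded_integrable_oo (K := K)) => // x /fK /andP[f0 f1].
  by rewrite ger0_norm.
- apply: (bounded_integrable_oo (K := `|K|)) => // x _.
- by move=> x; rewrite /= in_itv/= => /fK /andP[].
Qed.

Lemma measurable_ellq L r : measurable_fun setT (@ellq R L r).
Proof.
apply: (measurableT_comp (@measurable_sqrt R)).
by apply: measurable_funM; apply: measurable_funB => //; exact: measurable_funX.
Qed.

Lemma ellq_le L r x : x <= r -> L <= x -> 0 <= L -> ellq L r x <= r ^+ 2.
Proof.
move=> xr Lx L0; have r0 : 0 <= r by lra.
rewrite -[leRHS]ger0_norm ?sqr_ge0// -sqrtr_sqr ler_wsqrtr//.
rewrite [leRHS]expr2 ler_pM//; nra.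
Qed.

Variables (L r : R).
Hypotheses (L0 : 0 <= L) (L1 : L < 1) (r1 : 1 < r).
Let Lr : L < r. Proof. exact: lt_trans r1. Qed.
Let p := r ^+ 2 - 1.
Let q : R := 1 - L ^+ 2.
Let d := r ^+ 2 + L ^+ 2 - 2.
Let P : R := Num.sqrt (p * q).
Local Notation S := (ellq L r).
(** With [w = x^2 - 1] one has [S^2 = p * q + d * w - w^2], and [ln (N / |w|)] is the logarithm in
    the classical primitive of [1 / (w * S)]. *)
Let N x := 2 * (p * q) + d * (x ^+ 2 - 1) + 2 * P * S x.
Let H x := (S x + d / 2 * ellG1 L r x - P * ln (N x) + P * ln `|x ^+ 2 - 1|) / 2.

Let p0 : 0 < p. Proof. by have h := r1; rewrite /p; nra. Qed.
Let q0 : 0 < q. Proof. by have h := L1; have h' := L0; rewrite /q; nra. Qed.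
Let P2 : P ^+ 2 = p * q.
Proof. by rewrite sqr_sqrtr// mulr_ge0// ltW. Qed.

(** Without the term in [S], [N] is [p * (q + w) + q * (p - w)] with [- q <= w <= p], and the two
    factors cannot vanish together. *)
Let N0 x : L <= x <= r -> 0 < N x.
Proof.
move=> /andP[Lx xr]; have hp := p0; have hq := q0; have hL := L0.
have h1 : 0 <= 2 * P * S x by rewrite !mulr_ge0// sqrtr_ge0.
have x1 : - q <= x ^+ 2 - 1 by rewrite /q; nra.
have x2 : x ^+ 2 - 1 <= p by rewrite /p; nra.
have dpq : d = p - q by rewrite /d /p /q; ring.
rewrite /N dpq; suff : 0 < 2 * (p * q) + (p - q) * (x ^+ 2 - 1) by lra.
move: (x ^+ 2 - 1) x1 x2 => w w1 w2.
have -> : 2 * (p * q) + (p - q) * w = p * (q + w) + q * (p - w) by ring.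
have := mulr_ge0 (ltW hp) (_ : 0 <= q + w); have := mulr_ge0 (ltW hq) (_ : 0 <= p - w).
move=> /(_ ltac:(lra)) a1 /(_ ltac:(lra)) a2.
have : w < p \/ - q < w by have [wp|] := ltP w p; [left|right; lra].
case=> h.
  by have := mulr_gt0 hq (_ : 0 < p - w); rewrite subr_gt0 => /(_ h); lra.
by have := mulr_gt0 hp (_ : 0 < q + w) => /(_ ltac:(lra)); lra.
Qed.

Let H_der x : L < x < r -> x ^+ 2 - 1 != 0 -> is_derive x 1 H (S x * x / (x ^+ 2 - 1)).
Proof.
move=> xLr w0; have dS := ellq_der L0 xLr; have dG := ellG1_der L0 Lr xLr.
have s0 := ellq_gt0 L0 xLr; have s2 := ellq_sqr L0 xLr.
have sn : S x != 0 by rewrite gt_eqF.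
have n0 : 0 < N x by apply: N0; move: xLr => /andP[/ltW -> /ltW].
have nn : N x != 0 by rewrite gt_eqF.
have dN : is_derive x 1 N (2 * x * (d - P * (2 * (x ^+ 2 - 1) - d) / S x)).
  by rewrite /N; isder; rewrite /= /d; field.
(* Logarithmic derivative of [N]; its part [2 * x / (x^2 - 1)] is compensated in [H] by
   [ln |x^2 - 1|]. *)
have dN' : 2 * x * (d - P * (2 * (x ^+ 2 - 1) - d) / S x) =
    2 * x * N x * ((x ^+ 2 - 1)^-1 - P / (S x * (x ^+ 2 - 1))).
  apply: (mulIf sn); apply: (mulIf w0).
  transitivity (2 * x * ((S x - P) * N x)); last by field; rewrite w0 sn.
  transitivity (2 * x * ((x ^+ 2 - 1) * (d * S x - P * (2 * (x ^+ 2 - 1) - d)))); first by field.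
  congr (_ * _); apply/subr0_eq.
  transitivity (P * (2 * (S x ^+ 2 - (p * q + d * (x ^+ 2 - 1) - (x ^+ 2 - 1) ^+ 2))) * -1
     + 2 * S x * (P ^+ 2 - p * q)).
    by rewrite /N; ring.
  by rewrite P2 s2 /p /q /d; ring.
rewrite dN' in dN.
rewrite /H; isder => //=.
transitivity (x * (- (x ^+ 2 - 1) ^+ 2 + d * (x ^+ 2 - 1) + P ^+ 2) / (S x * (x ^+ 2 - 1))).
  by rewrite /d; field; rewrite sn w0 nn.
have -> : - (x ^+ 2 - 1) ^+ 2 + d * (x ^+ 2 - 1) + P ^+ 2 = S x ^+ 2.
  by rewrite s2 P2 /d /p /q; ring.
by field; rewrite sn w0.
Qed.

Let H_cvg a : L <= a <= r -> a ^+ 2 - 1 != 0 -> H x @[x --> a] --> H a.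
Proof.
move=> La a0; have n0 := N0 La.
have h := @ellq_cvg R L r a; have h' := @ellG1_cvg R L r L0 Lr a.
have hN : N x @[x --> a] --> N a by rewrite /N; lims.
by rewrite /H; lims => //; rewrite normr_gt0.
Qed.

Let H_r : H r = (d * (pi / 4) - P * ln (p + q)) / 2.
Proof.
have hp := p0; have hq := q0.
rewrite /H ellq_r ellG1_r// -/p gtr0_norm// /N ellq_r mulr0 addr0 -/p.
have -> : 2 * (p * q) + d * p = p * (p + q) by rewrite /d /p /q; ring.
rewrite lnM ?posrE//; last by lra.
by field.
Qed.

Let H_L : H L = (- (d * (pi / 4)) - P * ln (p + q)) / 2.
Proof.
have hp := p0; have hq := q0.
have w : L ^+ 2 - 1 = - q by rewrite /q; ring.
rewrite /H ellq_L ellG1_L// w normrN gtr0_norm// /N ellq_L mulr0 addr0 w.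
have -> : 2 * (p * q) + d * - q = q * (p + q) by rewrite /d /p /q; ring.
rewrite lnM ?posrE//; last by lra.
by field.
Qed.

(** [H] is a function [T] continuous at 1 plus [P * ln |x^2 - 1| / 2]. At [1 - e] and [1 + e] the
    logarithms have the common term [ln e], which cancels. *)
Let H_pv : H (1 - e) - H (1 + e) @[e --> 0^'+] --> (0 : R).
Proof.
have hL := L0; have hL1 := L1; have hr := r1.
pose T x := (S x + d / 2 * ellG1 L r x - P * ln (N x)) / 2.
have h := @ellq_cvg R L r 1; have h' := @ellG1_cvg R L r L0 Lr 1.
have n0 : 0 < N 1 by apply: N0; rewrite !ltW.
have hN : N x @[x --> (1 : R)] --> N 1 by rewrite /N; lims.
have hT : T x @[x --> (1 : R)] --> T 1 by rewrite /T; lims.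
have h1 : 1 - e @[e --> (0 : R)] --> (1 : R) by apply: fcvg_eq; [lims|ring].
have h2 : 1 + e @[e --> (0 : R)] --> (1 : R) by apply: fcvg_eq; [lims|ring].
have t1 : T (1 - e) @[e --> (0 : R)] --> T 1 by apply: (cvg_comp _ T h1 hT).
have t2 : T (1 + e) @[e --> (0 : R)] --> T 1 by apply: (cvg_comp _ T h2 hT).
have t3 : T (1 - e) - T (1 + e) + P * (ln (2 - e) - ln (2 + e)) / 2 @[e --> (0 : R)] --> (0 : R).
  clear h h' hN hT h1 h2 n0.
  by apply: fcvg_eq; [lims; lra|rewrite subr0 addr0; ring].
apply: (fcvg_near _ (cvg_at_right_filter t3)).
near=> e.
have e0 : 0 < e by near: e; exact: nbhs_right_gt.
have e1 : e < 1 by near: e; exact: nbhs_right_lt.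
rewrite /T /H.
have -> : (1 - e) ^+ 2 - 1 = - (e * (2 - e)) by ring.
have -> : (1 + e) ^+ 2 - 1 = e * (2 + e) by ring.
have f1 : 0 < 2 - e by lra.
have f2 : 0 < 2 + e by lra.
rewrite normrN !gtr0_norm ?mulr_gt0// !lnM ?posrE//.
by field.
Unshelve. all: by end_near. Qed.

Let mS : measurable_fun setT S := measurable_ellq L r.

Let g x : R := S x / (1 + x).

Let mg : measurable_fun setT g.
Proof.
apply: measurable_funM; first exact: mS.
apply: (measurableT_comp (@measurable_inv R)); exact: measurable_funD.
Qed.

Let gb x : L < x < r -> 0 <= g x <= r ^+ 2.
Proof.
move=> /andP[Lx xr]; have hL := L0; have x1 : 1 <= 1 + x by lra.
rewrite /g divr_ge0 ?sqrtr_ge0//=; last by lra.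
have s0 : 0 <= S x by exact: sqrtr_ge0.
rewrite ler_pdivrMr; last by lra.
apply: (@le_trans _ _ (r ^+ 2)); first by apply: ellq_le => //; exact: ltW.
by rewrite ler_peMr// sqr_ge0.
Qed.

Let gi a b : L <= a -> b <= r -> mu.-integrable `]a, b[ (EFin \o g).
Proof.
move=> La br; apply: (bounded_integrable_oo (K := r ^+ 2)); first exact: mg.
move=> x /andP[ax xb]; have /andP[g0 g1] : 0 <= g x <= r ^+ 2 by apply: gb; apply/andP; lra.
by rewrite ger0_norm.
Qed.

(** [s] is the sign of [x^2 - 1] on [[a, b]]; multiplying by it makes the singular part nonnegative,
    as the fundamental theorem used here requires. *)
Let Phi_piece (s a b : R) : L <= a -> a < b -> b <= r -> s * s = 1 ->
  (forall x, a <= x <= b -> 0 < s * (x ^+ 2 - 1)) ->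
  \int[mu]_(x in `[a, b]) Phi_integrand L r x =
  pi * (H b - H a - \int[mu]_(x in `]a, b[) g x).
Proof.
move=> La ab br ss s0; have hL := L0.
pose f x : R := s * (S x * x / (x ^+ 2 - 1)).
have sn x : a <= x <= b -> x ^+ 2 - 1 != 0.
  by move=> /s0 h; apply/eqP => e; move: h; rewrite e mulr0 ltxx.
have oc x : a < x < b -> a <= x <= b by move=> /andP[/ltW -> /ltW].
have oL x : a < x < b -> L < x < r by move=> /andP[? ?]; apply/andP; lra.
have mf : measurable_fun setT f.
  apply: measurable_funM => //; apply: measurable_funM; first by apply: measurable_funM => //; exact: mS.
  apply: (measurableT_comp (@measurable_inv R)); apply: measurable_funB => //; exact: measurable_funX.
have f0 x : a < x < b -> 0 <= f x.
  move=> xab; have h := s0 x (oc x xab); have hn := sn x (oc x xab).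
  have -> : f x = S x * x * (s * (x ^+ 2 - 1)) / (x ^+ 2 - 1) ^+ 2 by rewrite /f; field.
  rewrite divr_ge0 ?sqr_ge0// mulr_ge0 ?(ltW h)// mulr_ge0 ?sqrtr_ge0//.
  by move: xab => /andP[]; lra.
have a_ab : a <= a <= b by rewrite lexx ltW.
have b_ab : a <= b <= b by rewrite lexx ltW.
have fint : (\int[mu]_(x in `]a, b[) (f x)%:E = (s * H b - s * H a)%:E)%E.
  apply: (ge0_FTCoo (F := fun x => s * H x)).
  - exact: ab.
  - exact: f0.
  - move=> x xab; have hS := @ellq_cvg R L r x; have hn := sn x (oc x xab).
    by apply: cont_at; [rewrite /f; lims|by []].
  - move=> x xab; have hH := H_der (oL x xab) (sn x (oc x xab)).
    by rewrite /has_der; isder; rewrite /f /=; ring.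
  - apply: cvg_at_right_filter.
    have h : H x @[x --> a] --> H a by apply: H_cvg (sn a a_ab); apply/andP; lra.
    by clear -h; lims.
  - apply: cvg_at_left_filter.
    have h : H x @[x --> b] --> H b by apply: H_cvg (sn b b_ab); apply/andP; lra.
    by clear -h; lims.
have fi : mu.-integrable `]a, b[ (EFin \o f).
  by apply: ge0_integrable_val fint => //; move=> x; rewrite /= in_itv/=; exact: f0.
have fR : \int[mu]_(x in `]a, b[) f x = s * H b - s * H a by rewrite /Rintegral fint.
have gi' := gi La br.
have sfi : mu.-integrable `]a, b[ (EFin \o (fun x => s * f x)).
  by apply: (integrableZl _ s fi); exact: measurable_itv.
have di : mu.-integrable `]a, b[ (EFin \o (fun x => s * f x - g x)).
  by apply: (integrableB _ sfi gi'); exact: measurable_itv.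
have mPhi : measurable_fun setT (Phi_integrand L r).
  apply: measurable_funM; first by apply: measurable_funM => //; exact: mS.
  apply: (measurableT_comp (@measurable_inv R)); apply: measurable_funB => //; exact: measurable_funX.
transitivity (\int[mu]_(x in `]a, b[) Phi_integrand L r x).
  congr fine; apply: (@integral_itv_bndoo _ _ _ _ true false).
  by apply/measurable_EFinP; exact: measurable_funTS.
transitivity (\int[mu]_(x in `]a, b[) (pi * (s * f x - g x))).
  apply: eq_Rintegral => x; rewrite inE/= in_itv/= => xab.
  rewrite /f mulrA ss mul1r /g /Phi_integrand -/(S x).
  have hn := sn x (oc x xab); have x1 : 1 + x != 0 by move: xab => /andP[? _]; neq.
  by field; rewrite hn x1.
rewrite RintegralZl; [|exact: measurable_itv|exact: di].
rewrite RintegralB; [|exact: measurable_itv|exact: sfi|exact: gi'].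
rewrite RintegralZl; [|exact: measurable_itv|exact: fi].
by rewrite fR -mulrBr mulrA ss mul1r.
Qed.

(* [1 / (x^2 - 1) = x / (x^2 - 1) - 1 / (1 + x)]: the first term has the primitive [H],
   whose logarithmic singularity at [1] cancels in the principal value. *)
Lemma Phi_eq : Phi L r = pi * (pi * d / 4 - \int[mu]_(x in `]L, r[) (S x / (1 + x))).
Proof.
have hL := L0; have hL1 := L1; have hr := r1; have hLr := Lr.
rewrite /Phi; apply: cvg_lim; first exact: norm_hausdorff.
pose V := \int[mu]_(x in `]L, r[) g x.
(* The part of the regular integral that the window around 1 removes; it lies between 0 and
   [2 * e * r^2]. *)
pose U e := \int[mu]_(x in `](1 - e), (1 + e)[) g x.
have U0 : U e @[e --> 0^'+] --> (0 : R).
  have h2 : r ^+ 2 * (2 * e) @[e --> (0 : R)] --> (0 : R) by apply: fcvg_eq; [lims|ring].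
  apply: (squeeze_cvgr _ (cvg_cst 0) (cvg_at_right_filter h2)); near=> e.
  have e0 : 0 < e by near: e; exact: nbhs_right_gt.
  have e1 : e < 1 - L by near: e; apply: nbhs_right_lt; lra.
  have e2 : e < r - 1 by near: e; apply: nbhs_right_lt; lra.
  have -> : 2 * e = (1 + e) - (1 - e) by ring.
  apply: Rintegral_oo_bound; first lra.
    exact: mg.
  by move=> x /andP[? ?]; apply: gb; apply/andP; lra.
have key : \forall e \near (0 : R)^'+, pi * (H (1 - e) - H (1 + e) + (H r - H L) - V + U e) =
   \int[mu]_(x in `[L, 1 - e]) Phi_integrand L r x + \int[mu]_(x in `[1 + e, r]) Phi_integrand L r x.
  near=> e.
  have e0 : 0 < e by near: e; exact: nbhs_right_gt.
  have e1 : e < 1 - L by near: e; apply: nbhs_right_lt; lra.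
  have e2 : e < r - 1 by near: e; apply: nbhs_right_lt; lra.
  rewrite (@Phi_piece (-1) L (1 - e)) ?lexx//; try lra; last first.
    by move=> x /andP[? ?]; nra.
  rewrite (@Phi_piece 1 (1 + e) r) ?lexx//; try lra; last first.
    by move=> x /andP[? ?]; nra.
  have g0 x : L < x < r -> 0 <= g x by move=> /gb /andP[].
  have -> : V = \int[mu]_(x in `]L, (1 - e)[) g x + (U e + \int[mu]_(x in `](1 + e), r[) g x).
    rewrite /V /U (@Rintegral_split_oo g L (1 - e) r _ _ mg)//; try lra; last by apply: gi.
    rewrite (@Rintegral_split_oo g (1 - e) (1 + e) r _ _ mg)//; try lra.
      by move=> x /andP[? ?]; apply: g0; apply/andP; lra.
    by apply: gi => //; lra.
  ring.
apply: (fcvg_near _ (_ : pi * (H (1 - e) - H (1 + e) + (H r - H L) - V + U e) @[e --> 0^'+] --> _)).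
  by apply: filterS key => e ->.
have h := H_pv; apply: fcvg_eq; first by lims.
(* The terms [P * ln (p + q)] of [H r] and [H L] cancel, which leaves [d * pi / 4]. *)
by rewrite H_r H_L -/V; field.
Unshelve. all: by end_near. Qed.

End PrincipalValue.

(** * The elliptic integral as a function of [L] *)

Section EllipticIntegral.
Context {R : realType}.
Let mu := @lebesgue_measure R.
Implicit Types (f : R -> R) (x y a b d L r : R).

Lemma sqrt_dist_le a b : `|Num.sqrt a - Num.sqrt b| <= Num.sqrt `|a - b|.
Proof.
wlog ab : a b / b <= a.
  by move=> H; have [/H//|/ltW /H] := leP b a; rewrite distrC (distrC b).
have sab : Num.sqrt b <= Num.sqrt a by exact: ler_wsqrtr.
rewrite !ger0_norm ?subr_ge0// lerBlDr.
have [b0|b0] := leP 0 b; last first.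
  by rewrite (ltr0_sqrtr b0) addr0 ler_wsqrtr//; lra.
have u0 := sqrtr_ge0 (a - b); have v0 := sqrtr_ge0 b.
rewrite -(@ler_pXn2r _ 2%N) ?nnegrE ?sqrtr_ge0 ?addr_ge0//.
rewrite sqrrD !sqr_sqrtr ?subr_ge0//; last lra.
have := mulr_ge0 u0 v0; rewrite mulr2n; lra.
Qed.

(** The integral starts at 0 instead of [L]: the square root is 0 on []0, L[], and a domain
    independent of [L] reduces continuity in [L] to a pointwise estimate. *)
Definition ellI L r : R := \int[mu]_(x in `]0, r[) (ellq L r x / (1 + x)).

Lemma measurable_ellI L r : measurable_fun setT (fun x : R => ellq L r x / (1 + x)).
Proof.
apply: measurable_funM; first exact: measurable_ellq.
apply: (measurableT_comp (@measurable_inv R)); exact: measurable_funD.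
Qed.

Lemma ellI_arg_bound L r x : 0 < x < r -> 0 <= ellq L r x / (1 + x) <= r ^+ 2.
Proof.
move=> /andP[x0 xr]; rewrite divr_ge0 ?sqrtr_ge0//=; last by lra.
have s0 : 0 <= ellq L r x by exact: sqrtr_ge0.
rewrite ler_pdivrMr; last by lra.
apply: (@le_trans _ _ (r ^+ 2)); last by rewrite ler_peMr ?sqr_ge0//; lra.
rewrite -[leRHS]ger0_norm ?sqr_ge0// -sqrtr_sqr ler_wsqrtr//.
have h : 0 <= r ^+ 2 - x ^+ 2 by nra.
have l0 := sqr_ge0 L.
apply: (@le_trans _ _ ((r ^+ 2 - x ^+ 2) * r ^+ 2)); first by rewrite ler_wpM2l//; lra.
by rewrite [leRHS]expr2 ler_wpM2r ?sqr_ge0//; have := sqr_ge0 x; lra.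
Qed.

Lemma ellI_integrable L r : mu.-integrable `]0, r[ (EFin \o (fun x => ellq L r x / (1 + x))).
Proof.
apply: (bounded_integrable_oo (K := r ^+ 2)); first exact: measurable_ellI.
by move=> x /(ellI_arg_bound L)/andP[h1 h2]; rewrite ger0_norm.
Qed.

Lemma ellI_restrict L r : 0 <= L -> L < r ->
  \int[mu]_(x in `]L, r[) (ellq L r x / (1 + x)) = ellI L r.
Proof.
move=> + Lr; rewrite le_eqVlt => /predU1P[<- //|L0].
rewrite /ellI (@Rintegral_split_oo _ _ 0 L r L0 Lr (measurable_ellI L r)).
- rewrite -[LHS]add0r; congr (_ + _); apply/esym.
  transitivity (\int[mu]_(x in `]0, L[) (0 : R)); last by rewrite Rintegral_cst_oo// mul0r.
  apply: eq_Rintegral => x; rewrite inE/= in_itv/= => /andP[x0 xL].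
  by rewrite /ellq ler0_sqrtr ?mul0r// mulr_ge0_le0//; nra.
- by move=> x /(ellI_arg_bound L)/andP[].
- exact: ellI_integrable.
Qed.

Lemma ellI_dist L L' r : 0 < r ->
  `|ellI L r - ellI L' r| <= Num.sqrt (r ^+ 2 * `|L ^+ 2 - L' ^+ 2|) * r.
Proof.
move=> r0; rewrite /ellI -RintegralB//; [|exact: ellI_integrable|exact: ellI_integrable].
have mh : measurable_fun setT (fun x : R => ellq L r x / (1 + x) - ellq L' r x / (1 + x)).
  by apply: measurable_funB; exact: measurable_ellI.
apply: (le_trans (le_normr_Rintegral _ _)) => //.
  apply: (bounded_integrable_oo (K := r ^+ 2)) => // x xr.
  have /andP[a1 a2] := ellI_arg_bound L xr; have /andP[b1 b2] := ellI_arg_bound L' xr.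
  by rewrite ler_norml; apply/andP; lra.
have h : forall x, 0 < x < r ->
    0 <= `|ellq L r x / (1 + x) - ellq L' r x / (1 + x)| <= Num.sqrt (r ^+ 2 * `|L ^+ 2 - L' ^+ 2|).
  move=> x /andP[x0 xr]; rewrite normr_ge0/=.
  have x1 : 0 < 1 + x by lra.
  rewrite -mulrBl normrM normfV (gtr0_norm x1) ler_pdivrMr//.
  apply: (le_trans (sqrt_dist_le _ _)).
  apply: (@le_trans _ _ (Num.sqrt (r ^+ 2 * `|L ^+ 2 - L' ^+ 2|))); last first.
    by rewrite ler_peMr ?sqrtr_ge0//; lra.
  rewrite ler_wsqrtr// -mulrBr normrM.
  have -> : x ^+ 2 - L ^+ 2 - (x ^+ 2 - L' ^+ 2) = - (L ^+ 2 - L' ^+ 2) by ring.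
  rewrite normrN.
  rewrite ler_wpM2r// ger0_norm; last by nra.
  by have := sqr_ge0 x; lra.
have := @Rintegral_oo_bound _ _ 0 r _ r0 (measurableT_comp (@normr_measurable R setT) mh) h.
by rewrite subr0 => /andP[].
Qed.

Lemma ellI_continuous r : 0 < r -> continuous (fun L => ellI L r).
Proof.
move=> r0 L.
have H : Num.sqrt (r ^+ 2 * `|t ^+ 2 - L ^+ 2|) * r @[t --> L] --> (0 : R).
  by apply: fcvg_eq; [lims|rewrite subrr normr0 mulr0 sqrtr0 mul0r].
apply/cvgrPdist_lt => e e0; near=> t.
rewrite distrC; apply: (le_lt_trans (ellI_dist _ _ r0)).
near: t; move/cvgrPdist_lt: H => /(_ _ e0); apply: filterS => t /=.
by rewrite sub0r normrN => /(le_lt_trans (ler_norm _)).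
Unshelve. all: by end_near. Qed.

(** For [L = 0] the integrand is [x * w x / (1 + x)], with an elementary primitive. The term
    [r - s * ln (r + s)] is minus the function whose root is [R_c]: at [r = R_c] the reformulated
    condition holds with [L = 0]. *)
Lemma ellI0 (r s : R) : 0 < s -> 0 < r -> r ^+ 2 = 1 + s ^+ 2 ->
  ellI 0 r = pi * (r ^+ 2 - 2) / 4 + r - s * ln (r + s).
Proof.
move=> s0 r0 rs.
pose w x : R := Num.sqrt (r ^+ 2 - x ^+ 2).
(* The arc sine of [x / r], in half-angle form. *)
pose a x : R := 2 * atan (x / (r + w x)).
pose N x : R := s ^+ 2 + 1 + x + s * w x.
have w0 x : 0 <= w x by exact: sqrtr_ge0.
have N0 (x : R) : 0 <= x -> 0 < N x.
  by move=> x0; rewrite /N; have := mulr_ge0 (ltW s0) (w0 x); have := sqr_ge0 s; lra.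
have wr : w r = 0 by rewrite /w subrr sqrtr0.
have w00 : w 0 = r by rewrite /w expr0n subr0 sqrtr_sqr gtr0_norm.
have rw x : r + w x != 0 by have h := w0 x; neq.
have w_cvg (t : R) : w x @[x --> t] --> w t by rewrite /w; lims.
have a_cvg (t : R) : a x @[x --> t] --> a t by rewrite /a; have h := w_cvg t; lims.
have w_arg x : 0 < x < r -> 0 < r ^+ 2 - x ^+ 2 by move=> /andP[? ?]; nra.
have w2 x : 0 < x < r -> w x ^+ 2 = r ^+ 2 - x ^+ 2 by move=> /w_arg/ltW; exact: sqr_sqrtr.
have w_gt x : 0 < x < r -> 0 < w x by move=> /w_arg; rewrite sqrtr_gt0.
have wd x : 0 < x < r -> is_derive x 1 w (- x / w x).
  move=> xr; have wn : w x != 0 by rewrite gt_eqF// w_gt.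
  by rewrite /w; isder; [exact: w_arg|rewrite -/(w x); field].
have ad x : 0 < x < r -> is_derive x 1 a (1 / w x).
  move=> xr; have wn : w x != 0 by rewrite gt_eqF// w_gt.
  have rn : r != 0 by rewrite gt_eqF.
  have e : r ^+ 2 = x ^+ 2 + w x ^+ 2 by rewrite w2//; ring.
  have e2 : r * 0 = x * 1 + w x * (- x / w x) by field.
  have dx : is_derive x 1 (fun t : R => t) 1 by exact: is_derive_id.
  have dr := isder_cst r x; have dw := wd x xr.
  refine (isder_eq (isder_angle dx dw dr e e2 r0 (w0 x)) _).
  transitivity ((x ^+ 2 + w x ^+ 2) / (w x * r ^+ 2)); first by field; rewrite wn rn.
  by rewrite -e; field; rewrite wn rn.
pose F x : R := (x * w x + r ^+ 2 * a x) / 2 - a x - w x + s * (ln (N x) - ln (1 + x)).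
have FC (t : R) : 0 <= t -> F x @[x --> t] --> F t.
  move=> t0; have h := w_cvg t; have h' := a_cvg t.
  have hN : N x @[x --> t] --> N t by rewrite /N; clear h'; lims.
  have n0 := N0 t t0; have t1 : 0 < 1 + t by lra.
  by rewrite /F; lims.
have S0 x : 0 < x < r -> ellq 0 r x = x * w x.
  move=> /[dup] xr /andP[x0 _]; rewrite /ellq (expr0n _ 2%N) subr0 mulrC sqrtrM ?sqr_ge0//.
  by rewrite sqrtr_sqr gtr0_norm.
have ->: ellI 0 r = F r - F 0.
  rewrite /ellI /Rintegral.
  have -> : (\int[mu]_(x in `]0%R, r[) (ellq 0 r x / (1 + x))%:E = (F r - F 0)%:E)%E => //.
  apply: (ge0_FTCoo (F := F)).
  - exact: r0.
  - by move=> x /(ellI_arg_bound 0)/andP[].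
  - move=> x /andP[x0 _]; have h := @ellq_cvg R 0 r x; apply: cont_at; [lims|by []].
    by neq.
  - move=> x xr; have dw := wd x xr; have da := ad x xr.
    have wn : w x != 0 by rewrite gt_eqF// w_gt.
    have x0 : 0 < x by case/andP: xr.
    have n0 := N0 x (ltW x0); have nn : N x != 0 by rewrite gt_eqF.
    have x1 : 0 < 1 + x by lra. have xn : 1 + x != 0 by rewrite gt_eqF.
    have dN : is_derive x 1 N (1 - s * x / w x) by rewrite /N; isder; rewrite /=; field.
    have lN : s * (1 - s * x / w x) / N x = s / (1 + x) - s ^+ 2 / ((1 + x) * w x).
      apply: (mulIf nn); apply: (mulIf wn); apply: (mulIf xn).
      transitivity (s * ((w x - s * x) * (1 + x))); first by field; rewrite wn nn.
      transitivity (s * (w x - s) * N x); last by field; rewrite wn xn.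
      apply/subr0_eq; transitivity (s ^+ 2 * ((r ^+ 2 - x ^+ 2) - w x ^+ 2 - (r ^+ 2 - (1 + s ^+ 2)))).
        by rewrite /N; ring.
      by rewrite w2// rs; ring.
    rewrite /has_der /F; isder => //=.
    rewrite S0//.
    transitivity ((w x ^+ 2 + r ^+ 2 - x ^+ 2) / (2 * w x) - 1 / w x + x / w x + (s * (1 - s * x / w x) / N x - s / (1 + x))).
      by field; rewrite nn wn xn.
    rewrite lN w2//.
    transitivity ((r ^+ 2 * (1 + x) - x ^+ 2 - x ^+ 3 - 1 + x ^+ 2 - s ^+ 2) / ((1 + x) * w x)).
      by field; rewrite wn xn.
    transitivity (x * w x ^+ 2 / ((1 + x) * w x)); last by field; rewrite wn xn.
    by rewrite w2// rs; congr (_ / _); ring.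
  - apply: cvg_at_right_filter; exact: FC.
  - apply: cvg_at_left_filter; apply: FC; exact: ltW.
have ar : a r = pi / 2.
  by rewrite /a wr addr0 divff ?gt_eqF// atan1; field.
have a0 : a 0 = 0 by rewrite /a mul0r atan0 mulr0.
have Nr : N r = r * (1 + r) by rewrite /N wr -[s ^+ 2 + 1]addrC -rs; ring.
have N00 : N 0 = r * (r + s) by rewrite /N w00 -[s ^+ 2 + 1]addrC -rs; ring.
have r1 : 0 < 1 + r by lra. have rs0 : 0 < r + s by lra.
rewrite /F ar a0 wr w00 Nr N00 !lnM ?posrE// addr0 ln1.
by field.
Qed.

End EllipticIntegral.

(** * The numbers [R_c] and [L(R)] *)

Section CriticalRadius.
Context {R : realType}.
Let mu := @lebesgue_measure R.
Implicit Types (f : R -> R) (x y a b d L r s : R).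

(* Bounds touching [1 / (1 + x)] at [x = 1]:
   [x * (7 - 3 * x^2) / 8 <= 1 / (1 + x) <= (3 / x + x) / 8]. *)
Lemma ellI_moments L r : 0 <= L -> L < r ->
  let A := pi * ((r ^+ 2 - L ^+ 2) / 2) ^+ 2 / 4 in
  [/\ 7 / 8 * A - 3 / 8 * ((r ^+ 2 + L ^+ 2) / 2 * A) <= ellI L r,
      1 <= L -> ellI L r <= A / 2 &
      0 < L -> ellI L r <= 3 / 8 * (pi / 4 * (r - L) ^+ 2) + A / 8].
Proof.
move=> L0 Lr A; rewrite -ellI_restrict//.
have mS := measurable_ellq L r.
have mI := measurable_itv `]L, r[.
have S0 x : 0 <= ellq L r x by exact: sqrtr_ge0.
have gi : mu.-integrable `]L, r[ (EFin \o (fun x => ellq L r x / (1 + x))).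
  apply: integrableS (ellI_integrable L r); [exact: measurable_itv|exact: measurable_itv|].
  by move=> x; rewrite /= !in_itv/= => /andP[? ?]; apply/andP; lra.
pose h1 x : R := ellq L r x * x; pose h3 x : R := ellq L r x * x ^+ 3.
have H1 : (\int[mu]_(x in `]L, r[) (h1 x)%:E = A%:E)%E by exact: ellq_int_x.
have H3 : (\int[mu]_(x in `]L, r[) (h3 x)%:E = ((r ^+ 2 + L ^+ 2) / 2 * A)%:E)%E by exact: ellq_int_x3.
have i1 : mu.-integrable `]L, r[ (EFin \o h1).
  apply: ge0_integrable_val H1 => //; first exact: measurable_funM.
  by move=> x; rewrite /= in_itv/= => /andP[Lx _]; rewrite mulr_ge0 ?S0//; lra.
have i3 : mu.-integrable `]L, r[ (EFin \o h3).
  apply: ge0_integrable_val H3 => //; first by apply: measurable_funM => //; exact: measurable_funX.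
  by move=> x; rewrite /= in_itv/= => /andP[Lx _]; rewrite mulr_ge0 ?S0// exprn_ge0//; lra.
have R1 : \int[mu]_(x in `]L, r[) h1 x = A by rewrite /Rintegral H1.
have R3 : \int[mu]_(x in `]L, r[) h3 x = (r ^+ 2 + L ^+ 2) / 2 * A by rewrite /Rintegral H3.
split.
- have k1 : mu.-integrable `]L, r[ (EFin \o (fun x => 7 / 8 * h1 x)).
    by apply: (integrableZl _ (7 / 8) i1); exact: measurable_itv.
  have k3 : mu.-integrable `]L, r[ (EFin \o (fun x => 3 / 8 * h3 x)).
    by apply: (integrableZl _ (3 / 8) i3); exact: measurable_itv.
  have kk : mu.-integrable `]L, r[ (EFin \o (fun x => 7 / 8 * h1 x - 3 / 8 * h3 x)).
    by apply: (integrableB _ k1 k3); exact: measurable_itv.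
  have <- : \int[mu]_(x in `]L, r[) (7 / 8 * h1 x - 3 / 8 * h3 x) =
      7 / 8 * A - 3 / 8 * ((r ^+ 2 + L ^+ 2) / 2 * A).
    rewrite RintegralB; [|exact: measurable_itv|exact: k1|exact: k3].
    rewrite RintegralZl; [|exact: measurable_itv|exact: i1].
    rewrite RintegralZl; [|exact: measurable_itv|exact: i3].
    by rewrite R1 R3.
  apply: le_Rintegral; [exact: measurable_itv|exact: kk|exact: gi|].
  move=> x; rewrite /= in_itv/= => /andP[Lx _].
  have x1 : 0 < 1 + x by lra.
  rewrite ler_pdivlMr// /h1 /h3.
  have -> : (7 / 8 * (ellq L r x * x) - 3 / 8 * (ellq L r x * x ^+ 3)) * (1 + x) =
     ellq L r x - ellq L r x * ((x - 1) ^+ 2 * (3 * x ^+ 2 + 9 * x + 8) / 8) by field.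
  rewrite gerBl mulr_ge0 ?S0// divr_ge0// mulr_ge0 ?sqr_ge0//.
  by have := sqr_ge0 x; lra.
(* Here [x >= 1], where [1 / (1 + x) <= x / 2]; the bound is meant for the end [L = 1]. *)
- move=> L1; have kk : mu.-integrable `]L, r[ (EFin \o (fun x => 2^-1 * h1 x)).
    by apply: (integrableZl _ 2^-1 i1); exact: measurable_itv.
  have -> : A / 2 = \int[mu]_(x in `]L, r[) (2^-1 * h1 x).
    by rewrite RintegralZl; [rewrite R1 mulrC|exact: measurable_itv|exact: i1].
  apply: le_Rintegral; [exact: measurable_itv|exact: gi|exact: kk|].
  move=> x; rewrite /= in_itv/= => /andP[Lx _].
  have x1 : 0 < 1 + x by lra.
  rewrite ler_pdivrMr// /h1.
  have -> : 2^-1 * (ellq L r x * x) * (1 + x) = ellq L r x * (x * (1 + x) / 2) by field.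
  have x2 : 0 < x - 1 by lra.
  have e : x * (1 + x) / 2 - 1 = ((x - 1) ^+ 2 + 3 * (x - 1)) / 2 by field.
  by rewrite ler_peMr ?S0// -subr_ge0 e divr_ge0// addr_ge0 ?sqr_ge0// mulr_ge0// ltW.
- move=> Lp; pose hV x : R := ellq L r x / x.
  have HV : (\int[mu]_(x in `]L, r[) (hV x)%:E = (pi / 4 * (r - L) ^+ 2)%:E)%E.
    exact: ellq_int_xV.
  have iV : mu.-integrable `]L, r[ (EFin \o hV).
    apply: ge0_integrable_val HV => //.
      by apply: measurable_funM => //; exact: measurable_inv.
    by move=> x; rewrite /= in_itv/= => /andP[Lx _]; rewrite divr_ge0 ?S0//; lra.
  have k1 : mu.-integrable `]L, r[ (EFin \o (fun x => 8^-1 * h1 x)).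
    by apply: (integrableZl _ 8^-1 i1); exact: measurable_itv.
  have kV : mu.-integrable `]L, r[ (EFin \o (fun x => 3 / 8 * hV x)).
    by apply: (integrableZl _ (3 / 8) iV); exact: measurable_itv.
  have kk : mu.-integrable `]L, r[ (EFin \o (fun x => 3 / 8 * hV x + 8^-1 * h1 x)).
    by apply: (integrableD _ kV k1); exact: measurable_itv.
  have -> : 3 / 8 * (pi / 4 * (r - L) ^+ 2) + A / 8 =
      \int[mu]_(x in `]L, r[) (3 / 8 * hV x + 8^-1 * h1 x).
    rewrite RintegralD; [|exact: measurable_itv|exact: kV|exact: k1].
    rewrite RintegralZl; [|exact: measurable_itv|exact: iV].
    rewrite RintegralZl; [|exact: measurable_itv|exact: i1].
    by rewrite R1 /Rintegral HV [A / 8]mulrC.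
  apply: le_Rintegral; [exact: measurable_itv|exact: gi|exact: kk|].
  move=> x; rewrite /= in_itv/= => /andP[Lx _].
  have x0 : 0 < x by lra. have x1 : 0 < 1 + x by lra.
  rewrite ler_pdivrMr// /h1 /hV.
  have -> : (3 / 8 * (ellq L r x / x) + 8^-1 * (ellq L r x * x)) * (1 + x) =
     ellq L r x + ellq L r x * ((x - 1) ^+ 2 * (x + 3) / (8 * x)).
    by field; rewrite gt_eqF.
  rewrite lerDl; apply: mulr_ge0; first exact: S0.
  by apply: divr_ge0; [apply: mulr_ge0; [exact: sqr_ge0|lra]|lra].
Qed.

Let s r : R := Num.sqrt (r ^+ 2 - 1).
Let g r : R := s r * ln (r + s r) - r.

Let s2 r : 1 <= r -> s r ^+ 2 = r ^+ 2 - 1.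
Proof. by move=> r1; rewrite sqr_sqrtr//; nra. Qed.
Let s0 r : 0 <= s r. Proof. exact: sqrtr_ge0. Qed.
Let s_gt0 r : 1 < r -> 0 < s r.
Proof. by move=> r1; rewrite sqrtr_gt0; nra. Qed.

(** For [r = cosh t] the quotient is [t - coth t], which increases. Since [s] is positive, [g] is
    therefore negative before [R_c] and positive after it. *)
Let g_mono r1 r2 : 1 < r1 -> r1 < r2 -> g r1 / s r1 < g r2 / s r2.
Proof.
move=> h1 h2; have p1 := s_gt0 h1; have h3 : 1 < r2 by lra.
have p2 := s_gt0 h3; have e1 := s2 (ltW h1); have e2 := s2 (ltW h3).
have E r : 1 < r -> g r / s r = ln (r + s r) - r / s r.
  by move=> /s_gt0 sr; rewrite /g; field; rewrite gt_eqF.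
rewrite !E//.
have ss : s r1 < s r2 by rewrite -(@ltr_pXn2r _ 2%N) ?nnegrE ?s0// e1 e2; nra.
have l : ln (r1 + s r1) < ln (r2 + s r2) by rewrite ltr_ln ?posrE; lra.
suff : r2 / s r2 < r1 / s r1 by lra.
rewrite ltr_pdivrMr// mulrAC ltr_pdivlMr//.
rewrite -(@ltr_pXn2r _ 2%N) ?nnegrE ?mulr_ge0 ?s0//; try lra.
rewrite !exprMn e1 e2.
by have : r1 ^+ 2 < r2 ^+ 2 by [nra|]; lra.
Qed.

(** From [3 + 2 * sqrt 2 = (1 + sqrt 2)^2] and [ln (1 + sqrt 2) >= 2 - sqrt 2] one gets
    [g 3 >= 8 * sqrt 2 - 11]. *)
Let g3 : 0 < g 3.
Proof.
pose t : R := Num.sqrt 2; have t2 : t ^+ 2 = 2 by rewrite sqr_sqrtr.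
have t0 : 0 < t by rewrite sqrtr_gt0.
have tu : t < 3 / 2 by rewrite -(@ltr_pXn2r _ 2%N) ?nnegrE ?(ltW t0)// t2; lra.
have tl : 7 / 5 < t by rewrite -(@ltr_pXn2r _ 2%N) ?nnegrE ?(ltW t0)// t2; lra.
have -> : g 3 = 2 * t * (2 * ln (1 + t)) - 3.
  have s3 : s 3 = 2 * t.
    rewrite /s (_ : 3 ^+ 2 - 1 = (2 * t) ^+ 2); last by rewrite exprMn t2; ring.
    by rewrite sqrtr_sqr gtr0_norm; lra.
  rewrite /g s3 (_ : 3 + 2 * t = (1 + t) ^+ 2); last by rewrite sqrrD t2; ring.
  by rewrite lnXn ?mulr_natl//; lra.
have : 1 - (1 + t)^-1 <= ln (1 + t) by apply: ln_ge_1subV; lra.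
have -> : (1 + t)^-1 = t - 1.
  apply: (mulIf (_ : 1 + t != 0)); first by neq.
  rewrite mulVf; last by neq.
  transitivity (t ^+ 2 - 1); first by rewrite t2; lra.
  by ring.
by move=> h; nra.
Qed.

Let Rc_ex : exists r : R, 1 < r /\ g r = 0.
Proof.
have g1 : g 1 < 0 by rewrite /g /s expr1n subrr sqrtr0; lra.
have le13 : 1 <= 3 :> R by lra.
have : {within `[1, 3], continuous g}.
  apply: continuous_in_subspaceT => r; rewrite inE/= in_itv/= => /andP[r1 _].
  have h : s t @[t --> r] --> s r by rewrite /s; lims.
  have h2 := s0 r.
  by apply: cont_at; [rewrite /g; lims; lra|by []].
move=> cg.
have h : Num.min (g 1) (g 3) <= 0 <= Num.max (g 1) (g 3).
  by rewrite ge_min le_max (ltW g1) (ltW g3) orbT.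
have [c] := IVT le13 cg h.
rewrite in_itv/= => /andP[c1 _] gc; exists c; split => //.
by rewrite lt_neqAle c1 andbT; apply/eqP => e; move: g1; rewrite e gc ltxx.
Qed.

Lemma Rc_spec : 1 < Rc R /\ g (Rc R) = 0.
Proof. exact: (getPex Rc_ex). Qed.

Let g_lt0 r : 1 < r -> r < Rc R -> g r < 0.
Proof.
move=> r1 rR; have [_ gR] := Rc_spec; have := g_mono r1 rR.
by rewrite gR mul0r ltr_pdivrMr ?mul0r// s_gt0.
Qed.

(** Provides [R^2 - 1 < 8] for type III. *)
Lemma Rc_le3 : Rc R <= 3.
Proof.
have [_ gR] := Rc_spec; rewrite leNgt; apply/negP => R3.
have h1 : 1 < 3 :> R by lra.
have := g_mono h1 R3; rewrite gR mul0r ltr_pdivrMr ?mul0r ?s_gt0//.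
by move=> /(lt_trans g3); rewrite ltxx.
Qed.

(** At [R_c] one has [ln (R_c + t) = R_c / t] with [t = sqrt (R_c^2 - 1)]. If [t < 5 / 4], then
    [R_c / t >= 32 / 25], a value just below [sqrt 41 / 5], while [R_c + t < 21 / 13 + 5 / 4 < (1 +
    32 / 75)^3 <= exp (32 / 25)]: a contradiction. *)
Lemma sqrt_ge_Rc r : Rc R <= r -> 5 / 4 <= Num.sqrt (r ^+ 2 - 1).
Proof.
have [R1 gR] := Rc_spec => Rr; apply: (@le_trans _ _ (s (Rc R))); last first.
  by rewrite ler_wsqrtr// lerB// ler_pXn2r ?nnegrE//; lra.
have e := s2 (ltW R1); have p := s_gt0 R1; set t := s (Rc R) in e p *.
rewrite leNgt; apply/negP => t1.
have Ru : Rc R < 21 / 13.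
  rewrite ltNge; apply/negP => h; have : (21 / 13) ^+ 2 <= Rc R ^+ 2 by nra.
  by nra.
have Rl : 32 / 25 * t <= Rc R.
  by rewrite leNgt; apply/negP => h; nra.
have e1 : Rc R + t < expR (32 / 25).
  apply: (@lt_le_trans _ _ ((1 + 32 / 75) ^+ 3)); first by lra.
  have -> : expR (32 / 25) = expR (32 / 75) ^+ 3 :> R by rewrite -expRM_natl; congr expR; lra.
  by rewrite ler_pXn2r ?nnegrE ?expR_ge0//; exact: expR_ge1Dx.
have l : ln (Rc R + t) < 32 / 25.
  by rewrite -[ltRHS]expRK ltr_ln ?posrE ?expR_gt0//; lra.
by move: gR; rewrite /g -/t; nra.
Qed.

(** Intermediate values for [Psi], which is [Phi / pi] for [0 <= L < 1] and is continuous up to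
    [L = 1]. Its value at 0 is [g r], negative because [r < R_c]; at 1 it is at least
    [pi * p * (8 - p) / 32] with [p = r^2 - 1], positive because [R_c <= 3]. *)
Lemma LofR_spec r : 1 < r -> r < Rc R ->
  0 < LofR r < 1 /\ pi * (r ^+ 2 + LofR r ^+ 2 - 2) / 4 = ellI (LofR r) r.
Proof.
move=> r1 rR; have r3 : r < 3 := lt_le_trans rR Rc_le3; have r0 : 0 < r by lra.
have pi0 := @pi_gt0 R.
pose Psi L : R := pi * (r ^+ 2 + L ^+ 2 - 2) / 4 - ellI L r.
have P L : 0 <= L -> L < 1 -> Phi L r = pi * Psi L.
  by move=> L0 L1; rewrite Phi_eq// ellI_restrict//; lra.
have Psi0 : Psi 0 < 0.
  have e : r ^+ 2 = 1 + s r ^+ 2 by rewrite s2; [ring|lra].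
  have h := g_lt0 r1 rR; rewrite /Psi (ellI0 (s_gt0 r1) r0 e) expr0n/=.
  by move: h; rewrite /g; lra.
have Psi1 : 0 < Psi 1.
  have [_ h _] := ellI_moments ler01 r1; have {h} := h (lexx _); rewrite /Psi expr1n.
  have p0 : 0 < r ^+ 2 - 1 by nra.
  have p8 : r ^+ 2 - 1 < 8 by nra.
  move=> h; rewrite subr_gt0 (le_lt_trans h)//.
  have e : r ^+ 2 + 1 - 2 = r ^+ 2 - 1 by ring.
  rewrite e; move: (r ^+ 2 - 1) p0 p8 => p p0 p8; rewrite -subr_gt0.
  have -> : pi * p / 4 - pi * (p / 2) ^+ 2 / 4 / 2 = pi * (p * (8 - p)) / 32 :> R by field.
  by rewrite divr_gt0// mulr_gt0// mulr_gt0// subr_gt0.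
have cPsi : {within `[0, 1], continuous Psi}.
  apply: continuous_in_subspaceT => L _.
  have h : ellI t r @[t --> L] --> ellI L r by exact: ellI_continuous.
  by apply: cont_at; [rewrite /Psi; lims|by []].
have h0 : Num.min (Psi 0) (Psi 1) <= 0 <= Num.max (Psi 0) (Psi 1).
  by rewrite ge_min le_max (ltW Psi0) (ltW Psi1) orbT.
have ex : exists l : R, 0 < l < 1 /\ Phi l r = 0.
  have [c] := IVT ler01 cPsi h0; rewrite in_itv/= => /andP[c0 c1] Pc.
  have c0' : 0 < c by rewrite lt_neqAle c0 andbT; apply/eqP => e; move: Pc; rewrite -e => E; move: Psi0; rewrite E ltxx.
  have c1' : c < 1 by rewrite lt_neqAle c1 andbT; apply/eqP => e; move: Pc; rewrite e => E; move: Psi1; rewrite E ltxx.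
  by exists c; rewrite c0' c1' P// Pc mulr0.
have [/andP[l0 l1] Pl] : 0 < LofR r < 1 /\ Phi (LofR r) r = 0 by exact: (getPex ex).
rewrite l0 l1; split => //; apply/subr0_eq; rewrite -[LHS]/(Psi (LofR r)).
by move/eqP: Pl; rewrite P ?(ltW l0)// mulf_eq0 (gt_eqF pi0) => /eqP.
Qed.

End CriticalRadius.

(** * The inequality *)

Section FinalInequality.
Context {R : realType}.
Let mu := @lebesgue_measure R.
Implicit Types (x y a b d L r s : R).

(** [x - atan x] is the integral over []0, x[] of the nonnegative function [1 - 1 / (1 + t^2)]. *)
Lemma atan_le x : 0 < x -> atan x <= x.
Proof.
move=> x0; rewrite -subr_ge0 -[x - _]subr0 -lee_fin.
have e : (\int[mu]_(t in `]0%R, x[) (1 - (1 + t ^+ 2)^-1)%:E = (x - atan x - 0)%:E)%E.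
  have tn t : 1 + t ^+ 2 != 0 :> R by have h := sqr_ge0 t; neq.
  apply: (ge0_FTCoo (F := fun t => t - atan t)).
  - exact: x0.
  - move=> t _; rewrite subr_ge0 invf_le1; first by have := sqr_ge0 t; lra.
    by have := sqr_ge0 t; lra.
  - by move=> t _; apply: cont_at; [lims|by []].
  - by move=> t _; rewrite /has_der; isder; rewrite /= mulr1.
  - by apply: cvg_at_right_filter; apply: fcvg_eq; [lims|rewrite atan0 subrr].
  - by apply: cvg_at_left_filter; lims.
rewrite -e; apply: integral_ge0 => t _; rewrite lee_fin subr_ge0 invf_le1.
  by have := sqr_ge0 t; lra.
by have := sqr_ge0 t; lra.
Qed.

(* Machin-like: [pi / 4 = atan (1 / 2) + atan (1 / 3)]. *)
Lemma pi_le103 : pi <= 10 / 3 :> R.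
Proof.
pose a : R := atan (1 / 2); pose b : R := atan (1 / 3).
have a1 : a <= 1 / 2 by apply: atan_le; lra.
have b1 : b <= 1 / 3 by apply: atan_le; lra.
have ca : cos a != 0 by rewrite gt_eqF// cos_gt0_pihalf// atan_gtNpi2 atan_ltpi2.
have cb : cos b != 0 by rewrite gt_eqF// cos_gt0_pihalf// atan_gtNpi2 atan_ltpi2.
have a0 : 0 <= a by rewrite -atan0; apply: le_atan; lra.
have b0 : 0 <= b by rewrite -atan0; apply: le_atan; lra.
have t : tan (a + b) = 1 by rewrite tanD// !atanK; field.
have : atan (tan (a + b)) = a + b.
  by have h := @pihalf_ge1 R; apply: tanK; rewrite in_itv/=; apply/andP; lra.
by rewrite t atan1; lra.
Qed.

(* To be used with [e = sqrt d], [t = q / e] and [u = sqrt (p * q) / e]. *)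
Lemma ratio_ineq (e t u : R) : 0 < e -> 0 < t -> 1 <= u -> u ^+ 2 = t ^+ 2 + e * t ->
  (u ^+ 2 + e ^+ 2 / 4) * (8 - 3 * e ^+ 2) <= 16 ->
  u - 1 < 3 / 10 * (t + e * (u ^+ 2 - 1)).
Proof.
move=> e0 t0 u1 ue X.
(* For [e >= 5 / 3] the term [3 / 10 * e * (u^2 - 1)] is by itself at least
   [(u - 1) * (u + 1) / 2 >= u - 1]. *)
have [e1|e1] := leP (5 / 3) e.
  have : 3 / 10 * (5 / 3) * (u ^+ 2 - 1) <= 3 / 10 * e * (u ^+ 2 - 1).
    by rewrite ler_wpM2r//; [nra|lra].
  by nra.
(* [u^2 = (t + e / 2)^2 - e^2 / 4]. Replacing [t] by its lower bound [u - e / 2] leaves a quadratic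
   in [u]. *)
have vu : u <= t + e / 2 by nra.
suff : 0 < 3 / 10 * e * u ^+ 2 - 7 / 10 * u + 1 - 9 / 20 * e by nra.
(* The discriminant of this quadratic is [27 / 50 * (e - 5 / 9) * (e - 5 / 3) - 1 / 100], negative
   between [5 / 9] and [5 / 3]. *)
have [e2|e2] := leP (5 / 9) e.
  have h : 0 < 6 / 5 * e - 27 / 50 * e ^+ 2 - 49 / 100.
    suff : (e - 5 / 9) * (e - 5 / 3) <= 0 by nra.
    by rewrite mulr_ge0_le0//; lra.
  have := sqr_ge0 (3 / 5 * e * u - 7 / 10).
  by nra.
(* At [e = 0] the last hypothesis says [u^2 <= 2]. The correction [3 / 5 * e^2] is large enough for
   small [e]: [(2 + 17 / 20 * e^2) * (8 - 3 * e^2) = 16 + 4 / 5 * e^2 - 51 / 20 * e^4] exceeds 16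
   when [0 < e^2 < 25 / 81]. The quadratic does not increase up to [U], and at [e = 0] its value
   there is [1 - 7 / 10 * sqrt 2 > 0]. *)
pose U := Num.sqrt (2 + 3 / 5 * e ^+ 2).
have U2 : U ^+ 2 = 2 + 3 / 5 * e ^+ 2 by rewrite sqr_sqrtr//; nra.
have U0 : 0 <= U := sqrtr_ge0 _.
have d1 : e ^+ 2 < 25 / 81 by nra.
have u2 : u ^+ 2 <= U ^+ 2.
  rewrite U2 leNgt; apply/negP => h.
  have : (2 + 17 / 20 * e ^+ 2) * (8 - 3 * e ^+ 2) < 16.
    by apply: lt_le_trans X; rewrite ltr_pM2r; nra.
  by nra.
have uU : u <= U by rewrite -(@ler_pXn2r _ 2%N) ?nnegrE//; lra.
have U32 : U < 3 / 2 by nra.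
have : 3 / 10 * e * (U ^+ 2) - 7 / 10 * U <= 3 / 10 * e * u ^+ 2 - 7 / 10 * u.
  rewrite -subr_ge0.
  have -> : 3 / 10 * e * u ^+ 2 - 7 / 10 * u - (3 / 10 * e * U ^+ 2 - 7 / 10 * U) =
     (U - u) * (7 / 10 - 3 / 10 * (e * (U + u))) by field.
  by rewrite mulr_ge0 ?subr_ge0//; nra.
suff : 0 < 3 / 10 * e * (U ^+ 2) - 7 / 10 * U + 1 - 9 / 20 * e by lra.
rewrite U2.
have : 7 / 10 * U < 1 + 3 / 20 * e by nra.
by nra.
Qed.

(* [rho] stands for [R * L], and [D] for the mass of [[-1, 1]]. *)
Lemma mass_ineq (p q d P D : R) : 0 < p -> 0 < q -> d = p - q -> p < 8 ->
  0 <= P -> P ^+ 2 = p * q ->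
  ((p + q) / 2) ^+ 2 * (8 - 3 * d) <= 16 * d ->
  (forall rho : R, 0 <= rho -> rho ^+ 2 = 1 + d - p * q ->
     d <= 3 / 8 * (2 + d - 2 * rho) + ((p + q) / 2) ^+ 2 / 8) ->
  (0 < d -> 0 < D) -> (p * q <= 1 + d) -> 
  (d <= p * q -> D <= pi * P - (q + p * q - d)) ->
  [/\ 0 < d, 0 < D & D ^+ 2 < pi ^+ 2 * d].
Proof.
move=> p0 q0 dE p8 P0 P2 X1 X3 D0 pq1 hD.
have pq0 : 0 < p * q by rewrite mulr_gt0.
have d0 : 0 < d.
  rewrite ltNge; apply/negP => dn.
  have : 0 < ((p + q) / 2) ^+ 2 by rewrite exprn_gt0//; lra.
  by nra.
have {}D0 := D0 d0; split=> //.
(* In other words [R * L <= 1]. For [rho = 1] the hypothesis [X3] reads [d <= d / 2 + d^2 / 32],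
   impossible when [0 < d < 8]; a larger [rho] only decreases its right side. *)
have pq : d <= p * q.
  pose rho := Num.sqrt (1 + d - p * q).
  have r2 : rho ^+ 2 = 1 + d - p * q by rewrite sqr_sqrtr//; lra.
  have r0 : 0 <= rho by exact: sqrtr_ge0.
  have h := X3 rho r0 r2.
  have rho1 : rho <= 1.
    rewrite leNgt; apply/negP => r1.
    have m2 : ((p + q) / 2) ^+ 2 = d ^+ 2 / 4 + (1 + d - rho ^+ 2) by rewrite r2 dE; field.
    rewrite m2 in h.
    have d8 : d < 8 by lra.
    by nra.
  by have : rho ^+ 2 <= 1 by [nra|]; lra.
have pi0 := @pi_gt0 R; have pi1 := pi_le103.
pose e := Num.sqrt d; have e2 : e ^+ 2 = d by rewrite sqr_sqrtr// ltW.
have e0 : 0 < e by rewrite sqrtr_gt0.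
have en : e != 0 by rewrite gt_eqF.
(* As [pi * 3 / 10 <= 1], this gives [pi * (P - e) < q + p * q - d], which with [hD] is
   [D < pi * e]. *)
have key : P - e < 3 / 10 * (q + p * q - d).
  have t0 : 0 < q / e by rewrite divr_gt0.
  have u1 : 1 <= P / e.
    by rewrite ler_pdivlMr// mul1r -(@ler_pXn2r _ 2%N) ?nnegrE ?(ltW e0)// P2 e2.
  have ue : (P / e) ^+ 2 = (q / e) ^+ 2 + e * (q / e).
    rewrite !exprMn P2 exprVn e2 (_ : p = q + d); last by rewrite dE; ring.
    by rewrite -e2; field.
  have X : ((P / e) ^+ 2 + e ^+ 2 / 4) * (8 - 3 * e ^+ 2) <= 16.
    have -> : (P / e) ^+ 2 + e ^+ 2 / 4 = ((p + q) / 2) ^+ 2 / d.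
      rewrite exprMn exprVn P2 e2 (_ : p = q + d); last by rewrite dE; ring.
      by field; rewrite gt_eqF.
    by rewrite e2 mulrAC ler_pdivrMr.
  have := ratio_ineq e0 t0 u1 ue X.
  rewrite -(ltr_pM2l e0).
  have -> : e * (P / e - 1) = P - e by field.
  have -> : e * (3 / 10 * (q / e + e * ((P / e) ^+ 2 - 1))) = 3 / 10 * (q + P ^+ 2 - e ^+ 2) by field.
  by rewrite P2 e2.
have De : D < pi * e.
  have h := hD pq; have Y0 : 0 <= q + p * q - d by lra.
  have h1 : pi * (P - e) < pi * (3 / 10 * (q + p * q - d)) by rewrite ltr_pM2l.
  have h2 : pi * (3 / 10 * (q + p * q - d)) <= 10 / 3 * (3 / 10 * (q + p * q - d)).
    by rewrite ler_wpM2r//; lra.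
  by lra.
rewrite -e2 -exprMn ltr_pXn2r ?nnegrE//; first exact: ltW.
by rewrite mulr_ge0// ltW.
Qed.

End FinalInequality.

(** * The three types *)

Section Assembly.
Context {R : realType}.
Let mu := @lebesgue_measure R.
Implicit Types (f : R -> R) (x y a b d L r s l K p : R) (m : smeas R).

(** The mass [a] and the tail coefficient [kappa] refer to the unscaled measure, the position [p] of
    the atoms to the scaled one. *)
Lemma Ht_scale f a p kappa l m : measurable_fun setT f -> (forall x, f (- x) = f x) ->
  tail_bounded f kappa -> \int[mu]_x f x = - (2 * a) -> 0 < l -> dens m = f ->
  (forall x, \sum_(q <- atoms (scale l m)) q.2 * (- ln `|x - q.1|) =
     - (l * a * (ln `|x - p| + ln `|x + p|))) ->
  Ht (scale l m) = pi ^+ 2 * (kappa * l ^+ 2).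
Proof.
move=> mf fe ft fa l0 df hs; have ln0 : l != 0 by rewrite gt_eqF.
pose g x : R := f (x / l).
have mg : measurable_fun setT g by apply: (measurableT_comp mf); exact: measurable_funM.
have ge x : g (- x) = g x by rewrite /g mulNr fe.
have gt : tail_bounded g (kappa * l ^+ 2) by exact: tail_scale.
have [C1 [C2 [g1 g2]]] := tail_rden gt.
have ga : \int[mu]_x g x = - (2 * (l * a)).
  have fi := tail_integrable mf ft.
  have lV : l^-1 != 0 by rewrite invr_eq0.
  transitivity (\int[mu]_x f (l^-1 * x)); first by apply: eq_Rintegral => x _; rewrite /g mulrC.
  rewrite (Rintegral_dilate lV fi) fa gtr0_norm ?invr_gt0// invrK; ring.
by apply: (Ht_even mg ge g1 g2 ga _ hs); rewrite /= df.
Qed.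

Lemma mass_scale f l : mu.-integrable setT (EFin \o f) -> (forall x, f (- x) = f x) -> 0 < l ->
  \int[mu]_(x in `[- l, l]) f (x / l) = l * (2 * \int[mu]_(x in `]0, 1[) f x).
Proof.
move=> fi fe l0; have lV : l^-1 != 0 by rewrite invr_eq0 gt_eqF.
pose h : R -> R := f \_ `[-1, 1].
have hi : mu.-integrable setT (EFin \o h).
  rewrite /h -restrict_EFin; apply/integrable_restrict => //=; rewrite setTI.
  by apply: integrableS fi => //; exact: measurable_itv.
have he x : h (- x) = h x.
  rewrite /h !patchE !mem_setE fe; congr (if _ then _ else _).
  by rewrite !in_itv/=; apply/andP/andP => -[? ?]; split; lra.
transitivity (\int[mu]_x h (l^-1 * x)).
  rewrite Rintegral_mkcond; apply: eq_Rintegral => x _.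
  rewrite /h !patchE !mem_setE !in_itv/= [l^-1 * x]mulrC.
  by rewrite ler_pdivlMr// ler_pdivrMr// mulN1r mul1r.
rewrite (Rintegral_dilate lV hi) gtr0_norm ?invr_gt0// invrK; congr (_ * _).
rewrite (even_Rintegral ltr01 hi he).
have -> : \int[mu]_(x in `]0, 1[) h x = \int[mu]_(x in `]0, 1[) f x.
  apply: eq_Rintegral => x; rewrite inE/= in_itv/= => /andP[x0 x1].
  by rewrite /h patchE mem_setE in_itv/= ifT//; apply/andP; lra.
have -> : \int[mu]_(x in `]1, +oo[) h x = 0.
  transitivity (\int[mu]_(x in `]1, +oo[) (0 : R)).
    apply: eq_Rintegral => x; rewrite inE/= in_itv/= andbT => x1.
    by rewrite /h patchE mem_setE in_itv/= ifF//; apply/negP => /andP[]; lra.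
  by rewrite /Rintegral integral0.
by rewrite addr0.
Qed.

(** For [|x| < 1 / pi] the radicand is negative, where [Num.sqrt] is 0, so both branches agree with
    the single formula. The same holds for the other two types. *)
Lemma dens_muI : dens (muI R) = densI pi^-1.
Proof.
apply/funext => x; rewrite /= /densI; congr (_ + _); rewrite exprVn.
have pi0 : 0 < (pi : R)^-1 by rewrite invr_gt0 pi_gt0.
case: ifPn => //; rewrite -ltNge => h.
rewrite ler0_sqrtr ?mul0r// subr_le0 -exprVn -(real_normK (num_real x)).
by rewrite ler_pXn2r ?nnegrE// ltW.
Qed.

Lemma dens_muII r : dens (muII r) = densAB 0 (r ^+ 2).
Proof.
apply/funext => x; rewrite /= /densAB subr0; congr (_ + _).
case: ifPn => //; rewrite -ltNge => h.
rewrite ler0_sqrtr ?mul0r// mulr_le0_ge0 ?sqr_ge0// subr_le0.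
have x0 := normr_ge0 x.
by rewrite -(real_normK (num_real x)) ler_pXn2r ?nnegrE//; lra.
Qed.

Lemma dens_muIII L r : 0 < L -> dens (muIII L r) = densAB (L ^+ 2) (r ^+ 2).
Proof.
move=> L0; apply/funext => x; rewrite /= /densAB; congr (_ + _).
case: ifPn => //; rewrite negb_or -!ltNge => /andP[h1 h2].
rewrite ler0_sqrtr ?mul0r// -(real_normK (num_real x)).
have x0 := normr_ge0 x.
by rewrite mulr_le0_ge0// ?subr_le0 ?subr_ge0 ler_pXn2r ?nnegrE//; lra.
Qed.

Lemma typeI l : 0 < l -> Gt (AI l) = 2^-1.
Proof.
move=> l0; rewrite /Gt /=; have pi0 := @pi_gt0 R; have pin : (pi : R) != 0 by rewrite gt_eqF.
have ai : 0 < (pi : R)^-1 by rewrite invr_gt0.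
(* To fit [Ht_scale], the atom of mass 1 at 0 counts as two atoms of mass [1 / 2] at [p = 0]. *)
have e : \int[mu]_x densI pi^-1 x = - (2 * 2^-1).
  by rewrite densI_neutral// divff// divff.
rewrite (@Ht_scale _ 2^-1 0 _ l (muI R) (measurable_densI _) (densIN _) (densI_tail ai) e l0 dens_muI).
  by move: (pi : R) pin => w wn; field; rewrite wn lt0r_neq0.
by move=> x; rewrite /= big_cons big_nil /= mulr0 subr0 !addr0 mulr1; field.
Qed.

Lemma sum_atoms2 l K x : \sum_(q <- [:: (l * 1, l * K); (l * -1, l * K)]) q.2 * (- ln `|x - q.1|) =
  - (l * K * (ln `|x - l| + ln `|x + l|)).
Proof. by rewrite !big_cons big_nil /= mulr1 mulrN1 opprK; ring. Qed.

Lemma mass_atoms2 l K : 0 < l ->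
  \sum_(p <- [:: (l * 1, l * K); (l * -1, l * K)] | (- l <= p.1) && (p.1 <= l)) p.2 = l * (2 * K).
Proof.
move=> l0; rewrite !big_cons big_nil /= mulr1 mulrN1 !lexx /=.
have -> : - l <= l by lra.
by rewrite /=; ring.
Qed.

(** The density is [-1] on []-1, 1[], so [D = pi * s - 2], while [d = s^2 - 1]. Then
    [D^2 < pi^2 * d] means [4 * pi * s > pi^2 + 4], and for [s >= 5 / 4] this follows from
    [(pi - 1) * (pi - 4) < 0]. *)
Lemma typeII l r : 0 < l -> Rc R <= r -> 2^-1 < Gt (AII l r).
Proof.
move=> l0 Rr; have s54 := sqrt_ge_Rc Rr; have [R1 _] := @Rc_spec R.
have r1 : 1 < r by lra.
have pi2 := @pi_ge2 R; have pi4 : pi < 4 :> R by have := @pihalf_lt2 R; lra.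
set s := Num.sqrt (r ^+ 2 - 1) in s54.
have s2 : s ^+ 2 = r ^+ 2 - 1 by rewrite sqr_sqrtr//; nra.
have B1 : 1 < r ^+ 2 by nra.
have mf := @measurable_densAB R 0 (r ^+ 2).
have ft := densAB_tail (lexx 0) ltr01 B1.
have fi := tail_integrable mf ft.
have e : \int[mu]_x densAB 0 (r ^+ 2) x = - (2 * (pi * s / 2)).
  by rewrite densAB0_neutral// -/s; field.
have HH : Ht (measure_of (AII l r)) = pi ^+ 2 * ((0 + r ^+ 2 - 2) / 2 * l ^+ 2).
  rewrite (@Ht_scale _ (pi * s / 2) l _ l (muII r) mf (densABN _ _) ft e l0 (dens_muII r))//.
  by move=> x; exact: sum_atoms2.
have DD : Dt (AII l r) = l * (pi * s - 2).
  rewrite /Dt /mass_interval (_ : dens _ = fun x => densAB 0 (r ^+ 2) (x / l)); last by rewrite -dens_muII.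
  rewrite (mass_scale fi (densABN _ _) l0) [X in _ + X](mass_atoms2 _ l0) -/s.
  have -> : \int[mu]_(x in `]0, 1[) densAB 0 (r ^+ 2) x = - 1.
    transitivity (\int[mu]_(x in `]0, 1[) (- 1 : R)); last by rewrite Rintegral_cst_oo// subr0 mulr1.
    apply: eq_Rintegral => x; rewrite inE/= in_itv/= => /andP[x0 x1].
    by rewrite /densAB ler0_sqrtr ?mul0r ?addr0// mulr_le0_ge0 ?subr0 ?sqr_ge0// subr_le0; nra.
  by rewrite /=; field.
rewrite /Gt HH DD.
have D0 : 0 < pi * s - 2 by nra.
rewrite ltr_pdivlMr ?exprn_gt0 ?mulr_gt0//.
have -> : 0 + r ^+ 2 - 2 = s ^+ 2 - 1 by rewrite s2; ring.
rewrite -subr_gt0.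
have -> : pi ^+ 2 * ((s ^+ 2 - 1) / 2 * l ^+ 2) - 2^-1 * (l * (pi * s - 2)) ^+ 2 =
   l ^+ 2 * ((4 * (pi * s) - pi ^+ 2 - 4) / 2) :> R by field.
rewrite mulr_gt0 ?exprn_gt0// divr_gt0//.
have : pi * (5 / 4) <= pi * s by rewrite ler_wpM2l//; lra.
by nra.
Qed.

Lemma typeIII l r : 0 < l -> 1 < r -> r < Rc R -> 2^-1 < Gt (AIII l r).
Proof.
move=> l0 r1 rR; have [/andP[L0 L1] Psi] := LofR_spec r1 rR.
have R3 := @Rc_le3 R; have pi0 := @pi_gt0 R.
set L := LofR r in L0 L1 Psi; pose A := L ^+ 2; pose B := r ^+ 2.
have A0 : 0 < A by rewrite exprn_gt0.
have A1 : A < 1 by rewrite /A; nra.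
have B1 : 1 < B by rewrite /B; nra.
have LR : L < r by lra.
pose f := densAB A B; have mf := @measurable_densAB R A B.
have ft := densAB_tail (ltW A0) A1 B1.
have fi := tail_integrable mf ft.
pose P := Num.sqrt ((B - 1) * (1 - A)).
have P2 : P ^+ 2 = (B - 1) * (1 - A) by rewrite sqr_sqrtr// mulr_ge0//; lra.
have P0 : 0 <= P by exact: sqrtr_ge0.
have e : \int[mu]_x f x = - (2 * (pi * P / 2)).
  by rewrite /f densAB_neutral// -/P; field.
have HH : Ht (measure_of (AIII l r)) = pi ^+ 2 * ((A + B - 2) / 2 * l ^+ 2).
  rewrite (@Ht_scale _ (pi * P / 2) l _ l (muIII L r) mf (densABN _ _) ft e l0 (dens_muIII _ L0))//.
  by move=> x; exact: sum_atoms2.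
pose I1 := \int[mu]_(x in `]0, 1[) f x; pose I2 := \int[mu]_(x in `]1, +oo[) f x.
pose D := pi * P + 2 * I1.
have DD : Dt (AIII l r) = l * D.
  rewrite /Dt /mass_interval (_ : dens _ = fun x => f (x / l)); last by rewrite /f -dens_muIII.
  rewrite (mass_scale fi (densABN _ _) l0) [X in _ + X](mass_atoms2 _ l0) -/P -/I1.
  by rewrite /D /=; field.
(* Neutrality: the mass of [[-1, 1]] is the opposite of the mass outside. *)
have I12 : D = - (2 * I2).
  by move: e; rewrite (even_Rintegral ltr01 fi (densABN _ _)) -/I1 -/I2 /D; lra.
(* For [d > 0] the radicand is at most [(x^2 - 1)^2] beyond 1, so the density is nonpositive there,
   and it is [-1] on []1, r[]. Hence [D >= 2 * (r - 1)]. *)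
have Dpos : 0 < A + B - 2 -> 0 < D.
  move=> d0; have f0 x : 1 < x -> 0 <= - f x.
    move=> x1; have u0 : 0 < x ^+ 2 - 1 by nra.
    rewrite /f /densAB opprD opprK subr_ge0 ler_pdivrMr ?normr_gt0 ?gt_eqF// mul1r.
    rewrite -sqrtr_sqr ler_wsqrtr//.
    by have := mulr_gt0 d0 u0; nra.
  have fl x : 1 < x < r -> - f x = 1.
    move=> /andP[x1 xr]; rewrite /f /densAB ler0_sqrtr ?mul0r ?addr0 ?opprK//.
    by rewrite mulr_le0_ge0// /A /B; nra.
  have i1 : mu.-integrable `]1, +oo[ (EFin \o f).
    by apply: integrableS fi => //; exact: measurable_itv.
  have i2 : mu.-integrable `]1, +oo[ (EFin \o (fun x => -1 * f x)).
    by apply: (integrableZl _ (-1) i1); exact: measurable_itv.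
  have : ((r - 1)%:E <= \int[mu]_(x in `]1%R, +oo[) (-1 * f x)%:E)%E.
    have <- : (\int[mu]_(x in `]1%R, r[) (-1 * f x)%:E = (r - 1)%:E)%E.
      transitivity (\int[mu]_(x in `]1%R, r[) (1%:E : \bar R))%E.
        by apply: eq_integral => x; rewrite inE/= in_itv/= => /fl fx; rewrite mulN1r fx.
      apply: (@ge0_FTCoo R (fun=> 1) id); [exact: r1| | | | |].
      - by move=> x _; exact: ler01.
      - by move=> x _; exact: cvg_cst.
      - by move=> x _; exact: is_derive_id.
      - by apply: cvg_at_right_filter; exact: cvg_id.
      - by apply: cvg_at_left_filter; exact: cvg_id.
    apply: ge0_subset_integral; [exact: measurable_itv|exact: measurable_itv| | |].
    - by apply/measurable_EFinP; apply: measurable_funTS; exact: measurable_funM.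
    - by move=> x; rewrite /= in_itv/= andbT => /f0; rewrite lee_fin mulN1r.
    - by move=> x; rewrite /= !in_itv/= => /andP[-> _].
  have j2 : (\int[mu]_(x in `]1%R, +oo[) (-1 * f x)%:E \is a fin_num)%E.
    by apply: integrable_fin_num i2; exact: measurable_itv.
  rewrite -(fineK j2) lee_fin => h.
  have e2 : fine (\int[mu]_(x in `]1%R, +oo[) (-1 * f x)%:E)%E = - I2.
    transitivity (\int[mu]_(x in `]1, +oo[) (-1 * f x)) => //.
    by rewrite RintegralZl; [rewrite mulN1r|exact: measurable_itv|exact: i1].
  by rewrite e2 in h; rewrite I12; lra.
pose p := r ^+ 2 - 1; pose q := 1 - L ^+ 2; pose d := p - q.
have dE : A + B - 2 = d by rewrite /A /B /d /p /q; ring.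
have p0 : 0 < p by rewrite /p; nra.
have q0 : 0 < q by rewrite /q; nra.
have p8 : p < 8 by rewrite /p; nra.
have [M1 _ M3] := ellI_moments (ltW L0) LR.
have {}M3 := M3 L0.
rewrite -Psi in M1 M3.
have mE : (r ^+ 2 - L ^+ 2) / 2 = (p + q) / 2 by rewrite /p /q; field.
have cE : (r ^+ 2 + L ^+ 2) / 2 = 1 + d / 2 by rewrite /d /p /q; field.
have dE' : r ^+ 2 + L ^+ 2 - 2 = d by rewrite /d /p /q; ring.
rewrite mE dE' ?cE in M1 M3.
(* [X1] and [X3] are the lower and upper moment bounds, in which [Phi = 0] has replaced [ellI] by
   [pi * d / 4]; the common factor [pi] drops out. *)
have X1 : ((p + q) / 2) ^+ 2 * (8 - 3 * d) <= 16 * d.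
  rewrite -(ler_pM2l pi0); set m2 := ((p + q) / 2) ^+ 2 in M1 *; by nra.
have X3 rho : 0 <= rho -> rho ^+ 2 = 1 + d - p * q ->
     d <= 3 / 8 * (2 + d - 2 * rho) + ((p + q) / 2) ^+ 2 / 8.
  move=> rho0 rho2; have -> : rho = r * L.
    apply/eqP; rewrite -(@eqrXn2 _ 2%N)// ?mulr_ge0//; try lra.
    by rewrite rho2 exprMn /d /p /q; apply/eqP; ring.
  have -> : 2 + d - 2 * (r * L) = (r - L) ^+ 2 by rewrite /d /p /q; ring.
  rewrite -(ler_pM2l pi0); set m2 := ((p + q) / 2) ^+ 2 in M3 *; by nra.
have pq1 : p * q <= 1 + d.
  rewrite -subr_ge0 (_ : 1 + d - p * q = (r * L) ^+ 2) ?sqr_ge0//.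
  by rewrite exprMn /d /p /q; ring.
(* The density plus 1 vanishes on []L, 1[] and is at most its value [R * L] at 0 on []0, L[]; the
   latter relies on [R * L <= 1], that is [d <= p * q]. Hence [D <= pi * P - 2 + 2 * R * L^2]. *)
have hD : d <= p * q -> D <= pi * P - (q + p * q - d).
  move=> dpq; pose g x : R := f x + 1.
  have mg : measurable_fun setT g by exact: measurable_funD.
  have rl1 : (r * L) ^+ 2 <= 1.
    rewrite (_ : (r * L) ^+ 2 = 1 + d - p * q); first by lra.
    by rewrite exprMn /d /p /q; ring.
  have g0 x : 0 <= g x by rewrite /g /f /densAB addrAC addNr add0r divr_ge0// sqrtr_ge0.
  have g1 x : 0 < x < L -> 0 <= g x <= r * L.
    move=> /andP[x0 xL]; rewrite g0 /g /f /densAB addrAC addNr add0r.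
    have u0 : x ^+ 2 - 1 < 0 by nra.
    rewrite ler_pdivrMr ?normr_gt0 ?lt_eqF//.
    have -> : r * L * `|x ^+ 2 - 1| = Num.sqrt (A * B * (x ^+ 2 - 1) ^+ 2).
      rewrite (_ : A * B = (r * L) ^+ 2); last by rewrite /A /B; ring.
      by rewrite -exprMn sqrtr_sqr normrM (ger0_norm (_ : 0 <= r * L))// mulr_ge0//; lra.
    rewrite ler_wsqrtr// -subr_ge0.
    have xA : x ^+ 2 < A by rewrite /A; nra.
    have AB1 : A * B <= 1 by move: rl1; rewrite exprMn mulrC.
    move: (x ^+ 2) (exprn_gt0 2 x0) xA => y y0 yA.
    have -> : A * B * (y - 1) ^+ 2 - (y - B) * (y - A) =
       y * ((A - y) * (1 - A * B) + B * (1 - A) ^+ 2) by ring.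
    rewrite mulr_ge0 ?(ltW y0)// addr_ge0// mulr_ge0 ?sqr_ge0 ?subr_ge0//; lra.
  have gz x : L <= x < 1 -> 0 <= g x <= 0.
    move=> /andP[xL x1]; rewrite g0 /g /f /densAB addrAC addNr add0r ler0_sqrtr ?mul0r ?lexx//.
    by clear -L0 LR r1 R3 xL x1; rewrite mulr_le0_ge0// /A /B; nra.
  have gi : mu.-integrable `]0, 1[ (EFin \o g).
    apply: (bounded_integrable_oo (K := r * L)) => // x /andP[x0 x1].
    have rL0 : 0 <= r * L by rewrite mulr_ge0//; lra.
    rewrite ger0_norm//; have [xL|Lx] := ltP x L.
      by have /andP[] := g1 x (ltac:(by rewrite x0 xL)).
    by have /andP[_ /le_trans] := gz x (ltac:(by rewrite Lx x1)); apply.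
  have gsplit := @Rintegral_split_oo R g 0 L 1 L0 L1 mg (fun x _ => g0 x) gi.
  have /andP[_ J1] := @Rintegral_oo_bound R g 0 L _ L0 mg g1.
  have gz' x : L < x < 1 -> 0 <= g x <= 0 by move=> /andP[h1 h2]; apply: gz; rewrite h2 ltW.
  have /andP[_ J2] := @Rintegral_oo_bound R g L 1 _ L1 mg gz'.
  have I1E : I1 = \int[mu]_(x in `]0, 1[) g x - 1.
    transitivity (\int[mu]_(x in `]0, 1[) (g x - 1)).
      by apply: eq_Rintegral => x _; rewrite /g addrK.
    rewrite RintegralB; [|exact: measurable_itv|exact: gi|].
      by rewrite Rintegral_cst_oo// subr0 mulr1.
    by apply: (bounded_integrable_oo (K := 1)) => // x _; rewrite normr1.
  rewrite /D I1E gsplit; rewrite subr0 in J1; rewrite mul0r in J2.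
  (* [2 * R <= 1 + R^2] makes the bound polynomial in [p] and [q]. *)
  have hp : 2 * (r * L * L) <= 2 - q - p * q + d.
    rewrite -subr_ge0 (_ : _ - _ = L ^+ 2 * (r - 1) ^+ 2); last by rewrite /d /p /q; ring.
    by rewrite mulr_ge0 ?sqr_ge0.
  by lra.
rewrite dE in Dpos.
have [d0 D0 DP] := mass_ineq p0 q0 (erefl d) p8 P0 P2 X1 X3 Dpos pq1 hD.
rewrite /Gt HH DD dE ltr_pdivlMr ?exprn_gt0 ?mulr_gt0//.
rewrite -subr_gt0 (_ : _ - _ = l ^+ 2 * ((pi ^+ 2 * d - D ^+ 2) / 2)); last by field.
by rewrite mulr_gt0 ?exprn_gt0// divr_gt0// subr_gt0.
Qed.

End Assembly.

Theorem theorem5p1 (R : realType) (a : adm_data R) :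
  admissible a ->
  2^-1 <= Gt a /\
  (Gt a = 2^-1 <-> exists l : R, 0 < l /\ measure_of a = scale l (muI R)).
Proof.
case: a => [l l0|l r [l0 Rr]|l r [l0 [r1 rR]]].
- by rewrite typeI//; split => //; split => // _; exists l.
- have h := typeII l0 Rr; split; first exact: ltW.
  split=> [e|[l' [_ e]]]; first by move: h; rewrite e ltxx.
  (* A scaled [muI] has one atom, the measures of types II and III have two. *)
  by have := congr1 (fun m => size (atoms m)) e.
- have h := typeIII l0 r1 rR; split; first exact: ltW.
  split=> [e|[l' [_ e]]]; first by move: h; rewrite e ltxx.
  by have := congr1 (fun m => size (atoms m)) e.
Qed.
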